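(* Let $n\ge0$ be an integer, $d=n+1$, and let $(\mathcal V,\omega)$ be an $\mathsf{NP}$-manifold of degree $n$, presented in homogeneous Darboux coordinates. The morphism of operads $\mathsf{Rep}^{(d)}:\mathsf{Gra}_d\to\mathsf{End}_{\mathscr C^\infty(\mathcal V)}$ induces an injective morphism of differential graded Lie algebras $$s^*\mathsf{Rep}^{(d)}:\big(\mathsf{fGC}_d,\delta,[\cdot,\cdot]\big)\hookrightarrow\big(\mathsf{CE}(\mathcal T^{(n)}_{\rm poly}),\delta_{\mathsf S},[\cdot,\cdot]_{\mathsf{NR}}\big).$$
   Context: Base field $\mathbb K$ of characteristic $0$. $V[k]^m=V^{k+m}$. **Graph operad.** $\mathsf{gra}_{N,k}$: directed multigraphs (multiple edges, tadpoles allowed, not necessarily connected) with vertices labelled $1,\dots,N$ and edges labelled $1,\dots,k$. $\mathsf{Gra}_d(N)$ is the graded vector space of (possibly infinite in $k$, i.e. $\prod_k$) linear combinations of such graphs, each edge having degree $1-d$, modulo: for $d$ even, permuting edge labels multiplies by the signature and flipping an edge direction gives no sign; for $d$ odd, permuting edge labels gives no sign and flipping an edge direction multiplies by $-1$. $\mathbb S_N$ acts on the right (action denoted $\gamma\cdot\sigma$) by relabelling vertex $i$ as $\sigma^{-1}(i)$. Partial composition $\gamma\circ_i\gamma'$: replace vertex $i$ of $\gamma$ by $\gamma'$ and sum over all ways to reattach the edges formerly at $i$ to vertices of $\gamma'$ (labels of vertices of $\gamma'$ shifted by $i-1$, later vertices of $\gamma$ shifted by the number of vertices of $\gamma'$ minus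 one, edges of $\gamma$ before edges of $\gamma'$). **Full graph complex.** $\mathsf{fGC}_d=\prod_{N\ge1}\big(\mathsf{Gra}_d(N)\otimes\mathrm{sgn}_N^{\otimes d}[d(1-N)]\big)^{\mathbb S_N}$; a graph with $N$ vertices and $k$ edges has degree $d(N-1)+k(1-d)$. For $\gamma,\gamma'$ with $N,N'$ vertices, $\gamma\circ\gamma'=\sum_{\sigma\in\mathrm{Sh}^{-1}(N',N-1)}(-1)^{d|\sigma|}(\gamma\circ_1\gamma')\cdot\sigma$ (sum over unshuffles, i.e. inverses of shuffles), $[\gamma_1,\gamma_2]=\gamma_1\circ\gamma_2-(-1)^{|\gamma_1||\gamma_2|}\gamma_2\circ\gamma_1$, and $\delta=[\Gamma,\cdot]$ where $\Gamma$ is the graph with two vertices and one edge from $1$ to $2$ (of degree $1$, with $[\Gamma,\Gamma]=0$). **$\mathsf{NP}$-manifolds.** An $\mathsf{NP}$-manifold of degree $n$ is an $\mathbb N$-graded manifold with a symplectic form $\omega$ of intrinsic degree $n$. Darboux coordinates (degrees in parentheses): $n$ odd: $x^\mu(0),\psi^{\alpha_k}(k),\chi_{\alpha_k}(n-k),p_\mu(n)$, $1\le k\le\frac{n-1}2$, $\omega=dx^\mu\wedge dp_\mu+\sum_kd\psi^{\alpha_k}\wedge d\chi_{\alpha_k}$; $n$ even: $x^\mu(0),\psi^{\alpha_k}(k),\xi^a(n/2),\chi_{\alpha_k}(n-k),p_\mu(n)$, $1\le k\le\frac n2-1$, $\omega=dx^\mu\wedge dp_\mu+\sum_kd\psi^{\alpha_k}\wedge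 d\chi_{\alpha_k}+\frac12\kappa_{ab}d\xi^a\wedge d\xi^b$ with $\kappa$ constant, invertible, $\kappa_{ab}=-(-1)^{n/2}\kappa_{ba}$, inverse $\kappa^{ab}$ (for $n=0$ only $\xi^a$ occur). **Representation.** $\mathsf{Rep}^{(d)}_N(\gamma)(f_1\otimes\cdots\otimes f_N)=\mu_N\big(\prod_{(i,j)\in E_\gamma}\Delta_{ij}(f_1\otimes\cdots\otimes f_N)\big)$, where $\mu_N$ is multiplication, the product follows the edge labels (smallest leftmost), $(i)$ means that the left derivative acts on the $i$-th factor with Koszul signs, and (repeated indices, including $k$, summed) - $d$ even: $\Delta_{ij}=\frac{\partial}{\partial x^\mu_{(i)}}\frac{\partial}{\partial p_\mu^{(j)}}+\frac{\partial}{\partial p_\mu^{(i)}}\frac{\partial}{\partial x^\mu_{(j)}}+\frac{\partial}{\partial\psi^{\alpha_k}_{(i)}}\frac{\partial}{\partial\chi_{\alpha_k}^{(j)}}+\frac{\partial}{\partial\chi_{\alpha_k}^{(i)}}\frac{\partial}{\partial\psi^{\alpha_k}_{(j)}}$; - $d$ odd: $\Delta_{ij}=\frac{\partial}{\partial x^\mu_{(i)}}\frac{\partial}{\partial p_\mu^{(j)}}-\frac{\partial}{\partial p_\mu^{(i)}}\frac{\partial}{\partial x^\mu_{(j)}}+\frac{\partial}{\partial\psi^{\alpha_k}_{(i)}}\frac{\partial}{\partial\chi_{\alpha_k}^{(j)}}-(-1)^k\frac{\partial}{\partial\chi_{\alpha_k}^{(i)}}\frac{\partial}{\partial\psi^{\alpha_k}_{(j)}}+\frac{\partial}{\partial\xi^a_{(i)}}\kappa^{ab}\frac{\partial}{\partial\xi^b_{(j)}}$.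 The Poisson bracket of $\omega$, of degree $-n$, is $\{f,g\}_\omega=\mathsf{Rep}^{(d)}_2(\Gamma)(f\otimes g)$. **Chevalley–Eilenberg algebra.** $\mathcal T^{(n)}_{\rm poly}=\mathscr C^\infty(\mathcal V)[n]$ with suspension $s:\mathcal T^{(n)}_{\rm poly}\to\mathscr C^\infty(\mathcal V)$ of degree $n$, and graded Lie bracket $[\cdot,\cdot]_{\mathsf S}=s^{-1}\circ\{\cdot,\cdot\}_\omega\circ(s\otimes s)$ of degree $0$ (the $n$-Schouten algebra). For a graded vector space $\mathfrak g$, $\mathsf{CE}(\mathfrak g)$ has degree-$m$ part $\prod_{i+j=m}\mathrm{Hom}^i(\mathfrak g^{\wedge(j+1)},\mathfrak g)$, with the Nijenhuis–Richardson bracket $[\cdot,\cdot]_{\mathsf{NR}}$: the graded commutator (for the total degree) of the insertion product antisymmetrised over unshuffles; equivalently the commutator of coderivations of the cofree cocommutative coalgebra on $\mathfrak g[1]$. Its Maurer–Cartan elements are the $\mathsf{Lie}_\infty$-structures on $\mathfrak g$. $\delta_{\mathsf S}=[[\cdot,\cdot]_{\mathsf S},\,\cdot\,]_{\mathsf{NR}}$. The map $s^*\mathsf{Rep}^{(d)}$ sends $\gamma$ with $N$ vertices to $s^{-1}\circ\mathsf{Rep}^{(d)}_N(\gamma)\circ s^{\otimes N}$.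
   Formalization: Injectivity fails for each fixed V (e.g. a point), so it is stated stably: distinct elements of fGC_d have distinct images for every V with enough Darboux coordinates. For n=0, to make infinite sums over edges defined, iterated derivatives of each function must eventually vanish. *)

(* Defs.v *)
(* Mathematical Components; ClassicalEpsilon is used only for [lsum]. *)
From HB Require Import structures.
From mathcomp Require Import all_boot all_order all_fingroup all_algebra.
From Stdlib Require Import ClassicalEpsilon.

Set Implicit Arguments.
Unset Strict Implicit.
Unset Printing Implicit Defensive.

Import Order.TTheory GRing.Theory Num.Theory.
Local Open Scope ring_scope.

(* Throughout, an arity or a number of vertices N >= 1 is written p.+1 and
   components are indexed by p = N - 1; the labels 1, ..., N become the elements
   0, ..., p of 'I_p.+1. *)

(* ------------------------------------------------------------------------ *)
(* Graded Lie algebras with differential                                    *)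
(* ------------------------------------------------------------------------ *)

(* The data of a dg Lie algebra.  Elements of the degree-m part are represented
   by the x with [dgl_deg m x], two of them being equal when [dgl_eq x y]; the
   bracket of elements of degrees a, b is [dgl_br a b], and the differential on
   the degree-a part is [dgl_diff a]. *)
Record dglData (K : fieldType) := DglData {
  dgl_car : Type;
  dgl_lin : K -> dgl_car -> dgl_car -> dgl_car;   (* a, x, y |-> a x + y *)
  dgl_eq : dgl_car -> dgl_car -> Prop;
  dgl_deg : int -> dgl_car -> Prop;
  dgl_br : int -> int -> dgl_car -> dgl_car -> dgl_car;
  dgl_diff : int -> dgl_car -> dgl_car
}.

Record dgl_morphism (K : fieldType) (L L' : dglData K)
    (phi : dgl_car L -> dgl_car L') : Prop := DglMorphism {
  dgl_morph_deg : forall m x, dgl_deg m x -> dgl_deg m (phi x);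
  dgl_morph_eq : forall m x y, dgl_deg m x -> dgl_deg m y ->
    dgl_eq x y -> dgl_eq (phi x) (phi y);
  dgl_morph_lin : forall m a x y, dgl_deg m x -> dgl_deg m y ->
    dgl_eq (phi (dgl_lin a x y)) (dgl_lin a (phi x) (phi y));
  dgl_morph_br : forall m m' x y, dgl_deg m x -> dgl_deg m' y ->
    dgl_eq (phi (dgl_br m m' x y)) (dgl_br m m' (phi x) (phi y));
  dgl_morph_diff : forall m x, dgl_deg m x ->
    dgl_eq (phi (dgl_diff m x)) (dgl_diff m (phi x))
}.

(* ------------------------------------------------------------------------ *)
(* Graphs and the full graph complex                                        *)
(* ------------------------------------------------------------------------ *)

(* A directed multigraph with p.+1 labelled vertices and k labelled edges is the
   list of its k edges (source, target) in the order of the edge labels. *)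
Definition edge (p : nat) : Type := ('I_p.+1 * 'I_p.+1)%type.

(* Possibly infinite combinations of graphs with p.+1 vertices, any number of
   edges, before dividing out by the relations on edges. *)
Definition gra (K : fieldType) (p : nat) : Type := seq (edge p) -> K.

Definition flip_edge (p k : nat) (i : 'I_k) (G : k.-tuple (edge p)) :
    k.-tuple (edge p) :=
  [tuple if j == i then ((tnth G j).2, (tnth G j).1) else tnth G j | j < k].

Definition perm_edges (p k : nat) (t : 'S_k) (G : k.-tuple (edge p)) :
    k.-tuple (edge p) :=
  [tuple tnth G (t j) | j < k].

Definition graph1 (K : fieldType) (p k : nat) (G : k.-tuple (edge p)) :
    {ffun k.-tuple (edge p) -> K^o} := [ffun H => (H == G)%:R].

Definition edge_rels (K : fieldType) (d p k : nat) :
    seq {ffun k.-tuple (edge p) -> K^o} :=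
  [seq graph1 K (perm_edges t G)
       - (if odd d then 1 else (-1) ^+ (t : bool)) *: graph1 K G
     | t <- enum {: 'S_k}, G <- enum {: k.-tuple (edge p)}]
  ++ [seq graph1 K (flip_edge i G) - (if odd d then -1 else 1) *: graph1 K G
     | i <- enum 'I_k, G <- enum {: k.-tuple (edge p)}].

(* Equality in Gra_d(p.+1). *)
Definition gra_eq (K : fieldType) (d p : nat) (g h : gra K p) : Prop :=
  forall k : nat,
    [ffun G : k.-tuple (edge p) => (g G - h G : K^o)] \in <<edge_rels K d p k>>%VS.

(* g . s, where s relabels the vertex i as s^-1 i: the coefficient of G in g . s
   is the coefficient in g of the graph G with every vertex v renamed s v. *)
Definition gra_act (K : fieldType) (p : nat) (g : gra K p) (s : 'S_p.+1) :
    gra K p :=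
  fun G => g [seq (s e.1, s e.2) | e <- G].

(* Insertion of g' (q.+1 vertices) into the first vertex of g (r.+1 vertices),
   with p = r + q.  The graphs occurring in (G1 o_1 G2), each once, are the H ++ G2
   where H is any list of edges that becomes G1 when the vertices 0, ..., q are
   contracted to the vertex 0.  Hence the coefficient of G is read off from the
   ways of cutting G into H and G2. *)
Definition contract_vertex (p q r : nat) (v : 'I_p.+1) : 'I_r.+1 := inord (v - q).

Definition gra_comp1 (K : fieldType) (r q p : nat) (g : gra K r) (g' : gra K q) :
    gra K p :=
  fun G => \sum_(k < (size G).+1 |
                 all (fun e : edge p => (e.1 <= q)%N && (e.2 <= q)%N) (drop k G))
    g [seq (contract_vertex q r e.1, contract_vertex q r e.2) | e : edge p <- take k G]
    * g' [seq (inord e.1, inord e.2) | e : edge p <- drop k G].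

(* (q.+1, p - q)-shuffles. *)
Definition shuffle (p q : nat) (s : 'S_p.+1) : bool :=
  [forall i : 'I_p.+1, forall j : 'I_p.+1, (i < j)%N && ((j <= q)%N || (q < i)%N) ==> (s i < s j)%N].

Definition fgc (K : fieldType) : Type := forall p : nat, gra K p.

Definition fgc_circ (K : fieldType) (d : nat) (g g' : fgc K) : fgc K :=
  fun p G => \sum_(q < p.+1) \sum_(s : 'S_p.+1 | shuffle q (s^-1)%g)
    (-1) ^+ (d * (s : bool))
    * gra_act (gra_comp1 (p := p) (g (p - q)%N) (g' q)) s G.

Definition fgc_br (K : fieldType) (d : nat) (m m' : int) (g g' : fgc K) : fgc K :=
  fun p G => fgc_circ d g g' G - (-1) ^ (m * m') * fgc_circ d g' g G.

(* The graph with two vertices and one edge from the first to the second. *)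
Definition fgc_Gamma (K : fieldType) : fgc K :=
  fun p G => ((p == 1%N) && (G == [:: (inord 0, inord 1)]))%:R.

Definition fgc_deg (K : fieldType) (d : nat) (m : int) (g : fgc K) : Prop :=
  (forall p (G : seq (edge p)), g p G != 0 ->
     d%:Z * p%:Z + (size G)%:Z * (1 - d%:Z) = m) /\
  (forall p (s : 'S_p.+1),
     gra_eq d (gra_act (g p) s) (fun G => (-1) ^+ (d * (s : bool)) * g p G)).

Definition fGC (K : fieldType) (d : nat) : dglData K := {|
  dgl_car := fgc K;
  dgl_lin := fun a g h p G => a * g p G + h p G;
  dgl_eq := fun g h => forall p, gra_eq d (g p) (h p);
  dgl_deg := fgc_deg d;
  dgl_br := fgc_br d;
  dgl_diff := fun m => fgc_br d 1 m (@fgc_Gamma K)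
|}.

(* ------------------------------------------------------------------------ *)
(* NP-manifolds in Darboux coordinates                                      *)
(* ------------------------------------------------------------------------ *)

(* The list of Darboux coordinates, with the constant matrix kappa; together they
   determine the symplectic form.  The pair i consists of psi^i of degree
   [dx_lev i] = k and chi_i of degree n - k; the pairs with k = 0 are the
   (x^mu, p_mu), for which the formulas of omega and of Delta are those of the
   (psi, chi) with k = 0.  Both ranges 1 <= k <= (n - 1) / 2 (n odd) and
   1 <= k <= n / 2 - 1 (n even), extended by 0, say 2 k < n; in particular there
   are no pairs for n = 0. *)
Record darboux (K : fieldType) (n : nat) := Darboux {
  dx_pairs : nat;
  dx_lev : 'I_dx_pairs -> nat;
  dx_levP : forall i, ((dx_lev i).*2 < n)%N;
  dx_xi : nat;
  dx_xi_odd : odd n -> dx_xi = 0%N;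
  dx_kappa : 'M[K]_dx_xi;
  dx_kappa_unit : dx_kappa \in unitmx;
  dx_kappa_sym : forall a b, dx_kappa a b = - ((-1) ^+ n./2 * dx_kappa b a)
}.

Inductive coord (K : fieldType) (n : nat) (X : darboux K n) : Type :=
  | Psi of 'I_(dx_pairs X)
  | Chi of 'I_(dx_pairs X)
  | Xi of 'I_(dx_xi X).

Arguments Psi {K n X}.
Arguments Chi {K n X}.
Arguments Xi {K n X}.

Definition coord_to_sum (K : fieldType) (n : nat) (X : darboux K n) (c : coord X) :
    'I_(dx_pairs X) + 'I_(dx_pairs X) + 'I_(dx_xi X) :=
  match c with Psi i => inl (inl i) | Chi i => inl (inr i) | Xi a => inr a end.
Definition sum_to_coord (K : fieldType) (n : nat) (X : darboux K n)
    (t : 'I_(dx_pairs X) + 'I_(dx_pairs X) + 'I_(dx_xi X)) : coord X :=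
  match t with inl (inl i) => Psi i | inl (inr i) => Chi i | inr a => Xi a end.
Lemma coord_to_sumK (K : fieldType) (n : nat) (X : darboux K n) :
  cancel (@coord_to_sum K n X) (@sum_to_coord K n X).
Proof. by case. Qed.
HB.instance Definition _ (K : fieldType) (n : nat) (X : darboux K n) :=
  Finite.copy (coord X) (can_type (@coord_to_sumK K n X)).

Definition cdeg (K : fieldType) (n : nat) (X : darboux K n) (c : coord X) : nat :=
  match c with
  | Psi i => dx_lev i
  | Chi i => n - dx_lev i
  | Xi _ => n./2
  end.

(* Exponents of the monomials in the coordinates of positive degree. *)
Definition admissible (K : fieldType) (n : nat) (X : darboux K n)
    (e : {ffun coord X -> nat}) : bool :=
  [forall c, ((cdeg c == 0%N) ==> (e c == 0%N)) && (odd (cdeg c) ==> (e c <= 1)%N)].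

Definition monomial (K : fieldType) (n : nat) (X : darboux K n) (A : algType K)
    (z : coord X -> A) (e : {ffun coord X -> nat}) : A :=
  \prod_(c : coord X) z c ^+ e c.

(* An NP-manifold of degree n in a global homogeneous Darboux chart, through its
   graded algebra of functions C^oo(V).  The functions of degree 0 on the body form
   a commutative K-algebra with coordinate functions and partial derivatives about
   which nothing else is assumed, so that smooth functions (K = R) and polynomials
   are both covered; over it, the functions are free on the monomials in the
   coordinates of positive degree.  [np_diff c] is the left derivative d/dc.
   For n = 0 infinitely many edges contribute to Rep, hence [np_loc]. *)
Record npManifold (K : fieldType) (n : nat) := NPManifold {
  np_dx :> darboux K n;
  np_fun : algType K;
  np_pr : nat -> {linear np_fun -> np_fun};   (* homogeneous components *)
  np_crd : coord np_dx -> np_fun;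
  np_diff : coord np_dx -> {linear np_fun -> np_fun};
  np_pr_fin : forall f, exists M, f = \sum_(m < M) np_pr m f;
  np_pr_pr : forall m m' f, np_pr m (np_pr m' f) = if m == m' then np_pr m f else 0;
  np_pr_1 : np_pr 0 1 = 1;
  np_pr_mul : forall m m' f g, np_pr m f = f -> np_pr m' g = g ->
    np_pr (m + m') (f * g) = f * g;
  np_comm : forall m m' f g, np_pr m f = f -> np_pr m' g = g ->
    f * g = (-1) ^+ (m * m') *: (g * f);
  np_crd_deg : forall c, np_pr (cdeg c) (np_crd c) = np_crd c;
  np_diff_crd : forall c c', np_diff c (np_crd c') = (c == c')%:R;
  np_diff_deg : forall c m f, np_pr m f = f ->
    if (cdeg c <= m)%N then np_pr (m - cdeg c) (np_diff c f) = np_diff c f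
    else np_diff c f = 0;
  np_diff_mul : forall c m f g, np_pr m f = f ->
    np_diff c (f * g) = np_diff c f * g + (-1) ^+ (cdeg c * m) *: (f * np_diff c g);
  np_diff_comm : forall c c' f,
    np_diff c (np_diff c' f) = (-1) ^+ (cdeg c * cdeg c') *: np_diff c' (np_diff c f);
  np_gen : forall f, exists (s : seq {ffun coord np_dx -> nat})
      (b : {ffun coord np_dx -> nat} -> np_fun),
    [/\ all (@admissible K n np_dx) s, forall e, np_pr 0 (b e) = b e
      & f = \sum_(e <- s) b e * monomial np_crd e];
  np_free : forall (s : seq {ffun coord np_dx -> nat})
      (b : {ffun coord np_dx -> nat} -> np_fun),
    uniq s -> all (@admissible K n np_dx) s -> (forall e, np_pr 0 (b e) = b e) ->
    \sum_(e <- s) b e * monomial np_crd e = 0 -> forall e, e \in s -> b e = 0;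
  np_loc : n = 0%N -> forall f, exists r, forall s : seq (coord np_dx),
    (r <= size s)%N -> foldr (fun c => np_diff c) f s = 0
}.

(* The number of coordinates.  The representation on a single V has a kernel: if V
   is a point, every graph with an edge is represented by 0; if n is odd, a graph
   with N vertices and more than N * [dx_pairs V] edges is, since each edge removes
   an odd coordinate at one of its ends.  Injectivity is a statement about all V of
   large dimension. *)
Definition np_dim (K : fieldType) (n : nat) (V : npManifold K n) : nat :=
  (dx_pairs V).*2 + dx_xi V.

(* Sum of a sequence whose terms eventually vanish. *)
Definition lsum (A : zmodType) (u : nat -> A) : A :=
  epsilon (inhabits 0)
    (fun x => exists M, forall M', (M <= M')%N -> \sum_(k < M') u k = x).

(* Component of f of parity b. *)
Definition fpar (K : fieldType) (n : nat) (V : npManifold K n) (b : bool)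
    (f : np_fun V) : np_fun V :=
  lsum (fun m => if odd m == b then np_pr V m f else 0).

(* (-1)^(k |f|) f *)
Definition fsign (K : fieldType) (n : nat) (V : npManifold K n) (k : nat)
    (f : np_fun V) : np_fun V :=
  fpar false f + (-1) ^+ k *: fpar true f.

(* ------------------------------------------------------------------------ *)
(* The representation                                                       *)
(* ------------------------------------------------------------------------ *)

(* Maps (C^oo(V))^(p.+1) -> C^oo(V); those that matter are multilinear, that is,
   linear maps on the tensor power. *)
Definition nmap (K : fieldType) (n : nat) (V : npManifold K n) (p : nat) : Type :=
  {ffun 'I_p.+1 -> np_fun V} -> np_fun V.

(* d/dc acting on the i-th factor of f_0 (x) ... (x) f_p, with Koszul sign
   (-1)^(|c| (|f_0| + ... + |f_(i-1)|)). *)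
Definition diff_at (K : fieldType) (n : nat) (V : npManifold K n) (p : nat)
    (c : coord V) (i : 'I_p.+1) (f : {ffun 'I_p.+1 -> np_fun V}) :
    {ffun 'I_p.+1 -> np_fun V} :=
  [ffun l : 'I_p.+1 => if (l < i)%N then fsign (cdeg c) (f l)
             else if l == i then np_diff c (f l) else f l].

(* M o Delta_(ij), for d = n.+1. *)
Definition comp_Delta (K : fieldType) (n : nat) (V : npManifold K n) (p : nat)
    (M : nmap V p) (e : edge p) : nmap V p :=
  let: (i, j) := e in fun f =>
  \sum_(a < dx_pairs V)
     (M (diff_at (Psi a) i (diff_at (Chi a) j f))
      + (if odd n.+1 then - (-1) ^+ dx_lev a else 1)
          *: M (diff_at (Chi a) i (diff_at (Psi a) j f)))
  + \sum_(a < dx_xi V) \sum_(b < dx_xi V)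
      invmx (dx_kappa V) a b *: M (diff_at (Xi a) i (diff_at (Xi b) j f)).

(* mu_N o Delta_(e_1) o ... o Delta_(e_k), for the graph with edges e_1, ..., e_k. *)
Definition rep_graph (K : fieldType) (n : nat) (V : npManifold K n) (p : nat)
    (G : seq (edge p)) : nmap V p :=
  foldl (@comp_Delta K n V p) (fun f => \prod_(i < p.+1) f i) G.

Arguments rep_graph {K n} V {p} G f.

Definition Rep (K : fieldType) (n : nat) (V : npManifold K n) (p : nat)
    (g : gra K p) : nmap V p :=
  fun f => lsum (fun k => \sum_(G : k.-tuple (edge p)) g G *: rep_graph V G f).

Definition poisson (K : fieldType) (n : nat) (V : npManifold K n) : nmap V 1 :=
  rep_graph V [:: (inord 0, inord 1)].

Arguments poisson {K n} V f.

(* ------------------------------------------------------------------------ *)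
(* The Chevalley-Eilenberg algebra of T = C^oo(V)[n]                        *)
(* ------------------------------------------------------------------------ *)

(* T has the same elements as C^oo(V), and s is the identity map.  A function of
   degree m has degree m - n in T. *)

(* Component of x whose parity in T is b. *)
Definition tpar (K : fieldType) (n : nat) (V : npManifold K n) (b : bool)
    (x : np_fun V) : np_fun V := fpar (b (+) odd n) x.

(* s (x) ... (x) s on x_0 (x) ... (x) x_p: the Koszul rule gives the sign
   \prod_i (-1)^(n (p - i) |x_i|), the degrees being those in T. *)
Definition susp (K : fieldType) (n : nat) (V : npManifold K n) (p : nat)
    (x : {ffun 'I_p.+1 -> np_fun V}) : {ffun 'I_p.+1 -> np_fun V} :=
  [ffun i : 'I_p.+1 => tpar false (x i) + (-1) ^+ (n * (p - i)) *: tpar true (x i)].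

Definition sRep (K : fieldType) (n : nat) (V : npManifold K n) (g : fgc K) :
    forall p, nmap V p :=
  fun p x => Rep (g p) (susp x).

Arguments sRep {K n} V g p x.

(* x |-> the sum over the parities e of the homogeneous components of the x_i of
   +- F (x_(s 0), ..., x_(s p)), with the Koszul sign (degrees in T) of the
   permutation x_0, ..., x_p |-> x_(s 0), ..., x_(s p). *)
Definition koszul (p : nat) (s : 'S_p.+1) (e : {ffun 'I_p.+1 -> bool}) : nat :=
  \sum_(i < p.+1) \sum_(j < p.+1 | (i < j)%N && (s j < s i)%N) (e (s i) && e (s j)).

Definition permute_args (K : fieldType) (n : nat) (V : npManifold K n) (p : nat)
    (F : nmap V p) (s : 'S_p.+1) : nmap V p :=
  fun x => \sum_(e : {ffun 'I_p.+1 -> bool})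
    (-1) ^+ koszul s e *: F [ffun i : 'I_p.+1 => tpar (e (s i)) (x (s i))].

(* F (G (x_0, ..., x_q), x_(q+1), ..., x_p) *)
Definition insert1 (K : fieldType) (n : nat) (V : npManifold K n) (r q p : nat)
    (F : nmap V r) (G : nmap V q) : nmap V p :=
  fun x => F [ffun j : 'I_r.+1 =>
    if j == ord0 then G [ffun i : 'I_q.+1 => x (inord i)] else x (inord (q + j))].

(* Insertion product for G of total degree m', so that its component of arity q.+1
   has degree m' - q as a map T^(q.+1) -> T.  The first sign is the one for which
   F |-> F', F' o t^(x (p.+1)) = t o F, with t : T -> T[1] the degree -1 suspension,
   turns the insertion product into that of symmetric maps (coderivations) on
   T[1]. *)
Definition nr_circ (K : fieldType) (n : nat) (V : npManifold K n) (m' : int)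
    (F G : forall p, nmap V p) : forall p, nmap V p :=
  fun p x => \sum_(q < p.+1) (-1) ^ ((p - q)%N%:Z * (m' - q%:Z) : int)
    *: \sum_(s : 'S_p.+1 | shuffle q s)
         (-1) ^+ (s : bool) *: permute_args (insert1 (F (p - q)%N) (G q)) s x.

Definition nr_br (K : fieldType) (n : nat) (V : npManifold K n) (m m' : int)
    (F G : forall p, nmap V p) : forall p, nmap V p :=
  fun p x => nr_circ m' F G x - (-1) ^ (m * m') *: nr_circ m G F x.

(* The n-Schouten bracket, as an element of CE(T). *)
Definition schouten (K : fieldType) (n : nat) (V : npManifold K n) :
    forall p, nmap V p :=
  fun p => match p with 1%N => fun x => poisson V (susp x) | _ => fun _ => 0 end.

Arguments schouten {K n} V p.

Definition multilinear (K : fieldType) (n : nat) (V : npManifold K n) (p : nat)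
    (F : nmap V p) : Prop :=
  forall (i : 'I_p.+1) (a : K) (u v : np_fun V) (x : {ffun 'I_p.+1 -> np_fun V}),
    let upd w := [ffun j => if j == i then w else x j] in
    F (upd (a *: u + v)) = a *: F (upd u) + F (upd v).

Definition homog (K : fieldType) (n : nat) (V : npManifold K n) (m : int)
    (f : np_fun V) : Prop :=
  match m with Posz a => np_pr V a f = f | Negz _ => f = 0 end.

(* The condition that a map T^(p.+1) -> T has degree i, in terms of the degrees
   of functions. *)
Definition map_deg (K : fieldType) (n : nat) (V : npManifold K n) (p : nat)
    (i : int) (F : nmap V p) : Prop :=
  forall (a : 'I_p.+1 -> nat) (x : {ffun 'I_p.+1 -> np_fun V}),
    (forall j, np_pr V (a j) (x j) = x j) ->
    homog (\sum_(j < p.+1) ((a j)%:Z - n%:Z) + i + n%:Z) (F x).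

Definition ce_deg (K : fieldType) (n : nat) (V : npManifold K n) (m : int)
    (F : forall p, nmap V p) : Prop :=
  forall p,
    [/\ multilinear (F p), map_deg (m - p%:Z) (F p)
      & forall (s : 'S_p.+1) x, permute_args (F p) s x = (-1) ^+ (s : bool) *: F p x].

Definition CE_Tpoly (K : fieldType) (n : nat) (V : npManifold K n) : dglData K := {|
  dgl_car := forall p, nmap V p;
  dgl_lin := fun a F G p x => a *: F p x + G p x;
  dgl_eq := fun F G => forall p x, F p x = G p x;
  dgl_deg := @ce_deg K n V;
  dgl_br := @nr_br K n V;
  dgl_diff := fun m => nr_br 1 m (schouten V)
|}.

(* Main.v *)
(* Rep commutes with insertion because derivations satisfy the Leibniz rule: a
   derivative of mu(f_0, ..., f_q) is the sum over the vertices of the inserted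
   graph of the derivatives of the f_v, which are the ways of reattaching an edge.
   The relations on edges hold since the operators Delta_ij have degree -n, hence
   commute up to (-1)^n, and Delta_ji = (-1)^d Delta_ij.  The suspension turns
   Koszul signs of functions into those of T, the discrepancy being the sign of the
   permutation to the power n, i.e. the twist by sgn^d.

   For injectivity, let k be the least number of edges for which the difference of
   the two elements is nonzero in Gra_d.  In characteristic 0 its coefficients can
   be averaged to a function phi on graphs which is alternating under the relations.
   Pick G0 with phi G0 <> 0 and, for V large, one pair (u_e, v_e) of coordinate
   linear forms for each edge e of G0, orthogonal for different edges and with
   nonzero pairing within an edge.  Evaluate on the functions f_i which are the
   products of the u_e with e starting at i and of the v_e with e ending at i.  The
   graphs with more than k edges vanish on f, and those with k edges contribute
   2^k k! phi(G0) times a nonzero constant, since each relabelling and reorientation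
   of G0 contributes the same. *)
Require Import Defs.
From HB Require Import structures.
From mathcomp Require Import all_boot all_order all_fingroup all_algebra.
From mathcomp Require Import ring zify.
From Stdlib Require Import ClassicalEpsilon FunctionalExtensionality.

Set Implicit Arguments.
Unset Strict Implicit.
Unset Printing Implicit Defensive.

Import Order.TTheory GRing.Theory Num.Theory.
Local Open Scope ring_scope.
Local Notation coord := Defs.coord.

(** * Sums over tuples and signs of permutations *)

Definition tsum (T : finType) (A : nmodType) (k : nat) (phi : seq T -> A) : A :=
  \sum_(G : k.-tuple T) phi G.

Section TupleSums.
Variables (T : finType) (A : nmodType).
Implicit Type phi : seq T -> A.

Lemma tsum0 phi : tsum 0 phi = phi [::].
Proof.
rewrite /tsum (big_pred1 [tuple]) // => G; exact/esym/eqP/tuple0.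
Qed.

Lemma tsumS k phi : tsum k.+1 phi = \sum_(e : T) tsum k (fun G => phi (e :: G)).
Proof.
rewrite /tsum pair_bigA /=.
rewrite (reindex (fun eG : T * k.-tuple T => [tuple of eG.1 :: eG.2])) //=.
exists (fun G => (thead G, [tuple of behead G])) => [[e G] _|G _] /=.
  by congr (_, _); apply/val_inj.
by rewrite [RHS]tuple_eta.
Qed.

Lemma eq_tsum k phi phi' :
  (forall G, size G = k -> phi G = phi' G) -> tsum k phi = tsum k phi'.
Proof. by move=> E; apply: eq_bigr => G _; rewrite E ?size_tuple. Qed.

Lemma tsum_cat j k phi :
  tsum (j + k) phi = tsum j (fun H => tsum k (fun G => phi (H ++ G))).
Proof.
elim: j phi => [|j IH] phi; first by rewrite tsum0.
by rewrite addSn !tsumS; apply: eq_bigr => e _; rewrite IH.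
Qed.

Lemma tsum1 phi : tsum 1 phi = \sum_(e : T) phi [:: e].
Proof. by rewrite tsumS; apply: eq_bigr => e _; rewrite tsum0. Qed.

Lemma tsum_rcons k phi :
  tsum k.+1 phi = tsum k (fun G => \sum_(e : T) phi (rcons G e)).
Proof.
rewrite -addn1 tsum_cat; apply: eq_tsum => G _.
by rewrite tsum1; apply: eq_bigr => e _; rewrite cats1.
Qed.

Lemma tsum_sum k (I : finType) (P : pred I) (phi : I -> seq T -> A) :
  tsum k (fun G => \sum_(i | P i) phi i G) = \sum_(i | P i) tsum k (phi i).
Proof. exact: exchange_big. Qed.

Lemma tsum_perm k (t : T -> T) phi : injective t ->
  tsum k (fun G => phi (map t G)) = tsum k phi.
Proof.
move=> tI; elim: k phi => [|k IH] phi; first by rewrite !tsum0.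
rewrite !tsumS [RHS](reindex_inj tI) /=; apply: eq_bigr => e _.
by rewrite -(IH (fun G => phi (t e :: G))).
Qed.

Lemma tsum_partition (S : finType) k (c : T -> S) phi :
  tsum k phi = \sum_(G : k.-tuple S) \sum_(H : k.-tuple T | map c H == G) phi H.
Proof.
rewrite /tsum (partition_big (fun H : k.-tuple T => map_tuple c H) predT) //=.
Qed.

End TupleSums.

Lemma lsum_eq (A : zmodType) (u : nat -> A) (M : nat) :
  (forall k, (M <= k)%N -> u k = 0) -> lsum u = \sum_(k < M) u k.
Proof.
move=> u0.
have stab M' : (M <= M')%N -> \sum_(k < M') u k = \sum_(k < M) u k.
  move=> leM; rewrite -!(big_mkord predT u) (big_cat_nat (n := M)) //=.
  rewrite big_mkord big_nat_cond [X in _ + X]big1 ?addr0 // => k.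
  by case/andP=> /andP[/u0].
rewrite /lsum; set P := fun _ => _.
have /(epsilon_spec (inhabits 0)) [M' PM'] : exists x, P x.
  by exists (\sum_(k < M) u k); exists M.
by rewrite -/P -(PM' (maxn M M')) ?leq_maxr // stab ?leq_maxl.
Qed.

Lemma lsum_single (A : zmodType) (u : nat -> A) (k : nat) :
  (forall j, j != k -> u j = 0) -> lsum u = u k.
Proof.
move=> u0; rewrite (@lsum_eq _ _ k.+1) => [|j ltkj]; last by rewrite u0 ?gtn_eqF.
by rewrite big_ord_recr big1 /= ?add0r // => i _; rewrite u0 // ltn_eqF.
Qed.

Section SortSign.
Variables (K : fieldType) (A : lmodType K) (n : nat).
Variables (phi : seq 'I_n -> A) (eps : 'I_n -> 'I_n -> K).
Hypothesis swap : forall s1 x y s2,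
  phi (s1 ++ x :: y :: s2) = eps x y *: phi (s1 ++ y :: x :: s2).

Fixpoint ins (x : 'I_n) (s : seq 'I_n) :=
  if s is y :: s' then if (y < x)%N then y :: ins x s' else x :: s else [:: x].

Fixpoint isort (s : seq 'I_n) := if s is x :: s' then ins x (isort s') else [::].

Fixpoint inv_sign (s : seq 'I_n) : K :=
  if s is x :: s' then (\prod_(y <- s' | (y < x)%N) eps x y) * inv_sign s' else 1.

Let ltI (x y : 'I_n) := (x <= y)%N.

Lemma ltI_trans : transitive ltI. Proof. by move=> y x z; apply: leq_trans. Qed.

Lemma perm_ins x s : perm_eq (ins x s) (x :: s).
Proof.
elim: s => //= y s IH; case: ifP => // _.
by rewrite -(perm_cons y) in IH; rewrite (perm_trans IH) // (perm_catCA [:: y] [:: x]).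
Qed.

Lemma perm_isort s : perm_eq (isort s) s.
Proof. by elim: s => //= x s IH; rewrite (perm_trans (perm_ins _ _)) ?perm_cons. Qed.

Lemma sorted_ins x s : sorted ltI s -> sorted ltI (ins x s).
Proof.
elim: s => //= y s IH; case: ifP => [yx|/negbT]; last first.
  by rewrite -leqNgt => xy ps /=; rewrite /ltI xy.
rewrite /= !(path_sortedE ltI_trans) => /andP[ay ss]; rewrite IH // andbT.
by rewrite (perm_all _ (perm_ins x s)) /= /ltI (ltnW yx) ay.
Qed.

Lemma sorted_isort s : sorted ltI (isort s).
Proof. by elim: s => //= x s IH; apply: sorted_ins. Qed.

Lemma phi_ins s1 x s : sorted ltI s ->
  phi (s1 ++ x :: s) = (\prod_(y <- s | (y < x)%N) eps x y) *: phi (s1 ++ ins x s).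
Proof.
elim: s s1 => [|y s IH] s1 ss; first by rewrite big_nil scale1r.
rewrite big_cons /=; case: ifP => [yx|/negbT].
  rewrite swap -cat_rcons IH ?(path_sorted ss) // cat_rcons scalerA.
  by [].
rewrite -leqNgt => xy; rewrite big_seq_cond big_pred0 ?scale1r // => z.
apply/negP=> /andP[zs zx]; move: ss; rewrite /= (path_sortedE ltI_trans).
by case/andP=> /allP /(_ _ zs); rewrite /ltI => yz _; move: (leq_trans xy yz); rewrite leqNgt zx.
Qed.

Lemma phi_isort s1 s : phi (s1 ++ s) = inv_sign s *: phi (s1 ++ isort s).
Proof.
elim: s s1 => [|x s IH] s1 /=; first by rewrite scale1r.
rewrite -cat_rcons IH cat_rcons phi_ins ?sorted_isort // scalerA mulrC.
by rewrite (perm_big _ (perm_isort s)).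
Qed.

Lemma inv_sign_map (t : 'I_n -> 'I_n) (r : seq 'I_n) :
  sorted (fun i j : 'I_n => (i < j)%N) r ->
  inv_sign (map t r) =
  \prod_(i <- r) \prod_(j <- r | (i < j)%N && (t j < t i)%N) eps (t i) (t j).
Proof.
have ltT : transitive (fun i j : 'I_n => (i < j)%N) by move=> y x z; apply: ltn_trans.
elim: r => [|x r IH] /= sr; first by rewrite big_nil.
rewrite IH ?(path_sorted sr) // !big_cons ltnn /=; move: sr.
rewrite (path_sortedE ltT) => /andP[/allP xr _]; congr (_ * _).
  rewrite big_map big_seq_cond [RHS]big_seq_cond; apply: eq_bigl => j.
  by case jr: (j \in r) => //=; rewrite xr.
rewrite big_seq [RHS]big_seq; apply: eq_bigr => i ir; rewrite big_cons.
by rewrite ltnNge ltnW ?xr.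
Qed.

Lemma phi_perm (t : 'S_n) :
  phi [seq t i | i <- enum 'I_n] =
  (\prod_(i < n) \prod_(j < n | (i < j)%N && (t j < t i)%N) eps (t i) (t j))
    *: phi (enum 'I_n).
Proof.
have so : sorted (fun i j : 'I_n => (i < j)%N) (enum 'I_n).
  by have := iota_ltn_sorted 0 n; rewrite -val_enum_ord sorted_map.
rewrite -[LHS]/(phi ([::] ++ _)) phi_isort inv_sign_map // big_enum /=.
under eq_bigr => i _ do rewrite big_enum_cond /=.
congr (_ *: phi _); apply: (sorted_eq ltI_trans) => //.
- by move=> x y /anti_leq /val_inj.
- exact: sorted_isort.
- by apply: sub_sorted so => x y; apply: ltnW.
rewrite (perm_trans (perm_isort _)) // uniq_perm ?enum_uniq //.
  by rewrite map_inj_uniq ?enum_uniq //; apply: perm_inj.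
move=> x; rewrite !mem_enum; apply/mapP; exists (t^-1 x)%g; rewrite ?mem_enum //.
by rewrite permKV.
Qed.

End SortSign.

Definition inversions (n : nat) (t : 'S_n) : nat :=
  \sum_(i < n) \sum_(j < n | (i < j)%N && (t j < t i)%N) 1.

(* The Vandermonde determinant of 0, ..., n - 1 is positive, and a permutation
   of the points changes its sign by both sides. *)
Lemma odd_inversions (n : nat) (t : 'S_n) : odd (inversions t) = t.
Proof.
pose a : 'rV[int]_n := \row_i (i : nat)%:Z.
have VE (b : 'rV[int]_n) : col_perm t (Vandermonde n b) = Vandermonde n (\row_i b 0 (t i)).
  by apply/matrixP => i j; rewrite !mxE.
have : sgz (\det (col_perm t (Vandermonde n a))) = (-1) ^+ (t : bool).
  rewrite col_permE det_mulmx det_perm sgzM det_Vandermonde odd_permV.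
  rewrite (_ : sgz (\prod_(i < n) _) = 1) ?mul1r.
    by case: (odd_perm t).
  apply: gtr0_sgz; apply: prodr_gt0 => i _; apply: prodr_gt0 => j ij.
  by rewrite !mxE subr_gt0 ltz_nat.
rewrite VE det_Vandermonde.
rewrite (big_morph _ (@sgzM int) (sgz1 int)).
under eq_bigr => i _ do rewrite (big_morph _ (@sgzM int) (sgz1 int)).
have -> : \prod_(i < n) \prod_(j < n | (i < j)%N)
     sgz ((\row_i a 0 (t i)) 0 j - (\row_i a 0 (t i)) 0 i) = (-1) ^+ inversions t.
  rewrite /inversions -prodrXr; apply: eq_bigr => i _; rewrite -prodrXr big_mkcondr /=.
  apply: eq_bigr => j ij; rewrite !mxE.
  case: ifPn => [ltji|]; first by rewrite ltr0_sgz // subr_lt0 ltz_nat.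
  rewrite -leqNgt leq_eqVlt => /orP[/eqP/val_inj/perm_inj eij|ltij].
    by rewrite eij ltnn in ij.
  by rewrite gtr0_sgz // subr_gt0 ltz_nat.
rewrite -signr_odd => /eqP; case: (odd _); case: (odd_perm t) => //.
Qed.

(** * Parities of functions *)

Arguments fpar : simpl never.
Arguments fsign : simpl never.

Section Parity.
Variables (K : fieldType) (n : nat) (V : npManifold K n).
Implicit Types (f g : np_fun V) (b : bool) (k : nat) (c : coord V).

Lemma np_pr_vanish f : exists M, forall m, (M <= m)%N -> np_pr V m f = 0.
Proof.
have [M defM] := np_pr_fin f; exists M => m leMm; rewrite defM raddf_sum big1 //= => i _.
by rewrite np_pr_pr gtn_eqF // (leq_trans (ltn_ord i)).
Qed.

Lemma homog_ind (P : np_fun V -> Prop) :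
  (forall f g, P f -> P g -> P (f + g)) -> P 0 ->
  (forall m f, np_pr V m f = f -> P f) -> forall f, P f.
Proof.
move=> PD P0 Ph f; have [M ->] := np_pr_fin f.
elim/big_ind: _ => // i _; apply: (Ph i); by rewrite np_pr_pr eqxx.
Qed.

Lemma fparE b f M : (forall m, (M <= m)%N -> np_pr V m f = 0) ->
  fpar b f = \sum_(m < M) if odd m == b then np_pr V m f else 0.
Proof. by move=> f0; apply: lsum_eq => m /f0 ->; case: ifP. Qed.

Lemma fpar_linear b : linear (@fpar K n V b).
Proof.
move=> a f g; have [M fM] := np_pr_vanish f; have [M' gM] := np_pr_vanish g.
have fN m : (maxn M M' <= m)%N -> np_pr V m f = 0.
  by rewrite geq_max => /andP[/fM].
have gN m : (maxn M M' <= m)%N -> np_pr V m g = 0.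
  by rewrite geq_max => /andP[_ /gM].
have fgN m : (maxn M M' <= m)%N -> np_pr V m (a *: f + g) = 0.
  by move=> le; rewrite linearP fN // gN // scaler0 addr0.
rewrite (fparE _ fN) (fparE _ gN) (fparE _ fgN) scaler_sumr -big_split /=.
by apply: eq_bigr => i _; case: ifP; rewrite ?scaler0 ?addr0 // linearP.
Qed.
HB.instance Definition _ b :=
  GRing.isLinear.Build K (np_fun V) (np_fun V) _ (@fpar K n V b) (fpar_linear b).

Lemma fpar_homog b m f : np_pr V m f = f -> fpar b f = if odd m == b then f else 0.
Proof.
move=> fm; rewrite [LHS](@lsum_single _ _ m) ?fm // => j jm.
by rewrite -fm np_pr_pr (negbTE jm); case: ifP.
Qed.

Lemma fpar_add f : fpar false f + fpar true f = f.
Proof.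
elim/homog_ind: f => [f g|| m f fm]; last 1 first.
- by rewrite !(fpar_homog _ fm); case: odd; rewrite ?addr0 ?add0r.
- by move=> Ef Eg; rewrite !raddfD /= addrACA Ef Eg.
by rewrite !raddf0 addr0.
Qed.

Lemma fpar_fpar b b' f : fpar b (fpar b' f) = if b == b' then fpar b f else 0.
Proof.
elim/homog_ind: f => [f g|| m f fm]; last 1 first.
- rewrite !(fpar_homog _ fm) (fun_if (fpar b)) raddf0 (fpar_homog _ fm).
  by case: b b' (odd m) => [] [] [].
- by move=> Ef Eg; rewrite !raddfD /= Ef Eg; case: ifP; rewrite ?addr0.
by rewrite !raddf0; case: ifP.
Qed.

Lemma fpar_id b f : fpar b (fpar b f) = fpar b f.
Proof. by rewrite fpar_fpar eqxx. Qed.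

Lemma fpar_ind (P : np_fun V -> Prop) b :
  (forall f g, P f -> P g -> P (f + g)) -> P 0 ->
  (forall m f, odd m = b -> np_pr V m f = f -> P f) -> forall f, fpar b f = f -> P f.
Proof.
move=> PD P0 Ph f fb; rewrite -fb; elim/homog_ind: f {fb} => [f g Pf Pg||m f fm].
- by rewrite raddfD; apply: PD.
- by rewrite raddf0.
by rewrite (fpar_homog _ fm); case: eqP => // bm; apply: Ph bm fm.
Qed.

Lemma fpar_comm b b' f g : fpar b f = f -> fpar b' g = g ->
  f * g = (-1) ^+ (b && b') *: (g * f).
Proof.
move=> fb; move: g; apply: fpar_ind => [g g' Eg Eg'||m' g gb' gm].
- by rewrite mulrDl mulrDr scalerDr Eg Eg'.
- by rewrite mulr0 mul0r scaler0.
move: f fb; apply: fpar_ind => [f f' Ef Ef'||m f fb fm].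
- by rewrite mulrDl mulrDr scalerDr Ef Ef'.
- by rewrite mulr0 mul0r scaler0.
by rewrite (np_comm fm gm) -signr_odd oddM fb gb'.
Qed.

Lemma fsign_linear k : linear (@fsign K n V k).
Proof.
by move=> a f g; rewrite /fsign !linearP /= !scalerDr !scalerA mulrC addrACA.
Qed.
HB.instance Definition _ k :=
  GRing.isLinear.Build K (np_fun V) (np_fun V) _ (@fsign K n V k) (fsign_linear k).

Lemma fparD b f g : fpar b (f + g) = fpar b f + fpar b g.
Proof. exact: linearD. Qed.

Lemma fparZ b a f : fpar b (a *: f) = a *: fpar b f.
Proof. exact: linearZ. Qed.

Lemma fsignD k f g : fsign k (f + g) = fsign k f + fsign k g.
Proof. exact: linearD. Qed.

Lemma fsignZ k a f : fsign k (a *: f) = a *: fsign k f.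
Proof. exact: linearZ. Qed.

Lemma fsign_fpar k b f : fsign k (fpar b f) = (-1) ^+ (k * b) *: fpar b f.
Proof.
by rewrite /fsign !fpar_fpar; case: b; rewrite /= ?muln1 ?muln0 ?scaler0 ?scale1r ?add0r ?addr0.
Qed.

Lemma fsign_homog k m f : np_pr V m f = f -> fsign k f = (-1) ^+ (k * m) *: f.
Proof.
move=> fm; have <- : fpar (odd m) f = f by rewrite (fpar_homog _ fm) eqxx.
by rewrite fsign_fpar -signr_odd -[in RHS]signr_odd !oddM oddb.
Qed.

Lemma fpar_fsign k b f : fpar b (fsign k f) = (-1) ^+ (k * b) *: fpar b f.
Proof.
rewrite /fsign raddfD /= linearZ /= !fpar_fpar.
by case: b; rewrite /= ?muln1 ?muln0 ?scaler0 ?scale1r ?add0r ?addr0.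
Qed.

Lemma fsign_fsign k l f : fsign k (fsign l f) = fsign (k + l) f.
Proof.
rewrite {1}/fsign !fpar_fsign muln0 scale1r muln1 /fsign.
by rewrite scalerA -exprD.
Qed.

Lemma fsign_even k f : ~~ odd k -> fsign k f = f.
Proof.
by move=> ek; rewrite /fsign -signr_odd (negbTE ek) scale1r fpar_add.
Qed.

Lemma fsign1 k : fsign k (1 : np_fun V) = 1.
Proof. by rewrite (fsign_homog _ (np_pr_1 V)) muln0 scale1r. Qed.

Lemma fsign_mul k f g : fsign k (f * g) = fsign k f * fsign k g.
Proof.
elim/homog_ind: f => [f f' Ef Ef'||m f fm]; first by rewrite mulrDl !raddfD /= mulrDl Ef Ef'.
  by rewrite mul0r !raddf0 mul0r.
elim/homog_ind: g => [g g' Eg Eg'||m' g gm]; first by rewrite mulrDr !raddfD /= mulrDr Eg Eg'.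
  by rewrite mulr0 !raddf0 mulr0.
rewrite (fsign_homog _ (np_pr_mul fm gm)) (fsign_homog _ fm) (fsign_homog _ gm).
by rewrite -scalerAl -scalerAr scalerA mulnDr exprD.
Qed.

Lemma fsign_prod k (I : Type) (r : seq I) (P : pred I) (F : I -> np_fun V) :
  fsign k (\prod_(i <- r | P i) F i) = \prod_(i <- r | P i) fsign k (F i).
Proof. exact: (big_morph _ (fsign_mul k) (fsign1 k)). Qed.

Lemma np_diff_fpar c b f : np_diff c (fpar b f) = fpar (b (+) odd (cdeg c)) (np_diff c f).
Proof.
elim/homog_ind: f => [f g Ef Eg|| m f fm]; first by rewrite !raddfD /= Ef Eg.
  by rewrite !raddf0.
rewrite (fpar_homog _ fm); have := np_diff_deg c fm.
case: leqP => [lecm fcm|_ E]; last by case: ifP; rewrite ?E ?raddf0.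
rewrite (fpar_homog _ fcm) oddB // (fun_if (np_diff c)) raddf0.
by case: (odd m) b (odd (cdeg c)) => [] [] [].
Qed.

Lemma fpar_np_diff c b f : fpar b (np_diff c f) = np_diff c (fpar (b (+) odd (cdeg c)) f).
Proof. by rewrite np_diff_fpar addbK. Qed.

Lemma np_diff_fsign c k f :
  np_diff c (fsign k f) = (-1) ^+ (k * cdeg c) *: fsign k (np_diff c f).
Proof.
rewrite -[f in LHS]fpar_add fsignD !fsign_fpar linearD !linearZ /= !np_diff_fpar.
rewrite -[np_diff c f]fpar_add fsignD !fsign_fpar !fpar_np_diff !np_diff_fpar scalerDr !scalerA.
rewrite muln0 muln1 scale1r mulr1 -exprD.
rewrite -(signr_odd _ (k * cdeg c)) -(signr_odd _ (k * cdeg c + k)) -(signr_odd _ k) oddD oddM.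
by case: (odd (cdeg c)); rewrite ?andbT ?andbF ?addbb ?addFb ?scale1r /= fpar_add // addrC.
Qed.

Lemma np_diffM c f g : np_diff c (f * g) = np_diff c f * g + fsign (cdeg c) f * np_diff c g.
Proof.
elim/homog_ind: f => [f f' Ef Ef'||m f fm].
- rewrite mulrDl fsignD (linearD (np_diff c)) Ef Ef' addrACA -mulrDl -mulrDl.
  by rewrite -(linearD (np_diff c)).
- by rewrite mul0r !raddf0 !mul0r addr0.
by rewrite (np_diff_mul _ _ fm) (fsign_homog _ fm) scalerAl.
Qed.

Lemma np_diff1 c : np_diff c 1 = 0.
Proof.
have := np_diffM c 1 1; rewrite fsign1 !mul1r mulr1 => /esym/eqP.
by rewrite addrC -subr_eq0 addrK => /eqP.
Qed.

End Parity.

(** * The operators Delta *)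

Section Weights.
Variables (K : fieldType) (n : nat) (X : darboux K n).

(* Delta_ij = \sum_(c, c') weight c c' d/dc_(i) d/dc'_(j) *)
Definition weight (c c' : coord X) : K :=
  match c, c' with
  | Psi a, Chi b => (a == b)%:R
  | Chi a, Psi b => if a == b then (if odd n.+1 then - (-1) ^+ dx_lev a else 1) else 0
  | Xi a, Xi b => invmx (dx_kappa X) a b
  | _, _ => 0
  end.

Definition flip_sign : K := if odd n.+1 then -1 else 1.

Lemma flip_signM : flip_sign * flip_sign = 1.
Proof. by rewrite /flip_sign; case: odd; rewrite ?mulrNN mulr1. Qed.

Lemma xi_even (a : 'I_(dx_xi X)) : odd n = false.
Proof. by apply/negP=> /(dx_xi_odd X) x0; move: a; rewrite x0 => -[]. Qed.

Lemma weight_deg c c' : weight c c' != 0 -> (cdeg c + cdeg c')%N = n.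
Proof.
have lev a : (dx_lev (d := X) a <= n)%N.
  by apply: leq_trans (ltnW (dx_levP a)); rewrite -addnn leq_addr.
case: c c' => [a|a|a] [b|b|b] /=; rewrite ?eqxx //.
- by case: (a =P b) => [->|]; rewrite ?eqxx // subnKC.
- by case: (a =P b) => [->|]; rewrite ?eqxx // subnK.
by rewrite addnn halfK (xi_even a) subn0.
Qed.

Lemma inv_kappa_sym a b :
  invmx (dx_kappa X) b a = - (-1) ^+ n./2 * invmx (dx_kappa X) a b.
Proof.
set s := - _; have ss : s * s = 1 by rewrite mulrNN -expr2 sqrr_sign.
have us : s \is a GRing.unit by apply/unitrP; exists s.
have kT : (dx_kappa X)^T = s *: dx_kappa X.
  by apply/matrixP => i j; rewrite !mxE dx_kappa_sym mulNr.
have : (invmx (dx_kappa X))^T = s *: invmx (dx_kappa X).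
  rewrite trmx_inv kT invmxZ ?unitmxZ ?dx_kappa_unit //.
  by rewrite (_ : s^-1 = s) //; apply: (mulrI us); rewrite divrr.
by move/matrixP/(_ a b); rewrite !mxE.
Qed.

Lemma weight_flip c c' :
  weight c' c * (-1) ^+ (cdeg c * cdeg c') = flip_sign * weight c c'.
Proof.
rewrite /flip_sign.
have sgn a : (-1) ^+ (dx_lev (d := X) a * (n - dx_lev a)) =
    if odd n then 1 else (-1) ^+ dx_lev a :> K.
  rewrite -signr_odd oddM oddB; last first.
    by apply: leq_trans (ltnW (dx_levP a)); rewrite -addnn leq_addr.
  by rewrite -(signr_odd _ (dx_lev a)); case: (odd n) (odd _) => [] [].
case: c c' => [a|a|a] [b|b|b] /=; rewrite ?mul0r ?mulr0 //.
- rewrite eq_sym; case: eqP => [<-|]; rewrite ?mul0r ?mulr0 ?mulr1 //= sgn.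
  by case: (odd n); rewrite /= ?mul1r // mulNr -expr2 sqrr_sign.
- rewrite eq_sym; case: eqP => [<-|]; rewrite ?mul0r ?mulr0 ?mulr1 ?mul1r //= mulnC sgn.
  by case: (odd n); rewrite /= ?mul1r // mulN1r opprK.
rewrite inv_kappa_sym (xi_even a) /= -(signr_odd _ (_ * _)) oddM andbb signr_odd.
by rewrite mulrAC mulNr -expr2 sqrr_sign.
Qed.

Lemma sum_coord (A : nmodType) (F : coord X -> A) :
  \sum_c F c = \sum_a F (Psi a) + \sum_a F (Chi a) + \sum_a F (Xi a).
Proof.
rewrite (reindex (@sum_to_coord K n X)) /=; last first.
  exists (@coord_to_sum K n X) => [t _|c _]; last exact: coord_to_sumK.
  by case: t => [[]|].
by rewrite !big_sumType.
Qed.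

End Weights.

Section Multilinear.
Variables (K : fieldType) (n : nat) (V : npManifold K n) (p : nat).
Implicit Types (M : nmap V p) (f : {ffun 'I_p.+1 -> np_fun V}) (i j : 'I_p.+1).
Implicit Types (c : coord V) (e : edge p) (G : seq (edge p)).

Definition upd f i (w : np_fun V) : {ffun 'I_p.+1 -> np_fun V} :=
  [ffun j => if j == i then w else f j].

Definition cmap (h : 'I_p.+1 -> np_fun V -> np_fun V) f :
    {ffun 'I_p.+1 -> np_fun V} := [ffun i => h i (f i)].

Lemma multilinear_upd M f i a u v : multilinear M ->
  M (upd f i (a *: u + v)) = a *: M (upd f i u) + M (upd f i v).
Proof. exact. Qed.

Lemma mlin0 M f i : multilinear M -> M (upd f i 0) = 0.
Proof.
move=> Mm; have := multilinear_upd f i 1 0 0 Mm; rewrite !scale1r addr0 => /esym/eqP.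
by rewrite -subr_eq0 addrK => /eqP.
Qed.

Lemma mlin_zero M f i : multilinear M -> f i = 0 -> M f = 0.
Proof.
move=> Mm fi; rewrite -(mlin0 f i Mm); congr M; apply/ffunP => j; rewrite ffunE.
by case: eqP => [->|].
Qed.

Lemma mlin_scale M f f' i a : multilinear M ->
  (forall j, j != i -> f j = f' j) -> f i = a *: f' i -> M f = a *: M f'.
Proof.
move=> Mm E Ei.
have -> : f = upd f' i (a *: f' i + 0).
  apply/ffunP => j; rewrite ffunE addr0; case: eqP => [->//|/eqP]; exact: E.
rewrite multilinear_upd // mlin0 // addr0; congr (_ *: M _).
by apply/ffunP => j; rewrite ffunE; case: eqP => [->|].
Qed.

Lemma mlinZ M f (a : 'I_p.+1 -> K) : multilinear M ->
  M [ffun i => a i *: f i] = (\prod_i a i) *: M f.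
Proof.
move=> Mm.
suff H (r : seq 'I_p.+1) : uniq r ->
    M [ffun i => if i \in r then a i *: f i else f i] = (\prod_(i <- r) a i) *: M f.
  rewrite -[\prod_i a i]big_enum -H ?enum_uniq //; congr M.
  by apply/ffunP => i; rewrite !ffunE mem_enum.
elim: r => [_|i r IH /= /andP[ir ur]].
  by rewrite big_nil scale1r; congr M; apply/ffunP => i; rewrite ffunE.
rewrite big_cons -scalerA -IH //; apply: (mlin_scale (i := i)) => // [j ji|].
  by rewrite !ffunE inE (negbTE ji).
by rewrite !ffunE inE eqxx (negbTE ir).
Qed.

Lemma multilinear_cmap M h : multilinear M ->
  (forall i, linear (h i)) -> multilinear (fun f => M (cmap h f)).
Proof.
move=> Mm hl i a u v f upd0.
have E w : cmap h (upd0 w) = upd (cmap h f) i (h i w).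
  by apply/ffunP => j; rewrite !ffunE; case: eqP => [->|].
by rewrite !E hl multilinear_upd.
Qed.

Lemma multilinearZ M b : multilinear M -> multilinear (fun f => b *: M f).
Proof. by move=> Mm i a u v f upd0; rewrite /upd0 Mm scalerDr !scalerA mulrC. Qed.

Lemma multilinear_sum (I : Type) (r : seq I) (P : pred I) (M : I -> nmap V p) :
  (forall k : I, multilinear (M k)) -> multilinear (fun f => \sum_(k <- r | P k) M k f).
Proof.
move=> Mm i a u v f upd0; rewrite scaler_sumr -big_split /=.
by apply: eq_bigr => k _; rewrite /upd0 Mm.
Qed.

Lemma multilinear_prod : multilinear (fun f : {ffun 'I_p.+1 -> np_fun V} => \prod_(i < p.+1) f i).
Proof.
move=> i a u v f upd0.
have: i \in index_enum 'I_p.+1 by rewrite mem_index_enum.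
have upd_out w r : i \notin r -> \prod_(j <- r) upd0 w j = \prod_(j <- r) f j.
  move=> ir; apply: eq_big_seq => j jr; rewrite ffunE; case: eqP => // ji.
  by rewrite -ji jr in ir.
have := index_enum_uniq 'I_p.+1; elim: (index_enum _) => // j r IH /= /andP[jr ur].
rewrite inE !big_cons !ffunE eq_sym; case: eqP => [ji _|_ /= ir].
  by rewrite ji in jr; rewrite !upd_out // mulrDl scalerAl.
by rewrite IH // mulrDr scalerAr.
Qed.

End Multilinear.

Section RepGraph.
Variables (K : fieldType) (n : nat) (V : npManifold K n) (p : nat).
Implicit Types (M : nmap V p) (f : {ffun 'I_p.+1 -> np_fun V}) (i j : 'I_p.+1).
Implicit Types (c : coord V) (e : edge p) (G : seq (edge p)).

Lemma diff_at_lt c i f (l : 'I_p.+1) : (l < i)%N -> diff_at c i f l = fsign (cdeg c) (f l).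
Proof. by rewrite ffunE => ->. Qed.

Lemma diff_at_eq c i f : diff_at c i f i = np_diff c (f i).
Proof. by rewrite ffunE ltnn eqxx. Qed.

Lemma diff_at_gt c i f (l : 'I_p.+1) : (i < l)%N -> diff_at c i f l = f l.
Proof. by move=> il; rewrite ffunE ltnNge (ltnW il) /= -val_eqE /= gtn_eqF. Qed.

Lemma multilinear_diff_at M c i : multilinear M -> multilinear (fun f => M (diff_at c i f)).
Proof.
move=> Mm; pose h (l : 'I_p.+1) (u : np_fun V) :=
  if (l < i)%N then fsign (cdeg c) u else if l == i then np_diff c u else u.
apply: (@multilinear_cmap _ _ _ _ M h) => // l a u v; rewrite /h.
by case: ifP => _; [exact: fsign_linear|case: ifP => _ //; exact: linearP].
Qed.

Lemma diff_at_comm_lt M c c' i j f : multilinear M -> (i < j)%N ->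
  M (diff_at c i (diff_at c' j f)) =
  (-1) ^+ (cdeg c * cdeg c') *: M (diff_at c' j (diff_at c i f)).
Proof.
move=> Mm ij; apply: (mlin_scale (i := i)) => // [l li|]; last first.
  by rewrite diff_at_eq !(diff_at_lt _ _ ij) diff_at_eq np_diff_fsign mulnC.
case: (ltngtP l i) li => [li _|il _|/val_inj ->]; last by rewrite eqxx.
  by rewrite !(diff_at_lt _ _ li) !(diff_at_lt _ _ (ltn_trans li ij)) !(diff_at_lt _ _ li)
    !fsign_fsign addnC.
rewrite (diff_at_gt _ _ il); case: (ltngtP l j) => [lj|jl|/val_inj lj].
- by rewrite !(diff_at_lt _ _ lj) (diff_at_gt _ _ il).
- by rewrite !(diff_at_gt _ _ jl) (diff_at_gt _ _ il).
by rewrite lj !diff_at_eq (diff_at_gt _ _ ij).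
Qed.

Lemma diff_at_comm M c c' i j f : multilinear M ->
  M (diff_at c i (diff_at c' j f)) =
  (-1) ^+ (cdeg c * cdeg c') *: M (diff_at c' j (diff_at c i f)).
Proof.
move=> Mm; case: (ltngtP i j) => [ij|ji|/val_inj <-].
- exact: diff_at_comm_lt.
- by rewrite (diff_at_comm_lt c' c f Mm ji) mulnC signrZK.
apply: (mlin_scale (i := i)) => // [l li|]; last first.
  by rewrite !diff_at_eq np_diff_comm.
case: (ltngtP l i) li => [li _|il _|/val_inj ->]; last by rewrite eqxx.
  by rewrite !(diff_at_lt _ _ li) !fsign_fsign addnC.
by rewrite !(diff_at_gt _ _ il).
Qed.

Lemma comp_DeltaE M e f :
  comp_Delta M e f = \sum_(q : coord V * coord V)
    weight q.1 q.2 *: M (diff_at q.1 e.1 (diff_at q.2 e.2 f)).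
Proof.
rewrite -(pair_bigA _ (fun c c' => weight c c' *: M (diff_at c e.1 (diff_at c' e.2 f)))) /=.
case: e => i j /=; rewrite sum_coord; congr (_ + _).
  rewrite -big_split /=; apply: eq_bigr => a _; rewrite !sum_coord /=.
  rewrite [X in X + _ + _ + _]big1 ?add0r => [|b _]; last by rewrite scale0r.
  rewrite [X in _ + X + _]big1 ?addr0 => [|b _]; last by rewrite scale0r.
  rewrite [X in _ + (_ + X + _)]big1 ?addr0 => [|b _]; last by rewrite scale0r.
  rewrite [X in _ + (_ + X)]big1 ?addr0 => [|b _]; last by rewrite scale0r.
  rewrite (bigD1 a) //= eqxx scale1r big1 ?addr0 => [|b /negbTE ba]; last first.
    by rewrite eq_sym ba scale0r.
  rewrite (bigD1 a) //= eqxx [X in _ + (_ + X)]big1 ?addr0 // => b /negbTE ba.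
  by rewrite eq_sym ba scale0r.
apply: eq_bigr => a _; rewrite sum_coord /=.
rewrite [X in X + _ + _]big1 ?add0r => [|b _]; last by rewrite scale0r.
by rewrite [X in X + _]big1 ?add0r => [|b _]; last by rewrite scale0r.
Qed.

Lemma multilinear_comp_Delta M e : multilinear M -> multilinear (comp_Delta M e).
Proof.
move=> Mm.
rewrite (functional_extensionality _ _ (comp_DeltaE M e)).
apply: multilinear_sum => -[c c']; apply: multilinearZ.
by have := multilinear_diff_at c' e.2 (multilinear_diff_at c e.1 Mm).
Qed.

Lemma comp_Delta_lin (I : Type) (r : seq I) (P : pred I) (a : I -> K) (M : I -> nmap V p) e :
  comp_Delta (fun f => \sum_(k <- r | P k) a k *: M k f) e =
  fun f => \sum_(k <- r | P k) a k *: comp_Delta (M k) e f.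
Proof.
apply: functional_extensionality => f; rewrite comp_DeltaE.
under [RHS]eq_bigr => k _ do rewrite comp_DeltaE scaler_sumr.
rewrite exchange_big /=; apply: eq_bigr => -[c c'] _.
rewrite scaler_sumr; apply: eq_bigr => k _; by rewrite !scalerA mulrC.
Qed.

Lemma foldl_Delta_lin (I : Type) (r : seq I) (P : pred I) (a : I -> K) (M : I -> nmap V p) G :
  foldl (@comp_Delta K n V p) (fun f => \sum_(k <- r | P k) a k *: M k f) G =
  fun f => \sum_(k <- r | P k) a k *: foldl (@comp_Delta K n V p) (M k) G f.
Proof. by elim: G M => //= e G IH M; rewrite comp_Delta_lin IH. Qed.

Lemma foldl_Delta_scale a M G :
  foldl (@comp_Delta K n V p) (fun f => a *: M f) G =
  fun f => a *: foldl (@comp_Delta K n V p) M G f.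
Proof.
have := foldl_Delta_lin [:: tt] xpredT (fun=> a) (fun=> M) G.
have E M' : (fun f => \sum_(k <- [:: tt]) a *: M' f) = (fun f => a *: M' f) :> nmap V p.
  by apply: functional_extensionality => f; rewrite big_seq1.
by rewrite !E.
Qed.

Lemma multilinear_rep G : multilinear (rep_graph V G).
Proof.
elim/last_ind: G => [|G e IH]; first exact: multilinear_prod.
by rewrite /rep_graph -cats1 foldl_cat; apply: multilinear_comp_Delta.
Qed.

Lemma rep_rcons G e f : rep_graph V (rcons G e) f = comp_Delta (rep_graph V G) e f.
Proof. by rewrite /rep_graph -cats1 foldl_cat. Qed.

Lemma comp_Delta_swap M e e' f : multilinear M ->
  comp_Delta (comp_Delta M e) e' f = (-1) ^+ n *: comp_Delta (comp_Delta M e') e f.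
Proof.
move=> Mm; rewrite !comp_DeltaE scaler_sumr.
under eq_bigr => q _ do rewrite comp_DeltaE scaler_sumr.
under [RHS]eq_bigr => q _ do rewrite comp_DeltaE !scaler_sumr.
rewrite exchange_big /=; apply: eq_bigr => -[a a'] _; apply: eq_bigr => -[c c'] _ /=.
have [->|wa] := eqVneq (weight a a') 0; first by rewrite !scale0r !scaler0.
have [->|wc] := eqVneq (weight c c') 0; first by rewrite !scale0r !scaler0.
have m1 := multilinear_diff_at a e.1 Mm.
have m2 := multilinear_diff_at c e'.1 Mm.
rewrite (diff_at_comm a' c e.2 e'.1 (diff_at c' e'.2 f) m1).
rewrite (diff_at_comm a c e.1 e'.1 _ Mm).
rewrite (diff_at_comm a' c' e.2 e'.2 f (multilinear_diff_at a e.1 m2)).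
rewrite (diff_at_comm a c' e.1 e'.2 (diff_at a' e.2 f) m2).
rewrite !scalerA; congr (_ *: _).
have -> : (-1) ^+ n = (-1) ^+ (cdeg a' * cdeg c) * (-1) ^+ (cdeg a * cdeg c) *
    (-1) ^+ (cdeg a' * cdeg c') * (-1) ^+ (cdeg a * cdeg c') :> K.
  rewrite -!exprD -addnA -mulnDl -mulnDl -mulnDr.
  rewrite (addnC (cdeg a')) (weight_deg wa) (weight_deg wc).
  by rewrite -signr_odd -[in RHS]signr_odd oddM andbb.
move: (_ ^+ (cdeg a' * cdeg c)) (_ ^+ (cdeg a * cdeg c)) (_ ^+ (cdeg a' * cdeg c')) (_ ^+ (cdeg
  a * cdeg c')).
by move: (weight a a') (weight c c') => x y s1 s2 s3 s4; ring.
Qed.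

End RepGraph.

Lemma mktuple_mapE (T : Type) (k : nat) (F : 'I_k -> T) :
  [tuple F j | j < k] = [seq F j | j <- enum 'I_k] :> seq T.
Proof. by []. Qed.

Lemma tuple_mapE (T : Type) (k : nat) (G : k.-tuple T) :
  G = [seq tnth G j | j <- enum 'I_k] :> seq T.
Proof. by rewrite map_tnth_enum. Qed.

Lemma span_ind (K : fieldType) (vT : vectType K) (A : lmodType K)
    (Phi : vT -> A) (s : seq vT) (v : vT) : linear Phi ->
  (forall u, u \in s -> Phi u = 0) -> v \in <<s>>%VS -> Phi v = 0.
Proof.
move=> Phi_lin s0 vs.
pose PhiL := GRing.isLinear.Build K vT A _ Phi Phi_lin.
pose PhiF : {linear vT -> A} := HB.pack Phi PhiL.
rewrite -[Phi v]/(PhiF v) (coord_span (X := in_tuple s) vs) linear_sum big1 //= => i _.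
by rewrite -[Phi _]/(PhiF _) linearZ /= s0 ?scaler0 // mem_nth.
Qed.

Section RepRelations.
Variables (K : fieldType) (n : nat) (V : npManifold K n) (p : nat).
Implicit Types (M : nmap V p) (f : {ffun 'I_p.+1 -> np_fun V}) (i j : 'I_p.+1).
Implicit Types (c : coord V) (e : edge p) (G : seq (edge p)).

Lemma comp_Delta_flip M i j f : multilinear M ->
  comp_Delta M (j, i) f = flip_sign K n *: comp_Delta M (i, j) f.
Proof.
move=> Mm; rewrite !comp_DeltaE scaler_sumr /=.
rewrite (reindex_inj (h := fun q : coord V * coord V => (q.2, q.1))) /=; last first.
  by move=> [a a'] [b b'] [-> ->].
by apply: eq_bigr => -[c c'] _ /=; rewrite diff_at_comm // !scalerA mulnC weight_flip.
Qed.

Lemma rep_swap G1 e e' G2 f :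
  rep_graph V (G1 ++ e :: e' :: G2) f = (-1) ^+ n *: rep_graph V (G1 ++ e' :: e :: G2) f.
Proof.
rewrite /rep_graph !foldl_cat /= -/(rep_graph V G1).
rewrite (functional_extensionality _ _ (fun f => comp_Delta_swap e e' f (multilinear_rep (V :=
  V) G1))).
by rewrite foldl_Delta_scale.
Qed.

Lemma rep_flip G1 i j G2 f :
  rep_graph V (G1 ++ (j, i) :: G2) f = flip_sign K n *: rep_graph V (G1 ++ (i, j) :: G2) f.
Proof.
rewrite /rep_graph !foldl_cat -/(rep_graph V G1).
have foldl1 e : foldl (@comp_Delta K n V p) (rep_graph V G1) (e :: G2) =
  foldl (@comp_Delta K n V p) (comp_Delta (rep_graph V G1) e) G2 by [].
rewrite !foldl1 (functional_extensionality _ _ (fun f => comp_Delta_flip i j f (multilinear_rep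
  (V := V) G1))).
by rewrite foldl_Delta_scale.
Qed.

Lemma rep_perm_edges k (t : 'S_k) (G : k.-tuple (edge p)) f :
  rep_graph V (perm_edges t G) f =
  (if odd n.+1 then 1 else (-1) ^+ (t : bool)) *: rep_graph V G f.
Proof.
pose phi s := rep_graph V [seq tnth G l | l <- s] f.
have sw s1 x y s2 : phi (s1 ++ x :: y :: s2) = (-1) ^+ n *: phi (s1 ++ y :: x :: s2).
  by rewrite /phi !map_cat rep_swap.
transitivity (phi [seq t l | l <- enum 'I_k]); first by rewrite /phi -map_comp.
rewrite (phi_perm sw t) [in RHS]tuple_mapE; congr (_ *: _).
under eq_bigr => i _ do rewrite prodrXr.
rewrite prodrXr.
rewrite (_ : \sum_(i < k) _ = n * inversions t)%N; last first.
  rewrite /inversions big_distrr; apply: eq_bigr => i _ /=.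
  by rewrite big_distrr; apply: eq_bigr => j _ /=; rewrite muln1.
by rewrite -(signr_odd _ (n * _)) oddM odd_inversions /=; case: (odd n).
Qed.

Lemma rep_flip_edge k (i : 'I_k) (G : k.-tuple (edge p)) f :
  rep_graph V (flip_edge i G) f = flip_sign K n *: rep_graph V G f.
Proof.
rewrite mktuple_mapE [in RHS]tuple_mapE.
have := enum_uniq 'I_k; have iin : i \in enum 'I_k by rewrite mem_enum.
case/splitPr: (enum _) / iin => s1 s2; rewrite cat_uniq /= => /and3P[_ i1 /andP[i2 _]].
have out (s : seq 'I_k) : i \notin s ->
    [seq if l == i then ((tnth G l).2, (tnth G l).1) else tnth G l | l <- s] =
    [seq tnth G l | l <- s].
  move=> is_; apply/eq_in_map => l ls; case: eqP => // li.
  by rewrite -li ls in is_.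
rewrite !map_cat /= eqxx !out //; last by apply: contra i1 => /= ->.
by rewrite rep_flip; case: (tnth G i).
Qed.

Lemma rep_span k (phi : {ffun k.-tuple (edge p) -> K^o}) f :
  phi \in <<edge_rels K n.+1 p k>>%VS -> \sum_G phi G *: rep_graph V G f = 0.
Proof.
pose Phi (phi : {ffun k.-tuple (edge p) -> K^o}) := \sum_G phi G *: rep_graph V G f.
have Phi_lin : linear Phi.
  move=> a u v; rewrite /Phi scaler_sumr -big_split; apply: eq_bigr => G _ /=.
  by rewrite !ffunE scalerA -scalerDl.
apply: (span_ind Phi_lin) => u.
have Phi1 (G : k.-tuple (edge p)) : Phi (graph1 K G) = rep_graph V G f.
  rewrite /Phi (bigD1 G) //= ffunE eqxx scale1r big1 ?addr0 // => H /negbTE HG.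
  by rewrite ffunE HG scale0r.
rewrite mem_cat => /orP[] /allpairsP[[t G] /= [_ _ ->]].
  by rewrite addrC -scaleNr Phi_lin !Phi1 rep_perm_edges scaleNr addNr.
by rewrite addrC -scaleNr Phi_lin !Phi1 rep_flip_edge scaleNr addNr.
Qed.

Lemma Rep_gra_eq (g h : gra K p) f : gra_eq n.+1 g h -> Rep (V := V) g f = Rep h f.
Proof.
move=> gh; rewrite /Rep; congr lsum; apply: functional_extensionality => k.
apply/eqP; rewrite -subr_eq0 -sumrB; apply/eqP.
rewrite -[RHS](rep_span f (gh k)).
by apply: eq_bigr => G _; rewrite ffunE scalerBl.
Qed.

Definition gra_fin (g : gra K p) : Prop :=
  n = 0%N \/ exists M : nat, forall G, (M <= size G)%N -> g G = 0.

Definition rep_vanish (g : gra K p) f (M : nat) : Prop :=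
  forall G, (M <= size G)%N -> g G *: rep_graph V G f = 0.

Lemma rep_vanish_le g f (M M' : nat) : (M <= M')%N -> rep_vanish g f M -> rep_vanish g f M'.
Proof. by move=> le v G /(leq_trans le)/v. Qed.

Definition rank_le (r : 'I_p.+1 -> nat) f : Prop :=
  forall i (s : seq (coord V)), (r i <= size s)%N -> foldr (fun c => np_diff c) (f i) s = 0.

Lemma cdeg_n0 c : n = 0%N -> cdeg c = 0%N.
Proof.
move=> n0; have lev a := @dx_levP _ _ V a.
by case: c => a /=; [have := lev a|have := lev a|]; lia.
Qed.

Lemma rank_le_diff_at r c i f : n = 0%N -> rank_le r f ->
  rank_le (fun l => if l == i then (r i).-1 else r l) (diff_at c i f).
Proof.
move=> n0 rf l s; rewrite ffunE; case: ltnP => [li|_].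
  have -> : l == i = false by rewrite -val_eqE /= ltn_eqF.
  by rewrite fsign_even ?cdeg_n0 //; apply: rf.
case: eqP => [->|_]; last exact: rf.
move=> rs; rewrite -[LHS]/(foldr (fun c => np_diff c) (foldr (fun c => np_diff c) (f i) [:: c]) s).
by rewrite -foldr_cat; apply: rf; rewrite size_cat addn1; case: (r i) rs.
Qed.

Lemma rank_rep0 G r f : n = 0%N -> rank_le r f -> (\sum_i r i < size G)%N ->
  rep_graph V G f = 0.
Proof.
move=> n0; elim/last_ind: G r f => [|G [i j] IH] r f rf; first by rewrite ltn0.
rewrite size_rcons ltnS => lt; rewrite rep_rcons comp_DeltaE big1 // => -[c c'] _ /=.
have r1 := @rank_le_diff_at _ c' j _ n0 rf; have r2 := @rank_le_diff_at _ c i _ n0 r1.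
have [ri0|ri] := posnP (r i).
  have fi0 : f i = 0 by apply: (rf i [::]); rewrite ri0.
  rewrite (mlin_zero (i := i)) ?scaler0 //; first exact: multilinear_rep.
  by rewrite diff_at_eq ffunE fi0; do ?case: ifP => _; rewrite raddf0 // raddf0.
rewrite (IH _ _ r2) ?scaler0 //; apply: leq_trans lt.
rewrite (bigD1 i) //= [X in (_ < X)%N](bigD1 i) //= eqxx.
rewrite -addSn leq_add //.
  by case: eqP => [ij|_]; rewrite -?ij; case: (r i) ri => //= -[].
apply: leq_sum => l /negbTE li; rewrite li; case: eqP => [->|//]; exact: leq_pred.
Qed.

Lemma rep_vanishP g f : gra_fin g -> exists M : nat, rep_vanish g f M.
Proof.
case=> [n0|[M gM]]; last by exists M => G /gM ->; rewrite scale0r.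
have [r rP] : exists r : 'I_p.+1 -> nat, forall i (s : seq (coord V)),
    (r i <= size s)%N -> foldr (fun c => np_diff c) (f i) s = 0.
  apply: (fin_all_exists (P := fun i k => forall s : seq (coord V),
    (k <= size s)%N -> foldr (fun c => np_diff c) (f i) s = 0)) => i.
  exact: np_loc.
by exists (\sum_i r i).+1 => G lt; rewrite (rank_rep0 n0 rP) ?scaler0.
Qed.

Lemma RepE g f (M : nat) : rep_vanish g f M ->
  Rep g f = \sum_(k < M) tsum k (fun G => g G *: rep_graph V G f).
Proof.
move=> gM; apply: lsum_eq => k leMk; apply: big1 => G _.
by rewrite gM // size_tuple.
Qed.

Lemma multilinear_Rep g : gra_fin g -> multilinear (Rep (V := V) g).
Proof.
move=> gfin i a u v f upd0.
have [M1 v1] := rep_vanishP (upd0 (a *: u + v)) gfin.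
have [M2 v2] := rep_vanishP (upd0 u) gfin.
have [M3 v3] := rep_vanishP (upd0 v) gfin.
pose M := maxn M1 (maxn M2 M3).
rewrite (RepE (rep_vanish_le (M' := M) _ v1)) ?leq_maxl //.
rewrite (RepE (rep_vanish_le (M' := M) _ v2)); last by rewrite leq_max leq_maxl orbT.
rewrite (RepE (rep_vanish_le (M' := M) _ v3)); last by rewrite leq_max leq_maxr orbT.
rewrite scaler_sumr -big_split; apply: eq_bigr => k _ /=.
rewrite /tsum scaler_sumr -big_split; apply: eq_bigr => G _ /=.
by rewrite (multilinear_rep (V := V) G) scalerDr !scalerA mulrC.
Qed.

Lemma Rep_lin (a : K) g h f : gra_fin g -> gra_fin h ->
  Rep (V := V) (fun G => a * g G + h G) f = a *: Rep g f + Rep h f.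
Proof.
move=> gfin hfin; have [M1 v1] := rep_vanishP f gfin; have [M2 v2] := rep_vanishP f hfin.
pose M := maxn M1 M2.
have w1 := rep_vanish_le (leq_maxl M1 M2) v1; have w2 := rep_vanish_le (leq_maxr M1 M2) v2.
rewrite (RepE w1) (RepE w2) (@RepE _ _ (maxn M1 M2)) => [|G leMG]; last first.
  by rewrite scalerDl -scalerA w1 // w2 // scaler0 addr0.
rewrite scaler_sumr -big_split; apply: eq_bigr => k _ /=.
rewrite /tsum scaler_sumr -big_split; apply: eq_bigr => G _ /=.
by rewrite scalerDl -scalerA.
Qed.

End RepRelations.

(** * Insertion of graphs *)

Lemma uniform_bound (I : finType) (Q : I -> nat -> Prop) :
  (forall i M M', (M <= M')%N -> Q i M -> Q i M') -> (forall i, exists M, Q i M) ->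
  exists M, forall i, Q i M.
Proof.
move=> Qle /fin_all_exists[F QF]; exists (\max_i F i) => i.
by apply: Qle (QF i); apply: leq_bigmax.
Qed.

Lemma sum_stab (A : nmodType) (u : nat -> A) (M N : nat) : (M <= N)%N ->
  (forall b, (M <= b)%N -> u b = 0) -> \sum_(0 <= b < N) u b = \sum_(0 <= b < M) u b.
Proof.
move=> le u0; rewrite (big_cat_nat (n := M)) //= [X in _ + X]big_nat_cond.
by rewrite [X in _ + X]big1 ?addr0 // => b /andP[/andP[/u0]].
Qed.

Lemma antidiagonal_sum (A : nmodType) (T : nat -> nat -> A) (M1 M2 : nat) :
  (forall a b, (M1 <= a)%N || (M2 <= b)%N -> T a b = 0) ->
  \sum_(k < M1 + M2) \sum_(j < k.+1) T j (k - j)%N = \sum_(a < M1) \sum_(b < M2) T a b.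
Proof.
move=> T0; pose M := (M1 + M2)%N.
transitivity (\sum_(0 <= j < M) \sum_(0 <= b < M - j) T j b).
  transitivity (\sum_(k < M) \sum_(j < M | (j <= k)%N) T j (k - j)%N).
    apply: eq_bigr => k _.
    by rewrite (big_ord_widen M (fun j => T j (k - j)%N) (ltn_ord k)).
  rewrite (exchange_big_dep predT) //= big_mkord; apply: eq_bigr => j _.
  rewrite -(big_mkord (fun k => j <= k)%N (fun k => T j (k - j)%N)).
  rewrite (big_cat_nat (n := j)) ?(ltnW (ltn_ord j)) //=.
  rewrite big_nat_cond big_pred0 ?add0r => [|k]; last by case: ltnP => //=; rewrite andbF.
  rewrite -{1}[nat_of_ord j]add0n big_addn [LHS]big_nat_cond [RHS]big_nat_cond.
  apply: eq_big => k; first by rewrite leq_addl andbT.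
  by rewrite addnK.
rewrite (sum_stab (M := M1)) ?leq_addr // => [|b leb]; last first.
  by apply: big1 => a _; rewrite T0 ?leb.
rewrite big_mkord; apply: eq_bigr => a _.
rewrite (sum_stab (M := M2)) => [||b leb]; first by rewrite big_mkord.
  by rewrite /M -addnBAC ?leq_addl // ltnW.
by rewrite T0 ?leb ?orbT.
Qed.

Lemma np_diff_prod (K : fieldType) (n : nat) (V : npManifold K n) (c : coord V) (N : nat)
    (f : 'I_N -> np_fun V) :
  np_diff c (\prod_(l < N) f l) = \sum_(v < N) \prod_(l < N)
    (if (l < v)%N then fsign (cdeg c) (f l) else if l == v then np_diff c (f l) else f l).
Proof.
elim: N f => [|N IH] f; first by rewrite !big_ord0 np_diff1.
rewrite big_ord_recl np_diffM big_ord_recl IH; congr (_ + _).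
  by rewrite [RHS]big_ord_recl /=.
rewrite big_distrr; apply: eq_bigr => v _ /=; rewrite [RHS]big_ord_recl /=.
by congr (_ * _); apply: eq_bigr => l _; rewrite (inj_eq (@lift_inj _ ord0)).
Qed.

Section Insertion.
Variables (K : fieldType) (n : nat) (V : npManifold K n) (q r p : nat).
Hypothesis defp : p = (q + r)%N.
Implicit Types (M : nmap V r) (F : nmap V q) (x : {ffun 'I_p.+1 -> np_fun V}).

Definition emb (i : 'I_q.+1) : 'I_p.+1 := inord i.

Definition emb_edge (e : edge q) : edge p := (emb e.1, emb e.2).

Definition contract_edge (e : edge p) : edge r :=
  (contract_vertex q r e.1, contract_vertex q r e.2).

Definition low x : {ffun 'I_q.+1 -> np_fun V} := [ffun i : 'I_q.+1 => x (emb i)].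

Definition high x : {ffun 'I_r.+1 -> np_fun V} := [ffun j : 'I_r.+1 => x (inord (q + j))].

Lemma insert1E M F x : insert1 M F x = M (upd (high x) ord0 (F (low x))).
Proof.
congr M; apply/ffunP => j; rewrite !ffunE; case: eqP => // _.
Qed.

Lemma val_emb i : emb i = i :> nat.
Proof. by rewrite inordK // defp; have := ltn_ord i; lia. Qed.

Lemma inord_emb i : inord (emb i) = i.
Proof. by rewrite val_emb inord_val. Qed.

Lemma emb_le i : (emb i <= q)%N. Proof. by rewrite val_emb -ltnS. Qed.

Lemma val_high (j : 'I_r.+1) : @inord p (q + j) = (q + j)%N :> nat.
Proof. by rewrite inordK // defp; have := ltn_ord j; lia. Qed.

Lemma val_contract (v : 'I_p.+1) : contract_vertex q r v = (v - q)%N :> nat.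
Proof. by rewrite inordK //; have := ltn_ord v; have := defp; lia. Qed.

Lemma low_diff_at (c : coord V) i x : low (diff_at c (emb i) x) = diff_at c i (low x).
Proof.
by apply/ffunP => l; rewrite !ffunE -!val_eqE /= !val_emb.
Qed.

Lemma high_diff_at (c : coord V) i x (j : 'I_r.+1) : j != ord0 ->
  high (diff_at c (emb i) x) j = high x j.
Proof.
rewrite -val_eqE /= => j0; rewrite ffunE diff_at_gt ?ffunE //.
by rewrite val_emb val_high; have := ltn_ord i; lia.
Qed.

Lemma insert1_diff_right M F (c : coord V) i x :
  insert1 M (fun y => F (diff_at c i y)) x = insert1 M F (diff_at c (emb i) x).
Proof.
rewrite !insert1E low_diff_at; congr M; apply/ffunP => j; rewrite !ffunE.
by case: (boolP (j == ord0)) => // /(high_diff_at c i x); rewrite !ffunE.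
Qed.

Lemma mlin_sum M (f : {ffun 'I_r.+1 -> np_fun V}) (i : 'I_r.+1) (I : Type) (s : seq I) (P : pred I)
    (a : I -> K) (u : I -> np_fun V) : multilinear M ->
  M (upd f i (\sum_(k <- s | P k) a k *: u k)) = \sum_(k <- s | P k) a k *: M (upd f i (u k)).
Proof.
move=> Mm; elim: s => [|k s IH]; first by rewrite !big_nil mlin0.
by rewrite !big_cons; case: ifP => // _; rewrite multilinear_upd // IH.
Qed.

Lemma insert1_Delta_right M F e : multilinear M ->
  insert1 M (comp_Delta F e) = comp_Delta (insert1 (p := p) M F) (emb_edge e).
Proof.
move=> Mm; apply: functional_extensionality => x.
rewrite insert1E comp_DeltaE mlin_sum // comp_DeltaE; apply: eq_bigr => k _ /=.
by rewrite -!insert1_diff_right insert1E.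
Qed.

Lemma contract_eq0 (v : 'I_p.+1) : (contract_vertex q r v == ord0) = (v <= q)%N.
Proof. by rewrite -val_eqE /= val_contract subn_eq0. Qed.

Lemma contract_eqS (v : 'I_p.+1) (i : 'I_r.+1) : i != ord0 ->
  (contract_vertex q r v == i) = (v == inord (q + i)).
Proof.
rewrite -!val_eqE /= val_contract val_high => i0; lia.
Qed.

Lemma insert1_diff_left M (c : coord V) (i : 'I_r.+1) x : multilinear M ->
  insert1 (fun y => M (diff_at c i y)) (fun y => \prod_(l < q.+1) y l) x =
  \sum_(v < p.+1 | contract_vertex q r v == i)
    insert1 M (fun y => \prod_(l < q.+1) y l) (diff_at c v x).
Proof.
move=> Mm; rewrite insert1E; have [->|i0] := eqVneq i ord0.
  rewrite [RHS](reindex_onto emb (fun v => inord v)) /= => [|v]; last first.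
    by rewrite contract_eq0 => vq; apply: val_inj; rewrite /= val_emb inordK.
  rewrite [RHS](eq_bigl predT) => [|v]; last first.
    by rewrite contract_eq0 emb_le inord_emb eqxx.
  under [RHS]eq_bigr => v _ do rewrite insert1E low_diff_at.
  have -> : diff_at c ord0 (upd (high x) ord0 (\prod_(l < q.+1) low x l)) =
      upd (high x) ord0 (\sum_v 1 *: \prod_(l < q.+1) diff_at c v (low x) l).
    apply/ffunP => j; rewrite [in RHS]ffunE.
    have [->|j0] := eqVneq j ord0; last first.
      by rewrite diff_at_gt ?lt0n // ffunE (negbTE j0).
    rewrite diff_at_eq ffunE eqxx np_diff_prod; apply: eq_bigr => v _.
    by rewrite scale1r; apply: eq_bigr => l _; rewrite [RHS]ffunE.
  rewrite mlin_sum //; apply: eq_bigr => v _; rewrite scale1r; congr M.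
  apply/ffunP => j; rewrite ffunE [in RHS]ffunE.
  by case: (boolP (j == ord0)) => [//|j0]; rewrite high_diff_at.
rewrite [RHS](big_pred1 (inord (q + i))) => [|v]; last by rewrite /= contract_eqS.
have i_gt0 : (0 < i)%N by rewrite lt0n.
rewrite insert1E; congr M; apply/ffunP => j; rewrite [in RHS]ffunE.
have [->|j0] := eqVneq j ord0.
  rewrite diff_at_lt // ffunE eqxx fsign_prod; apply: eq_bigr => l _.
  rewrite [RHS]ffunE diff_at_lt ?ffunE // val_emb val_high.
  by have := ltn_ord l; lia.
rewrite !ffunE (negbTE j0) !val_high ltn_add2l.
by rewrite -[inord _ == _]val_eqE /= !val_high eqn_add2l.
Qed.

End Insertion.

Lemma prod_ord_split (R : pzSemiRingType) (q r p : nat) (x : 'I_p.+1 -> R) : p = (q + r)%N ->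
  \prod_(i < p.+1) x i =
  (\prod_(l < q.+1) x (inord l)) * \prod_(j < r) x (inord (q + j.+1)).
Proof.
move=> defp; have le : (q.+1 <= p.+1)%N by lia.
transitivity (\prod_(0 <= i < p.+1) x (inord i)).
  by rewrite big_mkord; apply: eq_bigr => i _; rewrite inord_val.
rewrite (big_cat_nat (n := q.+1) _ le) //=.
rewrite big_mkord; congr (_ * _).
rewrite -{1}[q.+1]add0n big_addn big_mkord (_ : p.+1 - q.+1 = r)%N; last by lia.
by apply: eq_bigr => j _; rewrite addnS addnC -addnS.
Qed.

Section Composition.
Variables (K : fieldType) (n : nat) (V : npManifold K n) (q r p : nat).
Hypothesis defp : p = (q + r)%N.
Implicit Types (x : {ffun 'I_p.+1 -> np_fun V}).

Let emb := @emb q p.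
Let emb_edge := @emb_edge q p.
Let contract_edge := @contract_edge q r p.
Let mu := fun y : {ffun 'I_q.+1 -> np_fun V} => \prod_(l < q.+1) y l.

Lemma insert1_Delta_left (M : nmap V r) (e : edge r) x : multilinear M ->
  insert1 (comp_Delta M e) mu x =
  \sum_(e' : edge p) (contract_edge e' == e)%:R *: comp_Delta (insert1 M mu) e' x.
Proof.
case: e => i j Mm.
rewrite insert1E // comp_DeltaE.
under eq_bigr => k _.
  have E := insert1_diff_left defp k.2 j x (multilinear_diff_at k.1 i Mm).
  rewrite insert1E // in E; rewrite E.
  under eq_bigr => v' _ do rewrite insert1_diff_left //.
  over.
transitivity (\sum_v \sum_v' ((contract_edge (v, v') == (i, j))%:R : K) *:
   comp_Delta (insert1 M mu) (v, v') x); last first.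
  by rewrite pair_bigA; apply: eq_bigr => -[].
under [RHS]eq_bigr => v _ do under eq_bigr => v' _ do rewrite comp_DeltaE scaler_sumr.
under [RHS]eq_bigr => v _ do rewrite exchange_big /=.
rewrite [RHS]exchange_big /=; apply: eq_bigr => k _.
rewrite [RHS]exchange_big /= scaler_sumr big_mkcond /=; apply: eq_bigr => v' _.
case: eqP => [Ej|Ej]; last first.
  rewrite big1 // => v _; rewrite -[contract_edge _]/(_, contract_vertex q r v') xpair_eqE.
  by rewrite (introF eqP Ej) andbF scale0r.
rewrite scaler_sumr big_mkcond /=; apply: eq_bigr => v _.
rewrite -[contract_edge _]/(contract_vertex q r v, contract_vertex q r v') xpair_eqE Ej eqxx andbT.
by case: eqP; rewrite ?scale1r ?scale0r.
Qed.

Lemma insert1_rep_left (G : seq (edge r)) x :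
  insert1 (rep_graph V G) mu x =
  tsum (size G) (fun H => (map contract_edge H == G)%:R *: rep_graph V H x).
Proof.
elim/last_ind: G x => [|G e IH] x.
  rewrite tsum0 eqxx scale1r insert1E // /rep_graph /= (prod_ord_split _ defp).
  rewrite [LHS]big_ord_recl ffunE eqxx; congr (_ * _); apply: eq_bigr => l _; rewrite !ffunE //.
have -> : insert1 (rep_graph V (rcons G e)) mu x = insert1 (comp_Delta (rep_graph V G) e) mu x.
  by rewrite insert1E // rep_rcons -insert1E.
rewrite insert1_Delta_left; last exact: multilinear_rep.
rewrite (functional_extensionality _ _ IH) size_rcons tsum_rcons.
rewrite [RHS]exchange_big /=; apply: eq_bigr => e' _.
rewrite comp_Delta_lin scaler_sumr; apply: eq_bigr => H _.
by rewrite map_rcons eqseq_rcons rep_rcons scalerA -natrM mulnb andbC.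
Qed.

Lemma insert1_rep (G : seq (edge r)) (G' : seq (edge q)) x :
  insert1 (rep_graph V G) (rep_graph V G') x =
  tsum (size G) (fun H =>
    (map contract_edge H == G)%:R *: rep_graph V (H ++ map emb_edge G') x).
Proof.
elim/last_ind: G' x => [|G' e IH] x.
  by rewrite [LHS]insert1_rep_left; apply: eq_tsum => H _; rewrite cats0.
have -> : rep_graph V (rcons G' e) = comp_Delta (rep_graph V G') e.
  by apply: functional_extensionality => y; rewrite rep_rcons.
rewrite insert1_Delta_right //; last exact: multilinear_rep.
rewrite (functional_extensionality _ _ IH) comp_Delta_lin.
by apply: eq_bigr => H _; rewrite map_rcons -rcons_cat rep_rcons.
Qed.

Lemma tsum_emb (A : nmodType) (k : nat) (phi : seq (edge q) -> seq (edge p) -> A) :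
  tsum k (fun D => if all (fun e : edge p => (e.1 <= q)%N && (e.2 <= q)%N) D
    then phi [seq (inord e.1, inord e.2) | e : edge p <- D] D else 0) =
  tsum k (fun G => phi G (map emb_edge G)).
Proof.
elim: k phi => [|k IH] phi; first by rewrite !tsum0.
rewrite !tsumS (bigID (fun e : edge p => (e.1 <= q)%N && (e.2 <= q)%N)) /=.
rewrite [X in _ + X]big1 ?addr0 => [|e /negbTE eq]; last first.
  by apply: big1 => D _; rewrite eq.
rewrite (reindex_onto emb_edge (fun e : edge p => (inord e.1, inord e.2))) /=; last first.
  move=> [v v'] /= /andP[vq vq']; congr (_, _); apply: val_inj;
    by rewrite /= (val_emb defp) inordK.
apply: eq_big => [e|e _].
  by rewrite !(emb_le defp) !(inord_emb defp); case: e => a b /=; rewrite eqxx.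
rewrite -(IH (fun G D => phi (e :: G) (emb_edge e :: D))); apply: eq_tsum => D _.
by rewrite !(emb_le defp) /= !(inord_emb defp); case: e.
Qed.

Lemma tsum_gra_comp1 (g : gra K r) (g' : gra K q) (k : nat) x :
  tsum k (fun G => gra_comp1 g g' G *: rep_graph V G x) =
  \sum_(j < k.+1) tsum j (fun G => tsum (k - j) (fun G' =>
     (g G * g' G') *: insert1 (rep_graph V G) (rep_graph V G') x)).
Proof.
have split_sum G : size G = k -> gra_comp1 g g' G *: rep_graph V G x =
    \sum_(j < k.+1) (if all (fun e : edge p => (e.1 <= q)%N && (e.2 <= q)%N) (drop j G) then
      (g (map contract_edge (take j G)) * g' [seq (inord e.1, inord e.2) | e : edge p <- drop j G])
      *: rep_graph V G x else 0).
  by move=> Gk; rewrite /gra_comp1 Gk scaler_suml big_mkcond.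
rewrite (eq_tsum split_sum) [LHS]tsum_sum; apply: eq_bigr => j _.
have jk : (j <= k)%N by rewrite -ltnS.
rewrite -{1}(subnKC jk) tsum_cat.
transitivity (tsum j (fun H => tsum (k - j) (fun G' =>
   (g (map contract_edge H) * g' G') *: rep_graph V (H ++ map emb_edge G') x))).
  apply: eq_tsum => H Hj; rewrite -(tsum_emb _ (fun G D =>
    (g (map contract_edge H) * g' G) *: rep_graph V (H ++ D) x)); apply: eq_tsum => D _.
  by rewrite take_size_cat // drop_size_cat.
rewrite (tsum_partition _ contract_edge); apply: eq_bigr => G _.
under [RHS]eq_tsum => G' _.
  rewrite insert1_rep size_tuple /tsum scaler_sumr.
  over.
rewrite [RHS]exchange_big big_mkcond /=; apply: eq_bigr => H _.
case: eqP => [->|_]; last by apply/esym/big1 => G' _; rewrite scale0r scaler0.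
by apply: eq_bigr => G' _; rewrite scale1r.
Qed.

Lemma gra_fin_comp1 (g : gra K r) (g' : gra K q) :
  gra_fin n g -> gra_fin n g' -> gra_fin n (gra_comp1 (p := p) g g').
Proof.
clear defp; case=> [?|[M gM]]; first by left.
case=> [?|[M' gM']]; [by left|right; exists (M + M')%N => G leG].
apply: big1 => k _; have [Mk|kM] := leqP M k.
  rewrite gM ?mul0r // size_map size_take; case: ifP => // _.
  by apply: leq_trans leG; apply: leq_addr.
by rewrite gM' ?mulr0 // size_map size_drop; lia.
Qed.

Lemma Rep_comp1 (g : gra K r) (g' : gra K q) x : gra_fin n g -> gra_fin n g' ->
  Rep (V := V) (gra_comp1 g g') x = insert1 (Rep g) (Rep g') x.
Proof.
move=> gfin g'fin.
have [M2 v2] := rep_vanishP (low q x) g'fin.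
pose base (G' : seq (edge q)) := upd (high q r x) ord0 (rep_graph V G' (low q x)).
have [M1 v1] : exists M1, forall (k : 'I_M2) (G' : k.-tuple (edge q)),
    rep_vanish g (base G') M1.
  apply: (uniform_bound (Q := fun (k : 'I_M2) M => forall (G' : k.-tuple (edge q)),
    rep_vanish g (base G') M)) => [k M M' le v G'|k].
    exact: rep_vanish_le (v G').
  apply: (uniform_bound (Q := fun (G' : k.-tuple (edge q)) M => rep_vanish g (base G') M)).
    by move=> G' M M'; apply: rep_vanish_le.
  by move=> G'; apply: rep_vanishP.
pose T a b := tsum a (fun G => tsum b (fun G' =>
     (g G * g' G') *: insert1 (rep_graph V G) (rep_graph V G') x)).
have T0 a b : (M1 <= a)%N || (M2 <= b)%N -> T a b = 0.
  move=> ab; apply: big1 => G _; apply: big1 => G' _; rewrite insert1E //.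
  have Mm := multilinear_rep (V := V) G.
  have [leb|ltb] := leqP M2 b.
    rewrite -scalerA -(mlin_scale (i := ord0) (f := upd (high q r x) ord0
      (g' G' *: rep_graph V G' (low q x)))) // => [|j /negbTE j0|]; last 2 first.
    - by rewrite !ffunE j0.
    - by rewrite !ffunE eqxx.
    by rewrite v2 ?size_tuple // mlin0 // scaler0.
  rewrite mulrC -scalerA (v1 (Ordinal ltb) G') ?scaler0 // size_tuple.
  by move: ab; rewrite [(M2 <= b)%N]leqNgt ltb orbF.
have -> : Rep (V := V) (gra_comp1 g g') x = \sum_(k < M1 + M2) \sum_(j < k.+1) T j (k - j)%N.
  have E k : tsum k (fun G => gra_comp1 g g' G *: rep_graph V G x) =
      \sum_(j < k.+1) T j (k - j)%N by apply: tsum_gra_comp1.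
  under [RHS]eq_bigr => k _ do rewrite -E.
  apply: lsum_eq => k lek; apply: etrans (E k) _; apply: big1 => j _; apply: T0.
  by have := ltn_ord j; lia.
rewrite (antidiagonal_sum T0) insert1E // (RepE v2).
under [X in upd _ _ X]eq_bigr => k _ do rewrite -[tsum _ _]scale1r.
rewrite mlin_sum; last exact: multilinear_Rep.
rewrite exchange_big /=; apply: eq_bigr => k _; rewrite scale1r.
rewrite [in RHS]/tsum mlin_sum; last exact: multilinear_Rep.
under [RHS]eq_bigr => G' _ do rewrite (RepE (v1 k G')) scaler_sumr.
rewrite [RHS]exchange_big /=; apply: eq_bigr => a _; rewrite /T /tsum.
rewrite exchange_big /=; apply: eq_bigr => G' _; rewrite scaler_sumr.
by apply: eq_bigr => G _; rewrite insert1E // scalerA mulrC.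
Qed.

End Composition.

(** * Equivariance *)

Lemma odd_sum (I : Type) (r : seq I) (P : pred I) (F : I -> nat) :
  odd (\sum_(i <- r | P i) F i) = \big[addb/false]_(i <- r | P i) odd (F i).
Proof. exact: (big_morph odd oddD). Qed.

Lemma odd_count_lt (N : nat) (i : 'I_N) : \big[addb/false]_(j < N) (j < i)%N = odd i.
Proof.
have E : nat_of_ord i = (\sum_(j < N) (j < i)%N)%N.
  rewrite -[LHS]card_ord -sum1_card (big_ord_widen N (fun=> 1%N)) ?(ltnW (ltn_ord i)) //.
  by rewrite big_mkcond; apply: eq_bigr => j _; case: ltnP.
by rewrite [in RHS]E odd_sum; apply: eq_bigr => j _; rewrite oddb.
Qed.

Section KoszulSign.
Variables (p : nat) (t : 'S_p.+1).
Implicit Types (e : {ffun 'I_p.+1 -> bool}) (i j : 'I_p.+1).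

Let inv i j := (i < j)%N && (t j < t i)%N.

Lemma inv_addb i j : inv i j (+) inv j i = (j < i)%N (+) (t j < t i)%N.
Proof.
rewrite /inv; case: (ltngtP i j) => [ij|ij|/val_inj ->]; last by rewrite ltnn.
  by rewrite addbF.
case: (ltngtP (t i) (t j)) => // /val_inj/perm_inj eij.
by rewrite eij ltnn in ij.
Qed.

Lemma odd_koszul e :
  odd (koszul t e) = \big[addb/false]_i \big[addb/false]_j (inv i j && (e (t i) && e (t j))).
Proof.
rewrite odd_sum; apply: eq_bigr => i _; rewrite odd_sum big_mkcond /=.
by apply: eq_bigr => j _; rewrite oddb /inv; case: (_ && (t j < t i)%N).
Qed.

Lemma odd_koszul_flip e i :
  odd (koszul t e) (+) odd (koszul t [ffun l : 'I_p.+1 => e l (+) (l == t i)]) =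
  (\big[addb/false]_(l < p.+1 | (l < i)%N) e (t l))
  (+) (\big[addb/false]_(l < p.+1 | (t l < t i)%N) e (t l)).
Proof.
rewrite !odd_koszul -big_split /=.
have delta (F : 'I_p.+1 -> bool) : \big[addb/false]_l ((l == i) && F l) = F i.
  by rewrite (bigD1 i) //= eqxx big1 ?addbF // => l /negbTE ->.
pose A := \big[addb/false]_j (inv i j && e (t j)).
pose B := \big[addb/false]_j (inv j i && e (t j)).
transitivity (A (+) B); last first.
  rewrite /A /B -big_split [in RHS]big_mkcond [X in _ = _ (+) X]big_mkcond -big_split /=.
  apply: eq_bigr => l _; have := inv_addb i l.
  by case: (inv i l) (inv l i) (l < i)%N (t l < t i)%N (e (t l)) => [] [] [] [] [].
rewrite /A -(delta (fun k => \big[addb/false]_j (inv k j && e (t j)))) -big_split /=.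
apply: eq_bigr => k _; rewrite -big_split /=.
rewrite -(delta (fun j => inv k j && e (t k))) (big_morph (andb (k == i)) (id1 := false) (op1
  := addb)) ?andbF //; last first.
  by move=> a b; case: (k == i).
rewrite -big_split /=; apply: eq_bigr => j _; rewrite !ffunE !(inj_eq perm_inj).
have : ~~ [&& k == i, j == i & inv k j].
  by apply/negP=> /and3P[/eqP-> /eqP->]; rewrite /inv ltnn.
by case: (k == i) (j == i) (inv k j) (e (t k)) (e (t j)) => [] [] [] [] [].
Qed.

Lemma odd_koszul_compl e :
  odd (koszul t e) (+) odd (koszul t [ffun l : 'I_p.+1 => ~~ e l]) =
  t (+) \big[addb/false]_i (e (t i) && (odd i (+) odd (t i))).
Proof.
have -> : \big[addb/false]_i (e (t i) && (odd i (+) odd (t i))) =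
    \big[addb/false]_i \big[addb/false]_j (e (t i) && (inv i j (+) inv j i)).
  apply: eq_bigr => i _.
  transitivity (e (t i) && \big[addb/false]_j (inv i j (+) inv j i)); last first.
    by case: (e (t i)) => /=; [apply: eq_bigr|rewrite big1].
  congr (_ && _); under [RHS]eq_bigr => j _ do rewrite inv_addb.
  rewrite big_split /= odd_count_lt; congr (_ (+) _).
  by rewrite -odd_count_lt (reindex_inj (@perm_inj _ t)).
transitivity ((\big[addb/false]_i \big[addb/false]_j inv i j) (+)
  ((\big[addb/false]_i \big[addb/false]_j (e (t i) && inv i j)) (+)
   (\big[addb/false]_i \big[addb/false]_j (e (t j) && inv i j)))).
  rewrite !odd_koszul -!big_split /=; apply: eq_bigr => i _.
  rewrite -!big_split /=; apply: eq_bigr => j _; rewrite !ffunE.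
  by case: (inv i j) (e (t i)) (e (t j)) => [] [] [].
congr (_ (+) _).
  rewrite -[RHS]odd_inversions odd_sum; apply: eq_bigr => i _; rewrite odd_sum [RHS]big_mkcond /=.
  by apply: eq_bigr => j _; rewrite /inv; case: ifP.
rewrite [X in _ (+) X]exchange_big. rewrite -big_split /=; apply: eq_bigr => i _.
by rewrite -big_split /=; apply: eq_bigr => j _; rewrite -andb_addr.
Qed.

End KoszulSign.

Lemma addb_exchange (a b c d : bool) : a (+) b = c (+) d -> a (+) c = b (+) d.
Proof. by case: a b c d => [] [] [] []. Qed.

Section Equivariance.
Variables (K : fieldType) (n : nat) (V : npManifold K n) (p : nat) (t : 'S_p.+1).
Implicit Types (M : nmap V p) (x : {ffun 'I_p.+1 -> np_fun V}) (e : {ffun 'I_p.+1 -> bool}).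

Definition perm_fpar x e : {ffun 'I_p.+1 -> np_fun V} :=
  [ffun i : 'I_p.+1 => fpar (e (t i)) (x (t i))].

(* The analogue of [permute_args] for the degrees of functions. *)
Definition vperm M : nmap V p :=
  fun x => \sum_(e : {ffun 'I_p.+1 -> bool}) (-1) ^+ koszul t e *: M (perm_fpar x e).

Lemma vperm_prod x :
  vperm (fun y => \prod_(i < p.+1) y i) x = \prod_(i < p.+1) x i.
Proof.
rewrite /vperm; transitivity (\sum_(e : {ffun 'I_p.+1 -> bool}) \prod_(i < p.+1) fpar (e i) (x i)).
  apply: eq_bigr => e _; pose y i := fpar (e i) (x i).
  pose phi s := \prod_(i <- s) y i.
  pose eps i j : K := (-1) ^+ (e i && e j).
  have sw s1 i j s2 : phi (s1 ++ i :: j :: s2) = eps i j *: phi (s1 ++ j :: i :: s2).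
    rewrite /phi !big_cat !big_cons /= scalerAr; congr (_ * _).
    by rewrite !mulrA scalerAl; congr (_ * _); apply: fpar_comm; apply: fpar_id.
  have phi_enum (F : 'I_p.+1 -> np_fun V) : \prod_(i < p.+1) F i = \prod_(i <- enum 'I_p.+1) F i.
    by rewrite enumT [index_enum _]unlock.
  transitivity ((-1) ^+ koszul t e *: phi [seq t i | i <- enum 'I_p.+1]).
    by rewrite /phi big_map phi_enum; congr (_ *: _); apply: eq_bigr => i _; rewrite ffunE.
  rewrite (phi_perm sw t) scalerA phi_enum.
  have -> : \prod_(i < p.+1) \prod_(j < p.+1 | (i < j)%N && (t j < t i)%N) eps (t i) (t j) =
      (-1) ^+ koszul t e.
    by rewrite -prodrXr; apply: eq_bigr => i _; rewrite -prodrXr.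
  by rewrite -expr2 sqrr_sign scale1r.
rewrite -(bigA_distr_bigA (fun i b => fpar b (x i))); apply: eq_bigr => i _.
by rewrite big_bool /= addrC fpar_add.
Qed.

Lemma vperm_sum (I : Type) (r : seq I) (P : pred I) (a : I -> K) (M : I -> nmap V p) x :
  vperm (fun y => \sum_(k <- r | P k) a k *: M k y) x =
  \sum_(k <- r | P k) a k *: vperm (M k) x.
Proof.
rewrite /vperm; under eq_bigr => e _ do rewrite scaler_sumr.
rewrite exchange_big /=; apply: eq_bigr => k _; rewrite scaler_sumr.
by apply: eq_bigr => e _; rewrite !scalerA mulrC.
Qed.

Lemma vperm_diff_at M (c : coord V) (i : 'I_p.+1) x : multilinear M ->
  vperm (fun y => M (diff_at c i y)) x = vperm M (diff_at c (t i) x).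
Proof.
move=> Mm; pose h e : {ffun 'I_p.+1 -> bool} := [ffun l : 'I_p.+1 => e l (+) ((l == t i) && odd
  (cdeg c))].
have hK : involutive h.
  by move=> e; apply/ffunP => l; rewrite !ffunE addbK.
rewrite [RHS](reindex_inj (inv_inj hK)); apply: eq_bigr => e _ /=.
pose B : {ffun 'I_p.+1 -> np_fun V} := [ffun l : 'I_p.+1 =>
  if l == i then np_diff c (fpar (e (t i)) (x (t i))) else fpar (e (t l)) (x (t l))].
have -> : diff_at c i (perm_fpar x e) =
    [ffun l : 'I_p.+1 => (if (l < i)%N then (-1) ^+ (cdeg c * e (t l)) else 1) *: B l].
  apply/ffunP => l; rewrite [RHS]ffunE [B l]ffunE.
  case: (ltngtP l i) => [li|il|/val_inj->].
  - by rewrite diff_at_lt // ffunE fsign_fpar -val_eqE /= ltn_eqF.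
  - by rewrite diff_at_gt // ffunE -val_eqE /= gtn_eqF // scale1r.
  by rewrite diff_at_eq ffunE eqxx scale1r.
have -> : perm_fpar (diff_at c (t i) x) (h e) =
    [ffun l : 'I_p.+1 => (if (t l < t i)%N then (-1) ^+ (cdeg c * e (t l)) else 1) *: B l].
  apply/ffunP => l; rewrite [RHS]ffunE [B l]ffunE [LHS]ffunE ffunE (inj_eq perm_inj).
  have [->|li] := eqVneq l i.
    by rewrite ltnn diff_at_eq scale1r fpar_np_diff /= addbK.
  rewrite addbF; case: (ltngtP (t l) (t i)) => [lt|lt|/val_inj/perm_inj li'].
  - by rewrite diff_at_lt // fpar_fsign.
  - by rewrite diff_at_gt // scale1r.
  by rewrite li' eqxx in li.
rewrite !mlinZ // !scalerA; congr (_ *: _).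
rewrite -!big_mkcond /= !prodrXr -!exprD.
rewrite -signr_odd -[in RHS]signr_odd; congr (_ ^+ nat_of_bool _).
rewrite !oddD [X in _ (+) X = _]odd_sum [X in _ = _ (+) X]odd_sum.
case co: (odd (cdeg c)); last first.
  have z (P : pred 'I_p.+1) F : \big[addb/false]_(l | P l) odd (cdeg c * F l) = false.
    by rewrite big1 // => l _; rewrite oddM co.
  rewrite !z !addbF. congr (odd (koszul t _)); by apply/ffunP => l; rewrite ffunE co andbF addbF.
have -> : h e = [ffun l : 'I_p.+1 => e l (+) (l == t i)].
  by apply/ffunP => l; rewrite !ffunE co andbT.
apply: addb_exchange; rewrite odd_koszul_flip.
by congr (_ (+) _); apply: eq_bigr => l _; rewrite oddM co oddb.
Qed.

Lemma vperm_rep G x : vperm (rep_graph V G) x = rep_graph V [seq (t e.1, t e.2) | e : edge p <-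
  G] x.
Proof.
elim/last_ind: G x => [|G [i j] IH] x; first by rewrite vperm_prod.
have -> : rep_graph V (rcons G (i, j)) = fun y => \sum_(q : coord V * coord V)
    weight q.1 q.2 *: rep_graph V G (diff_at q.1 i (diff_at q.2 j y)).
  by apply: functional_extensionality => y; rewrite rep_rcons comp_DeltaE.
rewrite vperm_sum map_rcons rep_rcons comp_DeltaE; apply: eq_bigr => q _ /=.
rewrite (vperm_diff_at q.2 j x (multilinear_diff_at q.1 i (multilinear_rep (V := V) G))).
by rewrite (vperm_diff_at _ _ _ (multilinear_rep (V := V) G)) IH.
Qed.

Lemma vperm_Rep (g : gra K p) x : gra_fin n g ->
  vperm (Rep (V := V) g) x = Rep (gra_act g (t^-1)%g) x.
Proof.
move=> gfin; have [N vN] : exists N, forall e, rep_vanish g (perm_fpar x e) N.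
  apply: (uniform_bound (Q := fun e N => rep_vanish g (perm_fpar x e) N)) => [e N N'|e].
    exact: rep_vanish_le.
  exact: rep_vanishP.
have E k : tsum k (fun G => gra_act g (t^-1)%g G *: rep_graph V G x) =
    \sum_(e : {ffun 'I_p.+1 -> bool}) (-1) ^+ koszul t e *:
       tsum k (fun G => g G *: rep_graph V G (perm_fpar x e)).
  pose tt (e : edge p) : edge p := (t e.1, t e.2).
  have tt_inj : injective tt.
    by move=> [a b] [a' b'] [/perm_inj -> /perm_inj ->].
  rewrite -(tsum_perm _ _ tt_inj); under [RHS]eq_bigr => e _ do rewrite /tsum scaler_sumr.
  rewrite [RHS]exchange_big; apply: eq_bigr => G _ /=.
  rewrite -[rep_graph V (map tt G) x]vperm_rep /vperm scaler_sumr.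
  have -> : gra_act g (t^-1)%g (map tt G) = g G.
    rewrite /gra_act -map_comp (eq_map (_ : _ =1 id)) ?map_id // => -[a b] /=.
    by rewrite !permK.
  by apply: eq_bigr => e _; rewrite !scalerA mulrC.
rewrite /vperm; under eq_bigr => e _ do rewrite (RepE (vN e)) scaler_sumr.
rewrite exchange_big /=; symmetry.
under [RHS]eq_bigr => k _ do rewrite -E.
apply: lsum_eq => k leNk; apply: etrans (E k) _; apply: big1 => e _.
by rewrite [tsum _ _]big1 ?scaler0 // => G _; rewrite vN ?size_tuple.
Qed.

Lemma tparE b (f : np_fun V) : tpar b f = fpar (b (+) odd n) f.
Proof. by []. Qed.

Lemma tpar_susp (x : {ffun 'I_p.+1 -> np_fun V}) b l :
  tpar b (susp x l) = (-1) ^+ (n * (p - l) * b) *: tpar b (x l).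
Proof.
rewrite ffunE !tparE fparD fparZ !fpar_fpar !(inj_eq (@addIb _)).
by case: b; rewrite /= ?muln1 ?muln0 ?scaler0 ?scale1r ?add0r ?addr0.
Qed.

Lemma susp_tpar (y : 'I_p.+1 -> np_fun V) (b : 'I_p.+1 -> bool) :
  susp [ffun i : 'I_p.+1 => tpar (b i) (y i)] =
  [ffun i : 'I_p.+1 => (-1) ^+ (n * (p - i) * b i) *: tpar (b i) (y i)].
Proof.
apply/ffunP => i; rewrite !ffunE !tparE !fpar_fpar !(inj_eq (@addIb _)).
by case: (b i); rewrite /= ?muln1 ?muln0 ?scaler0 ?scale1r ?add0r ?addr0.
Qed.

Lemma permute_args_susp (g : gra K p) x : gra_fin n g ->
  permute_args (fun y => Rep (V := V) g (susp y)) t x =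
  (-1) ^+ (n * t) *: Rep (gra_act g (t^-1)%g) (susp x).
Proof.
move=> gfin; rewrite -vperm_Rep // /vperm scaler_sumr.
pose h e : {ffun 'I_p.+1 -> bool} := [ffun l : 'I_p.+1 => e l (+) odd n].
have hK : involutive h by move=> e; apply/ffunP => l; rewrite !ffunE addbK.
rewrite [RHS](reindex_inj (inv_inj hK)); apply: eq_bigr => e _ /=.
have -> : perm_fpar (susp x) (h e) = [ffun i : 'I_p.+1 =>
    (-1) ^+ (n * (p - t i) * e (t i)) *: tpar (e (t i)) (x (t i))].
  by apply/ffunP => i; rewrite ffunE [h e _]ffunE -tparE tpar_susp ffunE.
have -> : susp [ffun i : 'I_p.+1 => tpar (e (t i)) (x (t i))] = [ffun i : 'I_p.+1 =>
    (-1) ^+ (n * (p - i) * e (t i)) *: tpar (e (t i)) (x (t i))].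
  exact: (susp_tpar (fun i => x (t i)) (fun i => e (t i))).
pose B : {ffun 'I_p.+1 -> np_fun V} := [ffun i : 'I_p.+1 => tpar (e (t i)) (x (t i))].
have BE (a : 'I_p.+1 -> K) : [ffun i : 'I_p.+1 => a i *: tpar (e (t i)) (x (t i))] =
    [ffun i : 'I_p.+1 => a i *: B i] by apply/ffunP => i; rewrite !ffunE.
have Rm := multilinear_Rep (V := V) gfin.
rewrite !BE !mlinZ // !scalerA; congr (_ *: _).
rewrite !prodrXr -!exprD -signr_odd -[in RHS]signr_odd; congr (_ ^+ nat_of_bool _).
rewrite !oddD [X in _ (+) X = _]odd_sum [X in _ = _ (+) X]odd_sum oddM oddb.
case on: (odd n); last first.
  have z F : \big[addb/false]_(i < p.+1) odd (n * F i) = false.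
    by rewrite big1 // => i _; rewrite oddM on.
  under eq_bigr => i _ do rewrite -mulnA.
  under [X in _ = _ (+) X]eq_bigr => i _ do rewrite -mulnA.
  rewrite !z.
  by rewrite !addbF; congr (odd (koszul t _)); apply/ffunP => l; rewrite ffunE on addbF.
have -> : h e = [ffun l : 'I_p.+1 => ~~ e l].
  by apply/ffunP => l; rewrite !ffunE on addbT.
apply: addb_exchange; rewrite addbCA odd_koszul_compl addKb.
rewrite -big_split; apply: eq_bigr => i _ /=.
have odd_term (k : 'I_p.+1) (c : bool) : odd (n * (p - k) * c) = (odd p (+) odd k) && c.
  by rewrite -mulnA oddM on oddM oddB -1?ltnS // oddb.
rewrite !odd_term.
by case: (odd p) (odd i) (odd (t i)) (e (t i)) => [] [] [] [].
Qed.

End Equivariance.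

(** * The morphism of dg Lie algebras *)

Section Homogeneity.
Variables (K : fieldType) (n : nat) (V : npManifold K n).
Implicit Types (z : int) (f : np_fun V).

Lemma homog0 z : homog z (0 : np_fun V).
Proof. by case: z => a //=; rewrite raddf0. Qed.

Lemma homogZD z a f f' : homog z f -> homog z f' -> homog z (a *: f + f').
Proof.
by case: z => b /= zf zf'; [rewrite linearP zf zf'|rewrite zf zf' scaler0 addr0].
Qed.

Lemma homogZ z a f : homog z f -> homog z (a *: f).
Proof. by move=> zf; rewrite -[_ *: _]addr0; apply: homogZD (homog0 z). Qed.

Lemma homog_sum z (I : Type) (r : seq I) (P : pred I) (F : I -> np_fun V) :
  (forall i, P i -> homog z (F i)) -> homog z (\sum_(i <- r | P i) F i).
Proof.
move=> zF; elim/big_ind: _ => //; first exact: homog0.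
by move=> f f'; rewrite -{2}[f]scale1r; apply: homogZD.
Qed.

Lemma homogM z z' f f' : homog z f -> homog z' f' -> homog (z + z') (f * f').
Proof.
move=> zf zf'; case: z zf => a zf; last by rewrite (zf : f = 0) mul0r; exact: homog0.
case: z' zf' => b zf'; last by rewrite (zf' : f' = 0) mulr0; exact: homog0.
exact: np_pr_mul.
Qed.

Lemma homog_diff z (c : coord V) f : homog z f -> homog (z - (cdeg c)%:Z) (np_diff c f).
Proof.
case: z => a /= zf; last by rewrite zf raddf0; apply: homog0.
by have := np_diff_deg c zf; case: leqP => [le|_ ->]; [rewrite subzn|apply: homog0].
Qed.

Lemma homog_fsign z k f : homog z f -> homog z (fsign k f).
Proof.
case: z => a /= zf; last by rewrite zf raddf0.
by rewrite (fsign_homog _ zf) linearZ /= zf.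
Qed.

Lemma homog_rep (p : nat) (G : seq (edge p)) (a : 'I_p.+1 -> int)
    (f : {ffun 'I_p.+1 -> np_fun V}) :
  (forall j, homog (a j) (f j)) ->
  homog (\sum_j a j - (n * size G)%N%:Z) (rep_graph V G f).
Proof.
have diff_deg (a' : 'I_p.+1 -> int) (f' : {ffun 'I_p.+1 -> np_fun V}) (c : coord V) (i :
  'I_p.+1) : (forall j, homog (a' j) (f' j)) ->
    forall j, homog (a' j - (if j == i then cdeg c else 0%N)%:Z) (diff_at c i f' j).
  move=> af' j; rewrite ffunE; case: ltnP => [ji|_].
    by rewrite -val_eqE /= ltn_eqF // subr0; apply: homog_fsign.
  by case: eqP => [->|_]; [apply: homog_diff|rewrite subr0].
elim/last_ind: G a f => [|G [i j] IH] a f af.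
  rewrite muln0 subr0 /rep_graph /=; elim/big_rec2: _ => [|k z g _ zg].
    exact: np_pr_1.
  by apply: homogM.
rewrite rep_rcons comp_DeltaE; apply: homog_sum => -[c c'] _ /=.
have [->|w] := eqVneq (weight c c') 0; first by rewrite scale0r; apply: homog0.
apply: homogZ; have := IH _ _ (diff_deg _ _ c i (diff_deg _ _ c' j af)).
congr homog; rewrite !sumrB size_rcons mulnS; have wd := weight_deg w.
have delta k (b : nat) : \sum_(l < p.+1) (if l == k then b else 0%N)%:Z = b%:Z :> int.
  by rewrite (bigD1 k) //= eqxx big1 ?addr0 // => l /negbTE ->.
rewrite !delta; move: (\sum_i a i) (n * size G)%N wd => S N; lia.
Qed.

End Homogeneity.

Section Suspension.
Variables (K : fieldType) (n : nat) (V : npManifold K n).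

Lemma fsign_rep k (p : nat) (G : seq (edge p)) (f : {ffun 'I_p.+1 -> np_fun V}) :
  fsign k (rep_graph V G f) =
  (-1) ^+ (k * n * size G) *: rep_graph V G [ffun i : 'I_p.+1 => fsign k (f i)].
Proof.
have fsign_diff_at (M : nmap V p) (c : coord V) (i : 'I_p.+1) f' : multilinear M ->
    M [ffun l : 'I_p.+1 => fsign k (diff_at c i f' l)] =
    (-1) ^+ (k * cdeg c) *: M (diff_at c i [ffun l : 'I_p.+1 => fsign k (f' l)]).
  move=> Mm; apply: (mlin_scale (i := i)) => // [l li|].
    rewrite !ffunE (negbTE li); case: ifP => // _.
    by rewrite !fsign_fsign addnC.
  by rewrite ffunE !diff_at_eq ffunE np_diff_fsign signrZK.
elim/last_ind: G f => [|G [i j] IH] f.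
  rewrite muln0 scale1r /rep_graph /= fsign_prod; apply: eq_bigr => i _; by rewrite ffunE.
rewrite !rep_rcons !comp_DeltaE scaler_sumr linear_sum /=; apply: eq_bigr => -[c c'] _ /=.
have [->|w] := eqVneq (weight c c') 0; first by rewrite !scale0r scaler0 linear0.
have Gm := multilinear_rep (V := V) G.
rewrite fsignZ IH fsign_diff_at // (fsign_diff_at _ _ _ _ (multilinear_diff_at c i Gm)).
rewrite !scalerA; congr (_ *: _); rewrite [RHS]mulrC -!mulrA -!exprD; congr (_ * _ ^+ _).
by rewrite size_rcons; have := weight_deg w; lia.
Qed.

Lemma fsign_Rep k (b : bool) (p : nat) (g : gra K p) (f : {ffun 'I_p.+1 -> np_fun V}) :
  gra_fin n g -> (forall G, g G != 0 -> odd (k * n * size G) = b) ->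
  fsign k (Rep g f) = (-1) ^+ b *: Rep g [ffun i : 'I_p.+1 => fsign k (f i)].
Proof.
move=> gfin gb; set f' := [ffun i => _].
have [M1 v1] := rep_vanishP f gfin; have [M2 v2] := rep_vanishP f' gfin.
rewrite (RepE (rep_vanish_le (leq_maxl M1 M2) v1)) (RepE (rep_vanish_le (leq_maxr M1 M2) v2)).
rewrite linear_sum scaler_sumr; apply: eq_bigr => j _.
rewrite linear_sum scaler_sumr; apply: eq_bigr => G _ /=.
have [->|gG] := eqVneq (g G) 0; first by rewrite !scale0r scaler0 linear0.
by rewrite fsignZ fsign_rep -(gb _ gG) signr_odd !scalerA mulrC.
Qed.

Lemma tsign_fsign k (y : np_fun V) :
  tpar false y + (-1) ^+ k *: tpar true y = (-1) ^+ (n * k) *: fsign k y.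
Proof.
rewrite !tparE -[(-1) ^+ (n * k)]signr_odd oddM /fsign.
case: (odd n); rewrite ?scale1r //= signr_odd scalerDr scalerA -expr2 sqrr_sign.
by rewrite scale1r addrC.
Qed.

Lemma suspE (p : nat) (x : {ffun 'I_p.+1 -> np_fun V}) :
  susp x = [ffun i : 'I_p.+1 => (-1) ^+ (n * (p - i)) *: fsign (n * (p - i)) (x i)].
Proof.
apply/ffunP => i; rewrite !ffunE tsign_fsign mulnA -signr_odd !oddM andbb.
by rewrite -oddM signr_odd.
Qed.

Lemma insert1_susp (q r p : nat) (g : gra K r) (g' : gra K q) (b : bool)
    (x : {ffun 'I_p.+1 -> np_fun V}) :
  p = (q + r)%N -> gra_fin n g -> gra_fin n g' ->
  (forall G, g' G != 0 -> odd (n * r * (q + size G)) = b) ->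
  insert1 (fun y => Rep g (susp y)) (fun y => Rep g' (susp y)) x =
  (-1) ^+ b *: Rep (gra_comp1 g g') (susp x).
Proof.
move=> defp gfin g'fin gb; rewrite (Rep_comp1 (V := V) defp _ gfin g'fin) !insert1E //.
set s := (n * r)%N; have Rm := multilinear_Rep (V := V) gfin.
have Rm' := multilinear_Rep (V := V) g'fin.
apply: (mlin_scale (i := ord0)) => // [j j0|].
  rewrite suspE ffunE [RHS]ffunE [upd _ _ _ j]ffunE (negbTE j0) ffunE suspE.
  rewrite [high _ _ _ _]ffunE ffunE (_ : p - @inord p (q + j) = r - j)%N //.
  by rewrite (val_high defp) defp subnDl.
rewrite suspE ffunE [upd _ _ _ _]ffunE [upd _ _ _ _ in RHS]ffunE eqxx subn0 -/s.
rewrite (@fsign_Rep _ (b (+) odd (s * q)) _ _ _ g'fin); last first.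
  move=> G gG; rewrite -(gb _ gG) mulnDr oddD addbC addKb.
  by rewrite -/s !oddM; case: (odd n); rewrite /= ?andbF ?andbT.
have -> : [ffun i : 'I_q.+1 => fsign s (susp (low q x) i)] =
    [ffun i : 'I_q.+1 => (-1) ^+ s *: low q (susp x) i].
  apply/ffunP => i; rewrite !suspE ffunE ffunE [RHS]ffunE [low q _ i]ffunE.
  rewrite [low q _ i]ffunE ffunE (val_emb defp) fsignZ fsign_fsign scalerA -exprD.
  have -> : (p - i = r + (q - i))%N by have := ltn_ord i; lia.
  by rewrite mulnDr -/s addnA (exprD _ (s + s)) addnn -(signr_odd _ s.*2) odd_double mul1r.
rewrite mlinZ // prodr_const card_ord !scalerA; congr (_ *: _).
rewrite signr_addb signr_odd -exprM mulnS exprD.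
have := sqrr_sign K s; have := sqrr_sign K (s * q).
move: ((-1) ^+ s) ((-1) ^+ (s * q)) ((-1) ^+ b) => A Q B QQ AA.
transitivity ((A ^+ 2) * (Q ^+ 2) * B); first by ring.
by rewrite AA QQ !mul1r.
Qed.

End Suspension.

Section GraFin.
Variables (K : fieldType) (n p : nat).
Implicit Types (g h : gra K p).

Lemma gra_fin_lin (a : K) g h : gra_fin n g -> gra_fin n h ->
  gra_fin n (fun G => a * g G + h G).
Proof.
case=> [?|[M gM]]; first by left.
case=> [?|[M' gM']]; [by left|right; exists (maxn M M') => G].
by rewrite geq_max => /andP[/gM -> /gM' ->]; rewrite mulr0 addr0.
Qed.

Lemma gra_fin0 : gra_fin n (fun _ : seq (edge p) => 0 : K).
Proof. by right; exists 0%N. Qed.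

Lemma gra_sum_nil (I : Type) (P : pred I) (a : I -> K) (h : I -> gra K p) :
  (fun G => \sum_(k <- [::] | P k) a k * h k G) = (fun=> 0) :> gra K p.
Proof. by apply: functional_extensionality => G; rewrite big_nil. Qed.

Lemma gra_sum_cons (I : Type) (k : I) (r : seq I) (P : pred I) (a : I -> K) (h : I -> gra K p) :
  (fun G => \sum_(k <- k :: r | P k) a k * h k G) =
  (fun G => if P k then a k * h k G + \sum_(k <- r | P k) a k * h k G
            else \sum_(k <- r | P k) a k * h k G) :> gra K p.
Proof. by apply: functional_extensionality => G; rewrite big_cons. Qed.

Lemma gra_fin_sum (I : Type) (r : seq I) (P : pred I) (a : I -> K) (h : I -> gra K p) :
  (forall k, P k -> gra_fin n (h k)) ->
  gra_fin n (fun G => \sum_(k <- r | P k) a k * h k G).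
Proof.
move=> hfin; elim: r => [|k r IH].
  by rewrite gra_sum_nil; apply: gra_fin0.
rewrite gra_sum_cons.
by case Pk: (P k) => //; apply: gra_fin_lin => //; apply: hfin.
Qed.

Lemma gra_fin_act g s : gra_fin n g -> gra_fin n (gra_act g s).
Proof.
by case=> [?|[M gM]]; [left|right; exists M => G leMG; apply: gM; rewrite size_map].
Qed.

Variable V : npManifold K n.

Lemma Rep_sum (I : Type) (r : seq I) (P : pred I) (a : I -> K) (h : I -> gra K p) f :
  (forall k, P k -> gra_fin n (h k)) ->
  Rep (V := V) (fun G => \sum_(k <- r | P k) a k * h k G) f =
  \sum_(k <- r | P k) a k *: Rep (h k) f.
Proof.
move=> hfin; elim: r => [|k r IH].
  rewrite big_nil gra_sum_nil.
  rewrite /Rep (@lsum_eq _ _ 0) ?big_ord0 // => k _.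
  by apply: big1 => G _; rewrite scale0r.
rewrite gra_sum_cons big_cons; case Pk: (P k) => //.
by rewrite Rep_lin ?IH //; [apply: hfin|apply: gra_fin_sum].
Qed.

Lemma RepZ (a : K) g f : gra_fin n g -> Rep (V := V) (fun G => a * g G) f = a *: Rep g f.
Proof.
move=> gfin; have := @Rep_sum _ [:: tt] xpredT (fun=> a) (fun=> g) f (fun _ _ => gfin).
rewrite big_seq1 => <-; congr (Rep _ _); apply: functional_extensionality => G.
by rewrite big_seq1.
Qed.

End GraFin.

Lemma exprz_sign (K : fieldType) (z : int) : (-1) ^ z = (-1) ^+ `|z|%N :> K.
Proof.
case: z => k //; rewrite NegzE abszN /= -exprnN.
by rewrite -exprVn invrN invr1.
Qed.

Section Morphism.
Variables (K : fieldType) (n : nat) (V : npManifold K n).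
Implicit Types (g h : fgc K) (m : int).

Definition fgc_graded m g : Prop := forall p (G : seq (edge p)), g p G != 0 ->
  n.+1%:Z * p%:Z + (size G)%:Z * (1 - n.+1%:Z) = m.

Lemma gra_fin_graded m g p : fgc_graded m g -> gra_fin n (g p).
Proof.
move=> gm; case: (posnP n) => [->|n0]; first by left.
right; exists (`|m| + n.+1 * p).+1%N => G leG; apply/eqP/negPn/negP => /gm; nia.
Qed.

Lemma permute_argsZ (p : nat) (F : nmap V p) (a : K) (s : 'S_p.+1) x :
  permute_args (fun y => a *: F y) s x = a *: permute_args F s x.
Proof.
by rewrite /permute_args scaler_sumr; apply: eq_bigr => e _; rewrite !scalerA mulrC.
Qed.

Lemma gra_fin_circ m m' g h p : fgc_graded m g -> fgc_graded m' h ->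
  gra_fin n (fgc_circ n.+1 g h (p := p)).
Proof.
move=> gm hm; rewrite /fgc_circ.
have E : (fun G : seq (edge p) => \sum_(q < p.+1) \sum_(s : 'S_p.+1 | shuffle q (s^-1)%g)
    (-1) ^+ (n.+1 * s) * gra_act (gra_comp1 (p := p) (g (p - q)%N) (h q)) s G) =
  (fun G : seq (edge p) => \sum_(q < p.+1) 1 * \sum_(s : 'S_p.+1 | shuffle q (s^-1)%g)
    (-1) ^+ (n.+1 * s) * gra_act (gra_comp1 (p := p) (g (p - q)%N) (h q)) s G) :> gra K p.
  by apply: functional_extensionality => G; apply: eq_bigr => q _; rewrite mul1r.
rewrite E; apply: gra_fin_sum => q _; apply: gra_fin_sum => s _.
apply: gra_fin_act; apply: gra_fin_comp1.
- exact: (gra_fin_graded _ gm).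
- exact: (gra_fin_graded _ hm).
Qed.

Lemma sRep_circ m m' g h p x : fgc_graded m g -> fgc_graded m' h ->
  sRep V (fgc_circ n.+1 g h) p x = nr_circ m' (sRep V g) (sRep V h) x.
Proof.
move=> gm hm; rewrite /sRep /nr_circ.
have cfin (q : 'I_p.+1) : gra_fin n (gra_comp1 (p := p) (g (p - q)%N) (h q)).
  by apply: gra_fin_comp1; [apply: (gra_fin_graded _ gm)|apply: (gra_fin_graded _ hm)].
rewrite -[fgc_circ n.+1 g h (p := p)]/(fun G => _).
transitivity (\sum_(q < p.+1) \sum_(s : 'S_p.+1 | shuffle q (s^-1)%g)
    (-1) ^+ (n.+1 * s) *: Rep (gra_act (gra_comp1 (p := p) (g (p - q)%N) (h q)) s) (susp x)).
  transitivity (Rep (V := V) (fun G : seq (edge p) => \sum_(q < p.+1) 1 *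
    \sum_(s : 'S_p.+1 | shuffle q (s^-1)%g)
    (-1) ^+ (n.+1 * s) * gra_act (gra_comp1 (p := p) (g (p - q)%N) (h q)) s G) (susp x)).
    congr (Rep _ _); apply: functional_extensionality => G.
    by apply: eq_bigr => q _; rewrite mul1r.
  rewrite Rep_sum => [|q _]; last by apply: gra_fin_sum => s _; apply: gra_fin_act.
  apply: eq_bigr => q _; rewrite scale1r Rep_sum // => s _; exact: gra_fin_act.
apply: eq_bigr => q _.
pose b := odd `|((p - q)%N%:Z * (m' - q%:Z) : int)|.
have hb (G : seq (edge q)) : h q G != 0 -> odd (n * (p - q) * (q + size G)) = b.
  move=> /hm hG; rewrite /b -hG.
  have -> : n.+1%:Z * q%:Z + (size G)%:Z * (1 - n.+1%:Z) - q%:Z = n%:Z * (q%:Z - (size G)%:Z)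
    :> int.
    by rewrite -addn1 PoszD; ring.
  have odd_sub : odd `|q%:Z - (size G)%:Z : int| = odd (q + size G) by lia.
  by rewrite !abszM !oddM odd_sub; case: (odd n) (odd (p - q)) => [] [].
have E : (fun y => insert1 (fun y => Rep (g (p - q)%N) (susp y)) (fun y => Rep (h q) (susp y)) y) =
  (fun y : {ffun 'I_p.+1 -> np_fun V} =>
     (-1) ^+ b *: Rep (gra_comp1 (p := p) (g (p - q)%N) (h q)) (susp y)).
  apply: functional_extensionality => y; apply: insert1_susp => //.
  - by rewrite subnKC // -ltnS.
  - exact: (gra_fin_graded _ gm).
  - exact: (gra_fin_graded _ hm).
rewrite (reindex_inj invg_inj) scaler_sumr /=; apply: eq_big => s; first by rewrite invgK.
move=> _; rewrite -[insert1 _ _]/(fun y => _) E permute_argsZ permute_args_susp //.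
rewrite odd_permV exprz_sign !scalerA; congr (_ *: _).
rewrite -[(-1) ^+ `|_|%N]signr_odd -/b mulSn exprD.
have := sqrr_sign K b; move: ((-1) ^+ b) ((-1) ^+ s) ((-1) ^+ (n * s)) => B S N BB.
by transitivity ((B ^+ 2) * (S * N)); [rewrite BB mul1r|ring].
Qed.

Lemma sRep_br m m' g h p x : fgc_graded m g -> fgc_graded m' h ->
  sRep V (fgc_br n.+1 m m' g h) p x = nr_br m m' (sRep V g) (sRep V h) x.
Proof.
move=> gm hm; rewrite /nr_br -(sRep_circ x gm hm) -(sRep_circ x hm gm) /sRep.
rewrite addrC -scaleNr -Rep_lin; first 1 last.
- exact: gra_fin_circ hm gm.
- exact: gra_fin_circ gm hm.
congr (Rep _ _); apply: functional_extensionality => G.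
by rewrite /fgc_br addrC mulNr.
Qed.

Lemma sRep_lin m (a : K) g h p x : fgc_graded m g -> fgc_graded m h ->
  sRep V (fun p G => a * g p G + h p G) p x = a *: sRep V g p x + sRep V h p x.
Proof. by move=> gm hm; apply: Rep_lin; apply: gra_fin_graded; eassumption. Qed.

Lemma Gamma_graded : fgc_graded 1 (@fgc_Gamma K).
Proof.
move=> p G; rewrite /fgc_Gamma; have [p1|] := eqVneq p 1%N; last by rewrite eqxx.
by case: (G =P _) => [->|]; rewrite /= ?eqxx // p1 => _; lia.
Qed.

Lemma sRep_Gamma : sRep V (@fgc_Gamma K) = schouten V.
Proof.
apply: functional_extensionality_dep => p; apply: functional_extensionality => x.
have RepG0 : p != 1%N -> sRep V (@fgc_Gamma K) p x = 0.
  move=> /negbTE p1; rewrite /sRep /Rep (@lsum_eq _ _ 0) ?big_ord0 // => k _.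
  by apply: big1 => G _; rewrite /fgc_Gamma p1 scale0r.
case: p x RepG0 => [|[|p]] x RepG0; try exact: RepG0.
rewrite /sRep /Rep /= /poisson (@lsum_single _ _ 1) => [|k k1].
  rewrite (bigD1 [tuple (inord 0, inord 1)]) //= /fgc_Gamma [_ == [:: _]]eqxx scale1r big1
    ?addr0 // => G.
  by rewrite -val_eqE /= => /negbTE ->; rewrite scale0r.
apply: big1 => G _; rewrite /fgc_Gamma /=; case: eqP => [GE|]; last by rewrite scale0r.
by have := size_tuple G; rewrite GE /= => k1'; rewrite -k1' in k1.
Qed.

Lemma sRep_diff m g p x : fgc_graded m g ->
  sRep V (fgc_br n.+1 1 m (@fgc_Gamma K) g) p x = nr_br 1 m (schouten V) (sRep V g) x.
Proof. by move=> gm; rewrite (sRep_br x Gamma_graded gm) sRep_Gamma. Qed.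

Lemma sRep_deg m g : fgc_deg n.+1 m g -> ce_deg m (sRep V g).
Proof.
move=> [gm gS] p; have gfin := gra_fin_graded p gm; split.
- have := multilinear_cmap (multilinear_Rep (V := V) gfin)
    (h := fun i y => tpar false y + (-1) ^+ (n * (p - i)) *: tpar true y).
  by apply=> i a u v; rewrite !tsign_fsign fsign_linear scalerDr !scalerA mulrC.
- move=> a x ax; rewrite /sRep.
  have [M v] := rep_vanishP (susp x) gfin; rewrite (RepE v).
  apply: homog_sum => k _; apply: homog_sum => G _.
  have [->|gG] := eqVneq (g p G) 0; first by rewrite scale0r; apply: homog0.
  apply: homogZ.
  have sx j : homog (a j)%:Z (susp x j).
    by rewrite suspE ffunE; apply/homogZ/homog_fsign/ax.
  have := homog_rep G sx; congr homog; rewrite -(gm _ _ gG) sumrB sumr_const card_ord.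
  rewrite -mulr_natr natz; move: (\sum_j _) (size G) => S N; rewrite -(addn1 n) -(addn1 p)
    !PoszD PoszM; ring.
move=> s x; rewrite -[permute_args _ _ _]/(permute_args (fun y => Rep (g p) (susp y)) s x).
rewrite permute_args_susp // (Rep_gra_eq _ (gS p (s^-1)%g)) RepZ // scalerA.
rewrite odd_permV -exprD -mulnDl addnS addnn -signr_odd oddM /= odd_double /=.
by rewrite oddb.
Qed.

Lemma sRep_morphism : @dgl_morphism K (fGC K n.+1) (CE_Tpoly V) (sRep V).
Proof.
split.
- exact: sRep_deg.
- by move=> m g h _ _ gh p x; apply: Rep_gra_eq.
- by move=> m a g h [gm _] [hm _] p x; apply: sRep_lin gm hm.
- by move=> m m' g h [gm _] [hm _] p x; apply: sRep_br gm hm.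
- by move=> m g [gm _] p x; apply: sRep_diff gm.
Qed.

End Morphism.

(** * Contractions of products of linear forms *)

Section Wick.
Variables (K : fieldType) (n : nat) (V : npManifold K n) (p : nat).
Implicit Types (M : nmap V p) (f : {ffun 'I_p.+1 -> np_fun V}) (i j : 'I_p.+1) (c : coord V).

(* A linear form \sum_c h.1 c * c in the coordinates, of degree h.2. *)
Definition lform : Type := ({ffun coord V -> K} * nat)%type.

Implicit Types (h : lform).

Definition lform_deg h : Prop := forall c, h.1 c != 0 -> cdeg c = h.2.

Definition lform_fun h : np_fun V := \sum_c h.1 c *: np_crd c.

Definition pairing h h' : K := \sum_(q : coord V * coord V) weight q.1 q.2 * (h.1 q.1 * h'.1 q.2).

Lemma diff_lform c h : np_diff c (lform_fun h) = h.1 c *: 1.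
Proof.
rewrite /lform_fun linear_sum (bigD1 c) //= linearZ /= np_diff_crd eqxx big1 ?addr0 // => c'
  /negbTE cc'.
by rewrite linearZ /= np_diff_crd eq_sym cc' scaler0.
Qed.

Lemma fsign_lform k h : lform_deg h -> fsign k (lform_fun h) = (-1) ^+ (k * h.2) *: lform_fun h.
Proof.
move=> hd; rewrite /lform_fun linear_sum scaler_sumr; apply: eq_bigr => c _ /=.
have [->|hc] := eqVneq (h.1 c) 0; first by rewrite !scale0r linear0 scaler0.
by rewrite fsignZ (fsign_homog _ (np_crd_deg c)) (hd _ hc) !scalerA mulrC.
Qed.

Definition mult_at i h f : {ffun 'I_p.+1 -> np_fun V} :=
  [ffun l : 'I_p.+1 => if (l < i)%N then fsign h.2 (f l)
    else if l == i then lform_fun h * f l else f l].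

Lemma mult_at_lt i h f (l : 'I_p.+1) : (l < i)%N -> mult_at i h f l = fsign h.2 (f l).
Proof. by rewrite ffunE => ->. Qed.

Lemma mult_at_eq i h f : mult_at i h f i = lform_fun h * f i.
Proof. by rewrite ffunE ltnn eqxx. Qed.

Lemma mult_at_gt i h f (l : 'I_p.+1) : (i < l)%N -> mult_at i h f l = f l.
Proof. by move=> il; rewrite ffunE ltnNge (ltnW il) /= -val_eqE /= gtn_eqF. Qed.

Lemma multilinear_mult_at M i h : multilinear M -> multilinear (fun f => M (mult_at i h f)).
Proof.
move=> Mm; pose g (l : 'I_p.+1) (u : np_fun V) :=
  if (l < i)%N then fsign h.2 u else if l == i then lform_fun h * u else u.
apply: (@multilinear_cmap _ _ _ _ M g) => // l a u v; rewrite /g.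
case: ifP => _; first exact: fsign_linear.
by case: ifP => _ //; rewrite mulrDr scalerAr.
Qed.

Lemma diff_mult_at M c i j h f : multilinear M -> lform_deg h ->
  M (diff_at c i (mult_at j h f)) =
  ((i == j)%:R * h.1 c) *: M f + (-1) ^+ (cdeg c * h.2) *: M (mult_at j h (diff_at c i f)).
Proof.
move=> Mm hd; case: (ltngtP i j) => [ij|ji|/val_inj ->].
- have -> : i == j = false by rewrite -val_eqE /= ltn_eqF.
  rewrite mul0r scale0r add0r; apply: (mlin_scale (i := i)) => // [l li|]; last first.
    by rewrite diff_at_eq !(mult_at_lt _ _ ij) diff_at_eq np_diff_fsign mulnC.
  case: (ltngtP l i) li => [li _|il _|/val_inj ->]; last by rewrite eqxx.
    by rewrite (diff_at_lt _ _ li) !(mult_at_lt _ _ (ltn_trans li ij)) (diff_at_lt _ _ li)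
      !fsign_fsign addnC.
  rewrite (diff_at_gt _ _ il); case: (ltngtP l j) => [lj|jl|/val_inj lj].
  + by rewrite !(mult_at_lt _ _ lj) (diff_at_gt _ _ il).
  + by rewrite !(mult_at_gt _ _ jl) (diff_at_gt _ _ il).
  by rewrite lj !mult_at_eq (diff_at_gt _ _ ij).
- have -> : i == j = false by rewrite -val_eqE /= gtn_eqF.
  rewrite mul0r scale0r add0r; apply: (mlin_scale (i := j)) => // [l lj|]; last first.
    rewrite (diff_at_lt _ _ ji) !mult_at_eq (diff_at_lt _ _ ji) fsign_mul fsign_lform //.
    by rewrite scalerAl.
  case: (ltngtP l j) lj => [lj _|jl _|/val_inj ->]; last by rewrite eqxx.
    by rewrite (diff_at_lt _ _ (ltn_trans lj ji)) !(mult_at_lt _ _ lj) (diff_at_lt _ _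
      (ltn_trans lj ji)) !fsign_fsign addnC.
  rewrite (mult_at_gt _ _ jl); case: (ltngtP l i) => [li|il|/val_inj li].
  + by rewrite !(diff_at_lt _ _ li) (mult_at_gt _ _ jl).
  + by rewrite !(diff_at_gt _ _ il) (mult_at_gt _ _ jl).
  by rewrite li !diff_at_eq (mult_at_gt _ _ ji).
rewrite eqxx mul1r.
pose g : {ffun 'I_p.+1 -> np_fun V} := [ffun l : 'I_p.+1 =>
  if (l < j)%N then fsign (cdeg c + h.2) (f l) else f l].
have E : diff_at c j (mult_at j h f) =
    upd g j (h.1 c *: f j + (-1) ^+ (cdeg c * h.2) *: (lform_fun h * np_diff c (f j))).
  apply/ffunP => l; rewrite [RHS]ffunE [g l]ffunE.
  case: (ltngtP l j) => [lj|jl|/val_inj ->].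
  - by rewrite (diff_at_lt _ _ lj) (mult_at_lt _ _ lj) fsign_fsign -val_eqE /= ltn_eqF.
  - by rewrite (diff_at_gt _ _ jl) (mult_at_gt _ _ jl) -val_eqE /= gtn_eqF.
  rewrite eqxx diff_at_eq mult_at_eq np_diffM diff_lform fsign_lform //.
  by rewrite -!scalerAl mul1r.
rewrite E multilinear_upd //; congr (_ + _).
  have [->|hc] := eqVneq (h.1 c) 0; first by rewrite !scale0r.
  congr (_ *: M _); apply/ffunP => l; rewrite !ffunE (hd _ hc); case: eqP => [->//|_].
  by case: ifP => // _; rewrite fsign_even // addnn odd_double.
apply: (mlin_scale (i := j)) => // [l lj|].
  rewrite ffunE (negbTE lj) ffunE.
  case: (ltngtP l j) lj => [lj _|jl _|/val_inj ->]; last by rewrite eqxx.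
    by rewrite (mult_at_lt _ _ lj) (diff_at_lt _ _ lj) fsign_fsign addnC.
  by rewrite (mult_at_gt _ _ jl) (diff_at_gt _ _ jl).
by rewrite ffunE eqxx mult_at_eq diff_at_eq.
Qed.

(* An edge together with linear forms placed at its source and its target. *)
Definition dedge : Type := (edge p * (lform * lform))%type.

Definition state (S : seq dedge) : {ffun 'I_p.+1 -> np_fun V} :=
  foldr (fun E f => mult_at E.1.1 E.2.1 (mult_at E.1.2 E.2.2 f)) [ffun=> 1] S.

Definition orth h (S : seq dedge) : Prop := forall E, E \in S ->
  [/\ pairing h E.2.1 = 0, pairing h E.2.2 = 0, pairing E.2.1 h = 0 & pairing E.2.2 h = 0].

Fixpoint frame (S : seq dedge) : Prop :=
  if S is E :: S' then
    [/\ lform_deg E.2.1, lform_deg E.2.2, (E.2.1.2 + E.2.2.2)%N = n,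
        orth E.2.1 S' & orth E.2.2 S' ] /\ frame S'
  else True.

Lemma contract_orth (k : coord V -> K) (d : nat) M i (S : seq dedge) : multilinear M ->
  (forall c, k c != 0 -> cdeg c = d) -> frame S ->
  (forall E, E \in S -> \sum_c k c * E.2.1.1 c = 0 /\ \sum_c k c * E.2.2.1 c = 0) ->
  \sum_c k c *: M (diff_at c i (state S)) = 0.
Proof.
move=> Mm kd; elim: S M Mm => [|E S IH] M Mm /=.
  move=> _ _; apply: big1 => c _; rewrite (mlin_zero (i := i)) ?scaler0 //.
  by rewrite diff_at_eq ffunE np_diff1.
move=> [[hd1 hd2 _ _ _] frS] kS.
have [k1 k2] := kS E (mem_head _ _).
pose M1 f := M (mult_at E.1.1 E.2.1 f); pose M2 f := M1 (mult_at E.1.2 E.2.2 f).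
have M1m : multilinear M1 by apply: multilinear_mult_at.
have M2m : multilinear M2 by apply: multilinear_mult_at.
have step M' j h f : multilinear M' -> lform_deg h -> \sum_c k c * h.1 c = 0 ->
    \sum_c k c *: M' (diff_at c i (mult_at j h f)) =
    (-1) ^+ (d * h.2) *: \sum_c k c *: M' (mult_at j h (diff_at c i f)).
  move=> M'm hd k0; under eq_bigr => c _ do rewrite diff_mult_at // scalerDr !scalerA.
  rewrite big_split /= [X in X + _](_ : _ = 0) ?add0r; last first.
    rewrite -scaler_suml; under eq_bigr => c _ do rewrite mulrCA.
    by rewrite -mulr_sumr k0 mulr0 scale0r.
  rewrite scaler_sumr; apply: eq_bigr => c _.
  have [->|kc] := eqVneq (k c) 0; first by rewrite !mul0r !scale0r scaler0.
  by rewrite (kd _ kc) scalerA mulrC.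
rewrite step // -/(M1 _); under eq_bigr => c _ do rewrite -/(M1 _).
rewrite (step M1) // (IH M2) ?scaler0 // => E' E'S; apply: kS.
by rewrite inE E'S orbT.
Qed.

Definition edge_coef (E : dedge) : K := (-1) ^+ (E.2.1.2 * E.2.2.2) * pairing E.2.1 E.2.2.

Lemma pairing_flip h h' : lform_deg h -> lform_deg h' ->
  pairing h' h = flip_sign K n * ((-1) ^+ (h.2 * h'.2) * pairing h h').
Proof.
move=> hd hd'; rewrite /pairing !mulr_sumr.
rewrite (reindex_inj (h := fun q : coord V * coord V => (q.2, q.1))) /=; last first.
  by move=> [a a'] [b b'] [-> ->].
apply: eq_bigr => -[c c'] _ /=.
have [->|hc] := eqVneq (h.1 c) 0; first by rewrite !(mulr0, mul0r).
have [->|hc'] := eqVneq (h'.1 c') 0; first by rewrite !(mulr0, mul0r).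
have := weight_flip c c'; rewrite (hd _ hc) (hd' _ hc') => wf.
have : (weight c' c * (-1) ^+ (h.2 * h'.2)) * (-1) ^+ (h.2 * h'.2) = weight c' c.
  by rewrite -mulrA -expr2 sqrr_sign mulr1.
by rewrite wf => <-; ring.
Qed.

Lemma orth_sum_r (sgn : nat -> nat -> K) h M i S : multilinear M -> lform_deg h ->
  frame S -> orth h S ->
  \sum_(q : coord V * coord V)
    (weight q.1 q.2 * sgn (cdeg q.1) (cdeg q.2) * h.1 q.2) *: M (diff_at q.1 i (state S)) = 0.
Proof.
move=> Mm hd frS oS; pose k c := \sum_c' weight c c' * h.1 c'.
have kd c : k c != 0 -> cdeg c = (n - h.2)%N.
  move=> kc; have [c' wc'] : exists c', weight c c' * h.1 c' != 0.
    apply/existsP; apply: contraNT kc => /existsPn k0; apply/eqP/big1 => c' _.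
    by apply/eqP; have := k0 c'; rewrite negbK.
  have [w hc'] : weight c c' != 0 /\ h.1 c' != 0.
    by apply/andP; rewrite -negb_or -mulf_eq0.
  by have := weight_deg w; rewrite (hd _ hc'); lia.
rewrite -(pair_bigA _ (fun c c' => (weight c c' * sgn (cdeg c) (cdeg c') * h.1 c')
   *: M (diff_at c i (state S)))) /=.
transitivity (sgn (n - h.2)%N h.2 *: \sum_c k c *: M (diff_at c i (state S))).
  rewrite scaler_sumr; apply: eq_bigr => c _; rewrite -scaler_suml scalerA; congr (_ *: _).
  rewrite mulr_sumr; apply: eq_bigr => c' _.
  have [->|w] := eqVneq (weight c c') 0; first by rewrite !mul0r mulr0.
  have [->|hc'] := eqVneq (h.1 c') 0; first by rewrite !mulr0.
  have wd := weight_deg w; rewrite (hd _ hc') in wd.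
  by rewrite (hd _ hc') (_ : cdeg c = n - h.2)%N; [ring|lia].
rewrite (@contract_orth k (n - h.2)%N) ?scaler0 // => E ES.
have pair_k (g : lform) : \sum_c k c * g.1 c = pairing g h.
  rewrite /pairing -(pair_bigA _ (fun c c' => weight c c' * (g.1 c * h.1 c'))) /=.
  apply: eq_bigr => c _; rewrite mulr_suml; apply: eq_bigr => c' _; ring.
by rewrite !pair_k; have [] := oS E ES.
Qed.

Lemma orth_sum_l (sgn : nat -> nat -> K) h M i S : multilinear M -> lform_deg h ->
  frame S -> orth h S ->
  \sum_(q : coord V * coord V)
    (weight q.1 q.2 * sgn (cdeg q.1) (cdeg q.2) * h.1 q.1) *: M (diff_at q.2 i (state S)) = 0.
Proof.
move=> Mm hd frS oS; rewrite -[RHS](orth_sum_r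
  (fun d d' => flip_sign K n * (-1) ^+ (d * d') * sgn d' d) i Mm hd frS oS).
rewrite (reindex_inj (h := fun q : coord V * coord V => (q.2, q.1))) /=; last first.
  by move=> [a a'] [b b'] [-> ->].
apply: eq_bigr => -[c c'] _ /=; congr (_ *: _).
have -> : weight c' c = flip_sign K n * weight c c' * (-1) ^+ (cdeg c * cdeg c').
  by rewrite -weight_flip -mulrA -expr2 sqrr_sign mulr1.
by ring.
Qed.

Lemma comp_Delta_state_cons M i j E S : multilinear M -> frame (E :: S) ->
  comp_Delta M (i, j) (state (E :: S)) =
  (edge_coef E * (((i, j) == E.1)%:R + flip_sign K n * ((j, i) == E.1)%:R)) *: M (state S)
  + (-1) ^+ n *: comp_Delta (fun f => M (mult_at E.1.1 E.2.1 (mult_at E.1.2 E.2.2 f))) (i, j)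
    (state S).
Proof.
case: E => -[a b] [h h'] Mm; case=> -[hd hd' dn oh oh'] frS.
rewrite /= in hd hd' dn oh oh'.
pose Y := state S; have -> : state (((a, b), (h, h')) :: S) = mult_at a h (mult_at b h' Y) by [].
rewrite -/Y !comp_DeltaE /=.
pose M1 f := M (mult_at a h f); pose M2 f := M (mult_at b h' f).
pose M3 f := M1 (mult_at b h' f).
have M1m : multilinear M1 by apply: multilinear_mult_at.
have M2m : multilinear M2 by apply: multilinear_mult_at.
have M3m : multilinear M3 by apply: multilinear_mult_at.
have expand c c' : M (diff_at c i (diff_at c' j (mult_at a h (mult_at b h' Y)))) = 
    ((j == a)%:R * h.1 c') *: (((i == b)%:R * h'.1 c) *: M Y
       + (-1) ^+ (cdeg c * h'.2) *: M2 (diff_at c i Y))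
  + (-1) ^+ (cdeg c' * h.2) *: (((j == b)%:R * h'.1 c') *: (((i == a)%:R * h.1 c) *: M Y
       + (-1) ^+ (cdeg c * h.2) *: M1 (diff_at c i Y))
     + (-1) ^+ (cdeg c' * h'.2) *: (((i == a)%:R * h.1 c) *: M2 (diff_at c' j Y)
         + (-1) ^+ (cdeg c * h.2) *: (((i == b)%:R * h'.1 c) *: M1 (diff_at c' j Y)
            + (-1) ^+ (cdeg c * h'.2) *: M3 (diff_at c i (diff_at c' j Y))))).
  have Dm := multilinear_diff_at c i Mm.
  rewrite (diff_mult_at c' j a (mult_at b h' Y) Dm hd).
  rewrite (diff_mult_at c i b Y Mm hd'); congr (_ *: _ + _ *: _).
  have D1m := multilinear_mult_at a h Dm.
  rewrite (diff_mult_at c' j b Y D1m hd'); congr (_ *: _ + _ *: _).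
    by rewrite (diff_mult_at c i a Y Mm hd).
  rewrite (diff_mult_at c i a _ Mm hd); congr (_ *: _ + _ *: _).
  by rewrite -/(M1 _) (diff_mult_at c i b _ M1m hd').
pose sg (x y : nat) : K := (-1) ^+ (x * y).
transitivity (\sum_(q : coord V * coord V)
  ((((i == b)%:R * (j == a)%:R) * (weight q.1 q.2 * (h'.1 q.1 * h.1 q.2))) *: M Y
   + (weight q.1 q.2 * ((j == a)%:R * sg (cdeg q.1) h'.2) * h.1 q.2) *: M2 (diff_at q.1 i Y)
   + (((((i == a)%:R * (j == b)%:R) * sg h'.2 h.2) * (weight q.1 q.2 * (h.1 q.1 * h'.1 q.2))) *: M Y
      + (weight q.1 q.2 * ((j == b)%:R * (sg (cdeg q.2) h.2 * sg (cdeg q.1) h.2)) * h'.1 q.2)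
         *: M1 (diff_at q.1 i Y)
      + ((weight q.1 q.2 * ((i == a)%:R * (sg (cdeg q.2) h.2 * sg (cdeg q.2) h'.2)) * h.1 q.1)
           *: M2 (diff_at q.2 j Y)
         + ((weight q.1 q.2 * ((i == b)%:R * (sg (cdeg q.2) h.2 * sg (cdeg q.2) h'.2 * sg (cdeg
           q.1) h.2))
               * h'.1 q.1) *: M1 (diff_at q.2 j Y)
            + (-1) ^+ n *: (weight q.1 q.2 *: M3 (diff_at q.1 i (diff_at q.2 j Y)))))))).
  apply: eq_bigr => -[c c'] _ /=; rewrite expand !scalerDr !scalerA.
  have [w0|w] := eqVneq (weight c c') 0; first by rewrite w0 !(mul0r, mulr0, scale0r).
  congr (_ *: _ + _ *: _ + (_ *: _ + _ *: _ + (_ *: _ + (_ *: _ + _ *: _)))); rewrite /sg; try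
    by ring.
    have [->|hc'] := eqVneq (h'.1 c') 0; first by rewrite !(mulr0, mul0r).
    by rewrite (hd' _ hc'); ring.
  rewrite [RHS]mulrC -!mulrA -!exprD; congr (_ * _).
  rewrite -!mulnDr addnA -mulnDr -mulnDl [(cdeg c' + _)%N]addnC (weight_deg w) dn.
  by rewrite -signr_odd oddM andbb signr_odd.
rewrite !big_split /=.
rewrite [X in _ + X + _](orth_sum_r (fun x y => (j == a)%:R * sg x h'.2)) // addr0.
rewrite [X in _ + (_ + X + _)](orth_sum_r (fun x y => (j == b)%:R * (sg y h.2 * sg x h.2))) //
  addr0.
rewrite [X in _ + (_ + (X + _))](orth_sum_l (fun x y => (i == a)%:R * (sg y h.2 * sg y h'.2)))
  // add0r.
rewrite [X in _ + (_ + (X + _))](orth_sum_l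
  (fun x y => (i == b)%:R * (sg y h.2 * sg y h'.2 * sg x h.2))) // add0r.
rewrite -!scaler_suml -!mulr_sumr -!/(pairing _ _) -scaler_sumr addrA -scalerDl; congr (_ *: _ + _).
rewrite (pairing_flip hd hd') /edge_coef /= !xpair_eqE -!mulnb !natrM /sg [(h'.2 * _)%N]mulnC.
by ring.
Qed.

End Wick.

Section WickSum.
Variables (K : fieldType) (n : nat) (V : npManifold K n) (p : nat).
Implicit Types (M : nmap V p) (i j : 'I_p.+1) (c : coord V) (S : seq (dedge V p)).
Implicit Types (G : seq (edge p)).

Definition remove_nth S (a : nat) : seq (dedge V p) := take a S ++ drop a.+1 S.

Lemma frame_subseq S S' : subseq S' S -> frame S -> frame S'.
Proof.
elim: S S' => [|E S IH] [|E' S'] //= sub [[d1 d2 dn o1 o2] frS].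
case: eqP sub => [->|_] sub; last exact: (IH (E' :: S')).
have subS : {subset S' <= S} by apply: mem_subseq.
split; last exact: IH.
by split=> // E'' /subS; [apply: o1|apply: o2].
Qed.

Lemma frame_remove S a : frame S -> frame (remove_nth S a).
Proof.
apply: frame_subseq; rewrite -{2}(cat_take_drop a S); apply: cat_subseq => //.
by rewrite -[a.+1]add1n -drop_drop drop_subseq.
Qed.

Lemma size_remove S a : (a < size S)%N -> size (remove_nth S a) = (size S).-1.
Proof. by move=> lt; rewrite size_cat size_takel ?size_drop; lia. Qed.

Lemma state_nil M i j : multilinear M -> comp_Delta M (i, j) (state ([::] : seq (dedge V p))) = 0.
Proof.
move=> Mm; rewrite comp_DeltaE big1 // => q _.
have D0 : diff_at q.2 j (state ([::] : seq (dedge V p))) j = 0.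
  by rewrite diff_at_eq ffunE np_diff1.
by rewrite (mlin_zero (multilinear_diff_at q.1 i Mm) D0) scaler0.
Qed.

Variable E0 : dedge V p.

Lemma comp_Delta_state M i j S : multilinear M -> frame S ->
  comp_Delta M (i, j) (state S) =
  \sum_(a < size S) ((-1) ^+ (n * a) * (edge_coef (nth E0 S a) *
     (((i, j) == (nth E0 S a).1)%:R + flip_sign K n * ((j, i) == (nth E0 S a).1)%:R)))
    *: M (state (remove_nth S a)).
Proof.
elim: S M => [|E S IH] M Mm; first by rewrite state_nil // big_ord0.
move=> frES; have [_ frS] := frES.
rewrite comp_Delta_state_cons // big_ord_recl muln0 mul1r; congr (_ + _).
  by rewrite /remove_nth take0 /= drop0.
rewrite IH //; last first.
  exact: (multilinear_mult_at _ _ (multilinear_mult_at _ _ Mm)).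
rewrite scaler_sumr; apply: eq_bigr => a _; rewrite scalerA mulrA -exprD -mulnS.
by congr (_ *: M _).
Qed.

Lemma rep_state_vanish S G : frame S -> (size S < size G)%N -> rep_graph V G (state S) = 0.
Proof.
elim/last_ind: G S => [|G [i j] IH] S frS; first by rewrite ltn0.
rewrite size_rcons ltnS => le; rewrite rep_rcons comp_Delta_state //; last exact: multilinear_rep.
apply: big1 => a _; rewrite IH ?scaler0 //; first exact: frame_remove.
by rewrite size_remove //; have := ltn_ord a; lia.
Qed.

Definition alternating (k : nat) (phi : seq (edge p) -> K) : Prop :=
  (forall G1 x y G2, size (G1 ++ x :: y :: G2) = k ->
    phi (G1 ++ x :: y :: G2) = (-1) ^+ n * phi (G1 ++ y :: x :: G2)) /\
  (forall G1 i j G2, size (G1 ++ (i, j) :: G2) = k ->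
    phi (G1 ++ (j, i) :: G2) = flip_sign K n * phi (G1 ++ (i, j) :: G2)).

Lemma alternating_rcons k phi e : alternating k.+1 phi -> alternating k (fun G => phi (rcons G e)).
Proof.
move=> [sw fl]; split=> [G1 x y G2|G1 i j G2]; rewrite !rcons_cat /= => Gk.
  by apply: sw; rewrite -Gk !size_cat /= size_rcons addnS.
by apply: fl; rewrite -Gk !size_cat /= size_rcons addnS.
Qed.

Lemma alternating_move k phi G1 s x G2 : alternating k phi -> size (G1 ++ x :: s ++ G2) = k ->
  phi (G1 ++ s ++ x :: G2) = (-1) ^+ (n * size s) * phi (G1 ++ x :: s ++ G2).
Proof.
move=> [sw fl]; elim: s G1 => [|y s IH] G1 Gk; first by rewrite muln0 mul1r.
have -> : G1 ++ (y :: s) ++ x :: G2 = rcons G1 y ++ s ++ x :: G2 by rewrite cat_rcons.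
rewrite IH ?cat_rcons; last by rewrite -Gk !size_cat /= !size_cat.
rewrite sw; last by rewrite -Gk !size_cat /= !size_cat.
by rewrite mulrA -exprD mulnS addnC.
Qed.

(* The last edge of G is contracted with one of the edges of S; contracting it with
   the a-th one costs the sign (-1)^(n a), which the alternation of phi absorbs. *)
Lemma wick_sum k phi S : alternating k phi -> frame S -> size S = k ->
  tsum k (fun G => phi G *: rep_graph V G (state S)) =
  ((2 ^ k * k`!)%:R * (\prod_(E <- S) edge_coef E) * phi (rev [seq E.1 | E <- S])) *: 1.
Proof.
elim: k phi S => [|k IH] phi S alt frS Sk.
  move/size0nil: Sk => ->; rewrite tsum0 big_nil mul1r mul1r /rep_graph /=; congr (_ *: _).
  by rewrite big1 // => i _; rewrite ffunE.
rewrite tsum_rcons.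
pose e a := (nth E0 S a).1.
transitivity (\sum_(a < size S) ((-1) ^+ (n * a) * edge_coef (nth E0 S a) * 2%:R) *:
    tsum k (fun G => phi (rcons G (e a)) *: rep_graph V G (state (remove_nth S a)))).
  transitivity (tsum k (fun G => \sum_(a < size S)
     ((-1) ^+ (n * a) * edge_coef (nth E0 S a) * 2%:R) *:
      (phi (rcons G (e a)) *: rep_graph V G (state (remove_nth S a))))); last first.
    by rewrite tsum_sum; apply: eq_bigr => a _; rewrite [in RHS]/tsum scaler_sumr.
  apply: eq_tsum => G Gk.
  have Gm := multilinear_rep (V := V) G.
  transitivity (\sum_(x : edge p) \sum_(a < size S)
     (phi (rcons G x) * ((-1) ^+ (n * a) * (edge_coef (nth E0 S a) *
        ((x == e a)%:R + flip_sign K n * ((x.2, x.1) == e a)%:R))))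
       *: rep_graph V G (state (remove_nth S a))).
    apply: eq_bigr => -[i j] _; rewrite rep_rcons (comp_Delta_state i j Gm frS) scaler_sumr.
    by apply: eq_bigr => a _; rewrite scalerA.
  rewrite exchange_big /=; apply: eq_bigr => a _.
  rewrite -scaler_suml scalerA; congr (_ *: _).
  have delta (F : edge p -> K) y : \sum_(x : edge p) F x * (x == y)%:R = F y.
    rewrite (bigD1 y) //= eqxx mulr1 big1 ?addr0 // => x /negbTE ->.
    by rewrite mulr0.
  pose s := (-1) ^+ (n * a) * edge_coef (nth E0 S a).
  pose sw (x : edge p) : edge p := (x.2, x.1).
  have swK : involutive sw by case.
  transitivity (\sum_(x : edge p) (phi (rcons G x) * s) * (x == e a)%:R +
     \sum_(x : edge p) (phi (rcons G x) * s * flip_sign K n) * (sw x == e a)%:R).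
    by rewrite -big_split /=; apply: eq_bigr => x _; rewrite /s /sw; ring.
  rewrite delta (reindex_inj (inv_inj swK)) /=.
  under [X in _ + X]eq_bigr => x _ do rewrite swK.
  rewrite (delta (fun x => phi (rcons G (sw x)) * s * flip_sign K n)).
  have -> : phi (rcons G (sw (e a))) = flip_sign K n * phi (rcons G (e a)).
    rewrite -!cats1; have := alt.2 G (e a).1 (e a).2 [::].
    by rewrite -surjective_pairing; apply; rewrite size_cat Gk addn1.
  rewrite -/s; have := flip_signM K n; move: (flip_sign K n) => x xx.
  transitivity (phi (rcons G (e a)) * s * (1 + x * x)); first by ring.
  by rewrite xx; ring.
transitivity (\sum_(a < size S) (2%:R * (2 ^ k * k`!)%:R * (\prod_(E <- S) edge_coef E)
    * phi (rev [seq E.1 | E <- S])) *: (1 : np_fun V)); last first.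
  rewrite sumr_const card_ord Sk -scaler_nat scalerA; congr (_ *: _).
  by rewrite !mulrA -!natrM factS expnS; congr (_%:R * _ * _); lia.
apply: eq_bigr => a _.
rewrite (IH _ _ (alternating_rcons (e a) alt) (frame_remove a frS)); last by rewrite
  size_remove // Sk.
rewrite scalerA; congr (_ *: _).
have defS : S = take a S ++ nth E0 S a :: drop a.+1 S by rewrite -drop_nth // cat_take_drop.
have -> : \prod_(E <- S) edge_coef E = edge_coef (nth E0 S a) * \prod_(E <- remove_nth S a)
  edge_coef E.
  by rewrite {1}defS /remove_nth !big_cat big_cons /= mulrCA.
have -> : phi (rcons (rev [seq E.1 | E <- remove_nth S a]) (e a)) =
    (-1) ^+ (n * a) * phi (rev [seq E.1 | E <- S]).
  have revS : rev [seq E.1 | E <- S] =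
      rev [seq E.1 | E <- drop a.+1 S] ++ e a :: rev [seq E.1 | E <- take a S] ++ [::].
    by rewrite {1}defS map_cat /= rev_cat rev_cons cat_rcons cats0.
  have := alternating_move (phi := phi) (k := k.+1) (G1 := rev [seq E.1 | E <- drop a.+1 S])
    (s := rev [seq E.1 | E <- take a S]) (x := e a) (G2 := [::]) alt.
  rewrite -revS !size_rev !size_map size_takel ?(ltnW (ltn_ord a)) // => /(_ Sk) <-.
  by rewrite /remove_nth map_cat rev_cat -cats1 -catA.
have := sqrr_sign K (n * a); move: ((-1) ^+ (n * a)) => x xx.
set P := \prod_(E <- _) _; set A := edge_coef _; set F := phi _.
transitivity ((x ^+ 2) * (A * 2%:R * (2 ^ k * k`!)%:R * P * F)); first by ring.
by rewrite xx; ring.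
Qed.

End WickSum.

(** * Alternating coefficients *)

Section Averaging.
Variables (K : fieldType) (n p k : nat).
Hypothesis charK : [pchar K] =i pred0.

Local Notation coeffs := {ffun k.-tuple (edge p) -> K^o}.
Local Notation rels := <<edge_rels K n.+1 p k>>%VS.
Implicit Types (phi psi : coeffs) (t : 'S_k) (i j : 'I_k) (G : k.-tuple (edge p)).

Definition perm_sign t : K := if odd n.+1 then 1 else (-1) ^+ (t : bool).

Lemma perm_signM t t' : perm_sign (t * t')%g = perm_sign t * perm_sign t'.
Proof. by rewrite /perm_sign odd_permM signr_addb; case: odd; rewrite ?mulr1. Qed.

Lemma perm_signV t : perm_sign (t^-1)%g = perm_sign t.
Proof. by rewrite /perm_sign odd_permV. Qed.

Lemma perm_sign_sqr t : perm_sign t * perm_sign t = 1.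
Proof. by rewrite /perm_sign; case: odd; rewrite ?mulr1 // -expr2 sqrr_sign. Qed.

Lemma perm_edgesM t t' G : perm_edges t (perm_edges t' G) = perm_edges (t * t')%g G.
Proof. by apply: eq_from_tnth => j; rewrite !tnth_mktuple permM. Qed.

Lemma perm_edges1 G : perm_edges 1%g G = G.
Proof. by apply: eq_from_tnth => j; rewrite tnth_mktuple perm1. Qed.

Lemma flip_perm_edges i t G : flip_edge i (perm_edges t G) = perm_edges t (flip_edge (t i) G).
Proof. by apply: eq_from_tnth => j; rewrite !tnth_mktuple (inj_eq perm_inj). Qed.

Lemma flip_edgeK i : involutive (@flip_edge p k i).
Proof.
move=> G; apply: eq_from_tnth => j; rewrite !tnth_mktuple.
by case: eqP => // _; case: (tnth G j).
Qed.

Lemma flip_edgeC i j G : flip_edge i (flip_edge j G) = flip_edge j (flip_edge i G).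
Proof.
apply: eq_from_tnth => l; rewrite !tnth_mktuple.
by case: eqP => // _; case: eqP.
Qed.

Definition act_perm t phi : coeffs := [ffun G => phi (perm_edges t G)].
Definition act_flip i phi : coeffs := [ffun G => phi (flip_edge i G)].

Lemma coeffs_sum phi : phi = \sum_G phi G *: graph1 K G.
Proof.
apply/ffunP => H; rewrite sum_ffunE (bigD1 H) //= !ffunE eqxx big1 ?addr0 => [|G /negbTE GH].
  by rewrite [RHS]mulr1.
by rewrite !ffunE eq_sym GH [LHS]mulr0.
Qed.

Lemma act_perm_rels t phi : act_perm t phi - perm_sign t *: phi \in rels.
Proof.
have -> : act_perm t phi - perm_sign t *: phi =
    \sum_G phi G *: (graph1 K (perm_edges (t^-1)%g G) - perm_sign (t^-1)%g *: graph1 K G).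
  under [RHS]eq_bigr => G _ do rewrite scalerBr scalerA mulrC -scalerA.
  rewrite sumrB -scaler_sumr -coeffs_sum perm_signV; congr (_ - _).
  rewrite [LHS]coeffs_sum (reindex_inj (h := perm_edges (t^-1)%g)) /=.
    by apply: eq_bigr => G _; rewrite ffunE perm_edgesM mulgV perm_edges1.
  by apply: (can_inj (g := perm_edges t)) => G; rewrite perm_edgesM mulgV perm_edges1.
apply: memv_suml => G _; apply: memvZ; apply: memv_span; rewrite mem_cat; apply/orP; left.
by apply/allpairsP; exists ((t^-1)%g, G); rewrite !mem_enum.
Qed.

Lemma act_flip_rels i phi : act_flip i phi - flip_sign K n *: phi \in rels.
Proof.
have -> : act_flip i phi - flip_sign K n *: phi =
    \sum_G phi G *: (graph1 K (flip_edge i G) - flip_sign K n *: graph1 K G).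
  under [RHS]eq_bigr => G _ do rewrite scalerBr scalerA mulrC -scalerA.
  rewrite sumrB -scaler_sumr -coeffs_sum; congr (_ - _).
  rewrite [LHS]coeffs_sum (reindex_inj (inv_inj (flip_edgeK i))) /=.
  by apply: eq_bigr => G _; rewrite ffunE flip_edgeK.
apply: memv_suml => G _; apply: memvZ; apply: memv_span; rewrite mem_cat; apply/orP; right.
by apply/allpairsP; exists (i, G); rewrite !mem_enum.
Qed.

Lemma natr_neq0 m : (0 < m)%N -> m%:R != 0 :> K.
Proof. by rewrite lt0n ((pcharf0P K).1 charK). Qed.

Definition avg_flip i phi : coeffs := 2%:R^-1 *: (phi + flip_sign K n *: act_flip i phi).

Definition avg_perm phi : coeffs := (k`!)%:R^-1 *: \sum_t perm_sign t *: act_perm t phi.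

Lemma avg_flip_rels i phi : phi - avg_flip i phi \in rels.
Proof.
have -> : phi - avg_flip i phi =
    - (2%:R^-1 * flip_sign K n) *: (act_flip i phi - flip_sign K n *: phi).
  have half : phi = 2%:R^-1 *: phi + 2%:R^-1 *: phi.
    by rewrite -scalerDl -mulr2n -[_ *+ 2]mulr_natr mulVf ?scale1r // natr_neq0.
  rewrite /avg_flip [in LHS]scalerDr scalerA opprD addrA {1}half addrK.
  by rewrite scalerBr scalerA mulNr -mulrA flip_signM mulr1 !scaleNr opprK addrC.
by apply: memvZ; apply: act_flip_rels.
Qed.

Lemma avg_perm_rels phi : phi - avg_perm phi \in rels.
Proof.
have -> : phi - avg_perm phi = - (k`!)%:R^-1 *: \sum_t perm_sign t *: (act_perm t phi -
  perm_sign t *: phi).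
  under [in RHS]eq_bigr => t _ do rewrite scalerBr scalerA perm_sign_sqr scale1r.
  rewrite sumrB sumr_const card_Sn scaleNr scalerBr opprB -/(avg_perm phi); congr (_ - _).
  by rewrite -scaler_nat scalerA mulVf ?scale1r // natr_neq0 // fact_gt0.
by apply: memvZ; apply: memv_suml => t _; apply: memvZ; apply: act_perm_rels.
Qed.

Definition flip_alt i phi : Prop := forall G, phi (flip_edge i G) = flip_sign K n * phi G.

Lemma avg_flip_alt i phi : flip_alt i (avg_flip i phi).
Proof.
have alt (x a b c : K) : x * x = 1 -> c * (b + x * a) = x * (c * (a + x * b)).
  by move=> xx; transitivity (c * ((x * x) * b + x * a)); [rewrite xx mul1r|ring].
by move=> G; rewrite !ffunE flip_edgeK; apply: alt; apply: flip_signM.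
Qed.

Lemma avg_flip_alt_other i j phi : flip_alt j phi -> flip_alt j (avg_flip i phi).
Proof.
move=> fj G; rewrite !ffunE flip_edgeC !fj.
have alt (x a b c : K) : c * (x * a + x * (x * b)) = x * (c * (a + x * b)) by ring.
exact: alt.
Qed.

Lemma avg_permE phi G :
  avg_perm phi G = (k`!)%:R^-1 * (\sum_t perm_sign t * phi (perm_edges t G) : K).
Proof.
rewrite ffunE sum_ffunE; congr (_ * _); apply: eq_bigr => t _.
by rewrite !ffunE.
Qed.

Lemma avg_perm_flip_alt phi : (forall i, flip_alt i phi) -> forall i, flip_alt i (avg_perm phi).
Proof.
move=> fl i G; rewrite !avg_permE mulrCA; congr (_ * _); rewrite mulr_sumr.
apply: eq_bigr => t _.
have -> : perm_edges t (flip_edge i G) = flip_edge (t^-1 i)%g (perm_edges t G).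
  by rewrite flip_perm_edges permKV.
by rewrite fl mulrCA.
Qed.

Lemma avg_perm_alt phi t G : avg_perm phi (perm_edges t G) = perm_sign t * avg_perm phi G.
Proof.
rewrite !avg_permE mulrCA; congr (_ * _); rewrite mulr_sumr.
rewrite (reindex_inj (mulIg (t^-1)%g)) /=; apply: eq_bigr => t' _.
rewrite perm_edgesM mulgKV perm_signM perm_signV.
by rewrite mulrA [perm_sign t' * _]mulrC.
Qed.

Lemma exists_alternating phi : exists2 psi : coeffs, phi - psi \in rels &
  (forall i, flip_alt i psi) /\ forall t G, psi (perm_edges t G) = perm_sign t * psi G.
Proof.
pose avg s := foldr avg_flip phi s.
have avg_rels s : phi - avg s \in rels.
  elim: s => [|i s IH] /=; first by rewrite subrr mem0v.
  by rewrite -[phi](subrK (avg s)) -addrA; apply: memvD => //; apply: avg_flip_rels.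
have avg_alt s i : i \in s -> flip_alt i (avg s).
  elim: s => //= j s IH; rewrite inE => /orP[/eqP->|is_]; first exact: avg_flip_alt.
  by apply: avg_flip_alt_other; apply: IH.
exists (avg_perm (avg (enum 'I_k))); last first.
  split; last exact: avg_perm_alt.
  by apply: avg_perm_flip_alt => i; apply: avg_alt; rewrite mem_enum.
rewrite -[phi](subrK (avg (enum 'I_k))) -addrA; apply: memvD => //; exact: avg_perm_rels.
Qed.

Lemma alternating_seq (psi : coeffs) :
  (forall i, flip_alt i psi) -> (forall t G, psi (perm_edges t G) = perm_sign t * psi G) ->
  alternating n k (fun s => psi (insubd (nseq_tuple k (ord0, ord0)) s)).
Proof.
move=> fl pe; pose G0 := nseq_tuple k ((ord0, ord0) : edge p).
split=> [G1 x y G2 Gk|G1 i j G2 Gk].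
  have Gk' : size (G1 ++ y :: x :: G2) = k by rewrite -Gk !size_cat.
  have lt1 : (size G1 < k)%N by rewrite -Gk size_cat /=; lia.
  have lt2 : ((size G1).+1 < k)%N by rewrite -Gk size_cat /=; lia.
  pose t := tperm (Ordinal lt1) (Ordinal lt2).
  have -> : insubd G0 (G1 ++ x :: y :: G2) = perm_edges t (insubd G0 (G1 ++ y :: x :: G2)).
    apply: eq_from_tnth => j; rewrite tnth_mktuple !(tnth_nth (ord0, ord0)) !val_insubd Gk Gk' eqxx.
    rewrite !nth_cat; case: tpermP => [->|->|/eqP j1 /eqP j2] /=.
    - by rewrite ltnn subnn ltnNge leqnSn /= subSnn.
    - by rewrite ltnn subnn ltnNge leqnSn /= subSnn.
    move: j1 j2; rewrite -!val_eqE /= => j1 j2; case: ltnP => // le.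
    case E: (j - size G1)%N => [|[|l]] //; exfalso; move: j1 j2 le E.
      by move: (nat_of_ord j) (size G1) => u v; clear; lia.
    by move: (nat_of_ord j) (size G1) => u v; clear; lia.
  rewrite pe; congr (_ * _); rewrite /perm_sign odd_tperm -val_eqE /= ltn_eqF //.
  by rewrite -[in RHS]signr_odd; case: odd.
have Gk' : size (G1 ++ (j, i) :: G2) = k by rewrite -Gk !size_cat.
have lt1 : (size G1 < k)%N by rewrite -Gk size_cat /=; lia.
have -> : insubd G0 (G1 ++ (j, i) :: G2) = flip_edge (Ordinal lt1) (insubd G0 (G1 ++ (i, j) :: G2)).
  apply: eq_from_tnth => l; rewrite tnth_mktuple !(tnth_nth (ord0, ord0)) !val_insubd Gk Gk' eqxx.
  rewrite !nth_cat -val_eqE /=; case: (ltngtP l (size G1)) => // [gt|->]; last by rewrite subnn.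
  case E: (l - size G1)%N => [|m] //; exfalso; move: gt E.
  by move: (nat_of_ord l) (size G1) => u v; clear; lia.
exact: fl.
Qed.

End Averaging.

(** * Orthogonal linear forms and injectivity *)

Lemma mem_zip2 (S T : eqType) (s : seq S) (t : seq T) x : x \in zip s t -> x.2 \in t.
Proof.
elim: s t => [|a s IH] [|b t] //=; rewrite !inE => /orP[/eqP->|/IH->] /=.
  by rewrite eqxx.
by rewrite orbT.
Qed.

Section GramSchmidt.
Variables (K : fieldType) (m : nat).
Definition bform (C : 'M[K]_m) (u v : 'rV[K]_m) : K := (u *m C *m v^T) 0 0.

Definition in_pair (T : eqType) (w : T) (x : T * T) : bool := (w == x.1) || (w == x.2).

Fixpoint hyp_frame (C : 'M[K]_m) (L : seq ('rV[K]_m * 'rV[K]_m)) : Prop :=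
  if L is x :: L' then
    [/\ bform C x.1 x.2 != 0, forall y w z, y \in L' -> in_pair w x -> in_pair z y ->
       bform C w z = 0 /\ bform C z w = 0 & hyp_frame C L']
  else True.

Lemma bformDl C u u' v : bform C (u + u') v = bform C u v + bform C u' v.
Proof. by rewrite /bform !mulmxDl mxE. Qed.

Lemma bformDr C u v v' : bform C u (v + v') = bform C u v + bform C u v'.
Proof. by rewrite /bform linearD /= mulmxDr mxE. Qed.

Lemma bform_delta C i j : bform C (delta_mx 0 i) (delta_mx 0 j) = C i j.
Proof. by rewrite /bform trmx_delta -rowE -colE !mxE. Qed.

Lemma bform0 C : (forall u v, bform C u v = 0) -> C = 0.
Proof. by move=> C0; apply/matrixP => i j; rewrite -bform_delta C0 mxE. Qed.

(* Non-degenerate on the span of the rows of U, the form splits off this span: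
   proj is the projection along it to its orthogonal complement. *)
Lemma split_off (s : K) (C : 'M[K]_m) (r k : nat) (U : 'M[K]_(r, m)) :
  C^T = s *: C -> U *m C *m U^T \in unitmx -> (r <= 2)%N -> (k.+1.*2 <= \rank C)%N ->
  exists pi : 'M[K]_m, [/\ (pi *m C)^T = s *: (pi *m C), (k.*2 <= \rank (pi *m C))%N,
    pi *m C *m U^T = 0, U *m C *m pi^T = 0 & pi *m C *m pi^T = pi *m C].
Proof.
move=> CT Nu r2 rC; set N := U *m C *m U^T in Nu.
pose pi := 1%:M - C *m U^T *m invmx N *m U; exists pi.
have piU : pi *m C *m U^T = 0.
  by rewrite /pi !mulmxBl mul1mx -!mulmxA [U *m (C *m _)]mulmxA -/N mulVmx // mulmx1 subrr.
have Upi : U *m C *m pi^T = 0.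
  have -> : U *m C *m pi^T = (pi *m C^T *m U^T)^T by rewrite !trmx_mul !trmxK mulmxA.
  by rewrite CT -scalemxAr -scalemxAl piU scaler0 trmx0.
have piCpi : pi *m C *m pi^T = pi *m C.
  rewrite {2}/pi linearB /= trmx1 mulmxBr mulmx1 !trmx_mul [in RHS]/pi.
  by rewrite !mulmxA piU !mul0mx subr0.
split=> //.
  rewrite -piCpi trmx_mul trmxK trmx_mul CT -scalemxAl -scalemxAr mulmxA.
  by [].
have : (\rank C <= \rank (pi *m C) + \rank (C *m U^T *m invmx N *m U *m C))%N.
  apply: leq_trans (mxrank_add _ _); rewrite leq_eqVlt; apply/orP; left; apply/eqP.
  by rewrite /pi mulmxBl mul1mx subrK.
have : (\rank (C *m U^T *m invmx N *m U *m C) <= r)%N.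
  apply: leq_trans (mxrankM_maxl _ _) _; apply: leq_trans (mxrankM_maxr _ _) _.
  exact: rank_leq_row.
move: rC r2; rewrite doubleS.
move: (\rank C) (\rank (pi *m C)) (\rank _) k.*2 => a b c d; lia.
Qed.

Lemma hyp_frame_map C (pi : 'M[K]_m) L : pi *m C *m pi^T = pi *m C ->
  hyp_frame (pi *m C) L -> hyp_frame C [seq (y.1 *m pi, y.2 *m pi) | y <- L].
Proof.
move=> piC; have bE w z : bform C (w *m pi) (z *m pi) = bform (pi *m C) w z.
  by rewrite /bform -piC trmx_mul !mulmxA.
elim: L => //= x L IH [x0 xL frL]; split; [by rewrite bE| |exact: IH].
move=> y w z /mapP[y' y'L ->] wx zy; have := xL y'.
by case/orP: wx => /eqP->; case/orP: zy => /eqP-> /=; rewrite !bE; apply; rewrite // /in_pair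
  eqxx ?orbT.
Qed.

Lemma exists_hyp_frame (s : K) (C : 'M[K]_m) (k : nat) : C^T = s *: C -> (k.*2 <= \rank C)%N ->
  exists2 L, size L = k & hyp_frame C L.
Proof.
elim: k C => [|k IH] C CT rC; first by exists [::].
have [r [U [u [v [Nu r2 uv uU vU]]]]] : exists r (U : 'M[K]_(r, m)) (u v : 'rV[K]_m),
    [/\ U *m C *m U^T \in unitmx, (r <= 2)%N, bform C u v != 0, (u <= U)%MS & (v <= U)%MS].
  have [[u uu]|iso] := classic (exists u, bform C u u != 0).
    exists 1%N, u, u, u; split; rewrite ?submx_refl //.
    by rewrite unitmxE det_mx11 unitfE.
  have alt u : bform C u u = 0 by apply/eqP/negPn/negP => uu; apply: iso; exists u.
  have [[u [v uv]]|C0] := classic (exists u v, bform C u v != 0); last first.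
    by move: rC; rewrite (@bform0 C) ?mxrank0 // => u v; apply/eqP/negPn/negP => uv; apply: C0;
      exists u, v.
  have vu : bform C v u = - bform C u v.
    apply/eqP; rewrite -addr_eq0 addrC.
    by have := alt (u + v); rewrite bformDl !bformDr !alt add0r addr0 => ->.
  exists (1 + 1)%N, (col_mx u v), u, v; split=> //.
  - have -> : col_mx u v *m C *m (col_mx u v)^T = block_mx 0 (bform C u v)%:M (bform C v u)%:M 0.
      rewrite tr_col_mx mul_col_mx mul_col_row; congr block_mx;
        by rewrite [LHS]mx11_scalar -/(bform _ _ _) ?alt ?scalemx0 // raddf0.
    rewrite vu; set c := bform C u v.
    have /mulmx1_unit[] // : block_mx 0 c%:M (- c)%:M 0 *m block_mx 0 (- c^-1)%:M (c^-1)%:M 0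
        = 1%:M :> 'M[K]_(1 + 1).
      rewrite mulmx_block !mul0mx !mulmx0 !addr0 !add0r -!scalar_mxM mulfV // mulrNN mulfV //.
      by rewrite [RHS](scalar_mx_block 1 1).
  - by apply/submxP; exists (row_mx 1%:M 0); rewrite mul_row_col mul0mx mul1mx addr0.
  by apply/submxP; exists (row_mx 0 1%:M); rewrite mul_row_col mul0mx mul1mx add0r.
have [pi [piT pir piU Upi piC]] := split_off CT Nu r2 rC.
have [L Lk frL] := IH _ piT pir.
exists ((u, v) :: [seq (y.1 *m pi, y.2 *m pi) | y <- L]); first by rewrite /= size_map Lk.
split=> //; last exact: hyp_frame_map.
have orthl w z : (w <= U)%MS -> bform C w (z *m pi) = 0.
  case/submxP=> D ->; rewrite /bform.
  have -> : D *m U *m C *m (z *m pi)^T = D *m (U *m C *m pi^T) *m z^T by rewrite trmx_mul !mulmxA.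
  by rewrite Upi mulmx0 mul0mx mxE.
have orthr w z : (w <= U)%MS -> bform C (z *m pi) w = 0.
  case/submxP=> D ->; rewrite /bform.
  have -> : z *m pi *m C *m (D *m U)^T = z *m (pi *m C *m U^T) *m D^T by rewrite trmx_mul !mulmxA.
  by rewrite piU mulmx0 mul0mx mxE.
have inU w : in_pair w (u, v) -> (w <= U)%MS by case/orP=> /eqP ->.
move=> y w z /mapP[y' _ ->] /inU wU /orP[] /eqP -> /=; split; [exact: orthl|exact: orthr|exact:
  orthl|exact: orthr].
Qed.

End GramSchmidt.

Section Frames.
Variables (K : fieldType) (n : nat) (V : npManifold K n).

Fixpoint lform_frame (L : seq (lform V * lform V)) : Prop :=
  if L is x :: L' then
    [/\ [/\ lform_deg x.1, lform_deg x.2 & (x.1.2 + x.2.2)%N = n], pairing x.1 x.2 != 0,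
      forall y g h, y \in L' -> in_pair g x -> in_pair h y -> pairing g h = 0 /\ pairing h g = 0
      & lform_frame L']
  else True.

Lemma frame_zip (p : nat) (es : seq (edge p)) (L : seq (lform V * lform V)) :
  lform_frame L -> frame (zip es L).
Proof.
elim: L es => [|x L IH] [|e es] //= [[d1 d2 dn] _ xL frL]; split; last exact: IH.
have orth_x g : in_pair g x -> orth g (zip es L).
  move=> gx [e' y] /mem_zip2 /= yL.
  have [a1 b1] : pairing g y.1 = 0 /\ pairing y.1 g = 0 by apply: (xL y); rewrite /in_pair ?eqxx.
  have [a2 b2] : pairing g y.2 = 0 /\ pairing y.2 g = 0.
    by apply: (xL y); rewrite /in_pair ?eqxx ?orbT.
  by split.
by split=> //; apply: orth_x; rewrite /in_pair eqxx ?orbT.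
Qed.

Lemma prod_edge_coef (p : nat) (es : seq (edge p)) (L : seq (lform V * lform V)) :
  lform_frame L -> \prod_(E <- zip es L) edge_coef E != 0.
Proof.
elim: L es => [|x L IH] [|e es] /=; rewrite ?big_nil ?oner_neq0 // => -[_ x0 _ frL].
by rewrite big_cons mulf_neq0 ?IH // mulf_neq0 // signr_eq0.
Qed.

Definition coord_lform (c : coord V) : lform V := ([ffun c' => (c' == c)%:R], cdeg c).

Lemma pairing_coord c c' : pairing (coord_lform c) (coord_lform c') = weight c c'.
Proof.
rewrite /pairing (bigD1 (c, c')) //= !ffunE !eqxx !mulr1 big1 ?addr0 // => -[d d'] /=.
rewrite xpair_eqE !ffunE negb_and => /orP[] /negbTE ->; by rewrite ?mul0r ?mulr0.
Qed.

Lemma lform_deg_coord c : lform_deg (coord_lform c).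
Proof. by move=> c'; rewrite ffunE; case: (c' =P c) => [->|]; rewrite ?eqxx. Qed.

Definition pair_lforms (a : 'I_(dx_pairs V)) := (coord_lform (Psi a), coord_lform (Chi a)).

Lemma frame_pairs (r : seq 'I_(dx_pairs V)) : uniq r -> lform_frame (map pair_lforms r).
Proof.
elim: r => //= a r IH /andP[ar ur]; split; last exact: IH.
- split; try exact: lform_deg_coord.
  by apply: (@weight_deg _ _ _ (Psi a) (Chi a)); rewrite /= eqxx oner_neq0.
- by rewrite pairing_coord /= eqxx oner_neq0.
move=> y g h /mapP[b br ->] ga hb.
have ab : (a == b) = false by apply: contraNF ar => /eqP ->.
have ba : (b == a) = false by rewrite eq_sym.
by case/orP: ga => /eqP ->; case/orP: hb => /eqP -> /=; rewrite !pairing_coord /= ?ab ?ba.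
Qed.

Definition xi_lform (u : 'rV[K]_(dx_xi V)) : lform V :=
  ([ffun c => if c is Xi a then u 0 a else 0], n./2).

Lemma lform_deg_xi u : lform_deg (xi_lform u).
Proof. by move=> [a|a|a]; rewrite ffunE ?eqxx. Qed.

Lemma pairing_xi u v : pairing (xi_lform u) (xi_lform v) = bform (invmx (dx_kappa V)) u v.
Proof.
rewrite /pairing -(pair_bigA _ (fun c c' => weight c c' * ((xi_lform u).1 c * (xi_lform v).1
  c'))) /=.
rewrite sum_coord [X in X + _ + _]big1 ?add0r => [|a _]; last first.
  by apply: big1 => c _; rewrite ffunE mul0r mulr0.
rewrite [X in X + _]big1 ?add0r => [|a _]; last first.
  by apply: big1 => c _; rewrite ffunE mul0r mulr0.
rewrite /bform mxE; under [RHS]eq_bigr => b _ do rewrite !mxE mulr_suml.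
rewrite [RHS]exchange_big /=; apply: eq_bigr => a _.
rewrite sum_coord [X in X + _ + _]big1 ?add0r => [|b _]; last by rewrite /= mul0r.
rewrite [X in X + _]big1 ?add0r => [|b _]; last by rewrite /= mul0r.
by apply: eq_bigr => b _; rewrite !ffunE /=; ring.
Qed.

Lemma frame_xi L : odd n = false -> hyp_frame (invmx (dx_kappa V)) L ->
  lform_frame [seq (xi_lform x.1, xi_lform x.2) | x <- L].
Proof.
move=> on; elim: L => //= x L IH [x0 xL frL]; split; last exact: IH.
- split; try exact: lform_deg_xi.
  by rewrite /= addnn halfK on subn0.
- by rewrite pairing_xi.
move=> y g h /mapP[z zL ->] gx hz.
by case/orP: gx => /eqP ->; case/orP: hz => /eqP -> /=; rewrite !pairing_xi;
  apply: (xL z) => //; rewrite /in_pair eqxx ?orbT.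
Qed.

Lemma exists_frame (k : nat) : (4 * k <= np_dim V)%N ->
  exists2 L, size L = k & lform_frame L.
Proof.
rewrite /np_dim => dimV; have [kp|pk] := leqP k (dx_pairs V).
  exists (map pair_lforms (take k (enum 'I_(dx_pairs V)))); last first.
    by apply: frame_pairs; rewrite take_uniq // enum_uniq.
  by rewrite size_map size_takel // size_enum_ord.
have kx : (k.*2 <= dx_xi V)%N by lia.
have [k0|k0] := posnP k; first by exists [::]; rewrite ?k0.
have on : odd n = false.
  by apply/negP => /(dx_xi_odd V) xi0; move: kx; rewrite xi0; lia.
have CT : (invmx (dx_kappa V))^T = - (-1) ^+ n./2 *: invmx (dx_kappa V).
  by apply/matrixP => a b; rewrite !mxE inv_kappa_sym.
have rC : (k.*2 <= \rank (invmx (dx_kappa V)))%N.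
  by rewrite mxrank_unit // unitmx_inv dx_kappa_unit.
have [L Lk frL] := exists_hyp_frame CT rC.
exists [seq (xi_lform x.1, xi_lform x.2) | x <- L]; first by rewrite size_map.
exact: frame_xi.
Qed.

End Frames.

Lemma suspK (K : fieldType) (n : nat) (V : npManifold K n) (p : nat) :
  involutive (@susp K n V p).
Proof.
move=> x; apply/ffunP => i; rewrite [LHS]ffunE !tpar_susp muln0 muln1 scale1r signrZK !tparE.
by case: (odd n); rewrite /= ?fpar_add // addrC fpar_add.
Qed.

Lemma sRep_injective (K : fieldType) (charK : [pchar K] =i pred0) (n : nat) (g h : fgc K) :
  ~ (forall p, gra_eq n.+1 (g p) (h p)) ->
  exists r : nat, forall V : npManifold K n, (r <= np_dim V)%N ->
    ~ (forall p x, sRep V g p x = sRep V h p x).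
Proof.
move=> /not_all_ex_not[p gh]; pose D k : {ffun k.-tuple (edge p) -> K^o} :=
  [ffun G : k.-tuple (edge p) => (g p G - h p G : K^o)].
have exk : exists k, D k \notin <<edge_rels K n.+1 p k>>%VS.
  by have [k Dk] := not_all_ex_not _ _ gh; exists k; apply/negP.
case: (ex_minnP exk) => k Dk k_min; exists (4 * k)%N => V dimV sgh.
have [L Lk frL] := exists_frame dimV.
have [psi D_psi [psi_flip psi_perm]] := exists_alternating n charK (D k).
have [G0 psi0] : exists G0, psi G0 != 0.
  apply/existsP; apply: contraNT Dk => /existsPn psi0.
  have -> : D k = D k - psi; last exact: D_psi.
  by rewrite (_ : psi = 0) ?subr0 //; apply/ffunP => G; rewrite ffunE; apply/eqP; rewrite -[_
    == _]negbK psi0.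
pose S := zip (rev G0) L; have frS : frame S by apply: frame_zip.
have Sk : size S = k by rewrite size_zip size_rev size_tuple Lk minnn.
have E0 : dedge V p by exact: ((ord0, ord0), ((0, 0%N), (0, 0%N))).
pose f := state S.
have vanish (u : gra K p) : rep_vanish u f k.+1.
  by move=> G ltkG; rewrite (rep_state_vanish E0 frS) ?scaler0 // Sk.
have tsumD j : tsum j (fun G => g p G *: rep_graph V G f) - tsum j (fun G => h p G *: rep_graph
  V G f)
    = \sum_G D j G *: rep_graph V G f.
  by rewrite /tsum -sumrB; apply: eq_bigr => G _; rewrite ffunE scalerBl.
have : Rep (g p) f - Rep (h p) f = 0.
  by apply/eqP; rewrite subr_eq0 -[f]suspK; apply/eqP/(sgh p).
rewrite !(RepE (vanish _)) -sumrB big_ord_recr /= big1 ?add0r => [|j _]; last first.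
  rewrite tsumD rep_span //; apply/negPn/negP => /k_min.
  by rewrite leqNgt ltn_ord.
pose psis s := psi (insubd (nseq_tuple k (ord0, ord0)) s).
have -> : tsum k (fun G => g p G *: rep_graph V G f) - tsum k (fun G => h p G *: rep_graph V G f)
    = tsum k (fun G => psis G *: rep_graph V G f).
  rewrite tsumD; apply/eqP; rewrite -subr_eq0 -sumrB; apply/eqP.
  rewrite -[RHS](rep_span f D_psi); apply: eq_bigr => G _.
  by rewrite /psis valKd -scalerBl !ffunE.
rewrite (wick_sum E0 (alternating_seq psi_flip psi_perm) frS Sk) => /eqP.
rewrite scaler_eq0 oner_eq0 orbF !mulf_eq0 (negbTE (prod_edge_coef _ frL)) orbF.
rewrite (negbTE (natr_neq0 charK _)) ?muln_gt0 ?expn_gt0 ?fact_gt0 //=.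
have -> : [seq E.1 | E <- S] = rev G0.
  by rewrite -[map _ _]/(unzip1 S) unzip1_zip // size_rev size_tuple Lk.
by rewrite revK valKd (negbTE psi0).
Qed.

Theorem proposition4p4 (K : fieldType) (charK : [pchar K] =i pred0) (n : nat) :
  (forall V : npManifold K n,
     @dgl_morphism K (fGC K n.+1) (CE_Tpoly V) (sRep V)) /\
  (forall (m : int) (g h : dgl_car (fGC K n.+1)),
     dgl_deg m g -> dgl_deg m h -> ~ dgl_eq g h ->
     exists r : nat, forall V : npManifold K n, (r <= np_dim V)%N ->
       ~ @dgl_eq K (CE_Tpoly V) (sRep V g) (sRep V h)).
Proof.
split=> [V|m g h _ _]; first exact: sRep_morphism.
exact: sRep_injective.
Qed.
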